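(* Formulas of depth $\log n/(\log\log n)^{O(1)}$ solving $\mathrm{STCONN}(k(n))$ have size $n^{\Omega(\log k)}$ for all $k(n) \le \log\log n$.
   Context: Formulas are unbounded fan-in boolean formulas (AND/OR gates, NOT only at the leaves); size is the number of leaves. For $k:\mathbb N\to\mathbb N$ with $k(n)\le n$, $\mathrm{STCONN}(k(n))$ (distance $k(n)$ connectivity) is the problem: given a directed graph on $n$ vertices with specified vertices $s$ and $t$, decide whether there is a path of length at most $k(n)$ from $s$ to $t$. *)

(* Defs.v *)
From HB Require Import structures.
From mathcomp Require Import all_boot all_order all_algebra.
From mathcomp Require Import all_classical all_reals all_analysis.

Set Implicit Arguments.
Unset Strict Implicit.
Unset Printing Implicit Defensive.

Import Order.TTheory GRing.Theory Num.Theory.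
Import numFieldNormedType.Exports.

(* [Lit b x] is the literal x if b = true and its negation if b = false.
   Gates have arbitrary fan-in m.+1 >= 1; a gate of fan-in 0 is a constant and
   is represented by the leaf [Const]. *)
Inductive formula (V : Type) : Type :=
| Const of bool
| Lit of bool & V
| And (m : nat) of ('I_m.+1 -> formula V)
| Or (m : nat) of ('I_m.+1 -> formula V).

Section Formula.
Variable V : Type.

Fixpoint feval (a : V -> bool) (F : formula V) : bool :=
  match F with
  | Const b => b
  | Lit b x => if b then a x else ~~ a x
  | And _ fs => [forall i, feval a (fs i)]
  | Or _ fs => [exists i, feval a (fs i)]
  end.

Fixpoint fsize (F : formula V) : nat :=
  match F with
  | Const _ | Lit _ _ => 1
  | And m fs | Or m fs => \sum_(i < m.+1) fsize (fs i)
  end.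

Fixpoint fdepth (F : formula V) : nat :=
  match F with
  | Const _ | Lit _ _ => 0
  | And m fs | Or m fs => (\max_(i < m.+1) fdepth (fs i)).+1
  end.

End Formula.

(* The edge set of a digraph on 'I_n is an arbitrary relation. In MathComp's
   [path e s p] the vertex sequence is s :: p, so that [size p] is the number
   of edges. *)
Definition stconn (n k : nat) (s t : 'I_n) (e : rel 'I_n) : Prop :=
  exists p : seq 'I_n, [/\ path e s p, last s p = t & (size p <= k)%N].

(* The input variables are the entries of the n x n adjacency matrix. *)
Definition solves_stconn (n k : nat) (s t : 'I_n)
    (F : formula ('I_n * 'I_n)) : Prop :=
  forall e : rel 'I_n, feval (fun uv => e uv.1 uv.2) F <-> stconn k s t e.

(* As [ln] is 0 outside the positive reals, log2 0 = 0. *)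
Definition log2 (R : realType) (x : R) : R := (ln x / ln 2)%R.

(* Main.v *)
(** Restrict attention to layered graphs with k+1 layers of N vertices, N being a fixed
    power of n.  An embedding picks one vertex in every layer, hence a potential path from
    [s] to [t].  For a Boolean function g and a set H of positions on the path, consider
    the density of the embeddings for which g, with edges of the embedded path planted in
    a random background graph, depends on all the edges at the positions in H.

    By the switching lemma every gate of a small-depth formula becomes, under a random
    restriction, a function of few edges; so for a gate this density is at most
    n^o(1) N^-c, where c is the number of connected components of H.  Make all gates
    binary.  A gate depending on H has children depending on sets with union H, and one
    shows by induction that for a formula with L leaves the density is at most
    L n^o(1) N^(-v/16), where v is either 16 c or the logarithm of the length of an interval
    of H plus 16 times the number of components elsewhere.  Indeed, splitting a long
    interval into two sets leaves a long interval in one of them or creates many components.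
    A formula for distance k connectivity depends on the whole path for half of the
    embeddings, so L is at least N^(log k / 16 - O(1)) n^-o(1). *)

Require Import Defs.
From HB Require Import structures.
From mathcomp Require Import all_boot all_order all_algebra all_fingroup.
From mathcomp Require Import zify ring lra.
From mathcomp Require Import boolp.

Set Implicit Arguments.
Unset Strict Implicit.
Unset Printing Implicit Defensive.

Import Order.TTheory GRing.Theory Num.Theory.

(** * Decision trees under restrictions *)

(** The hard split is the one in which both sets cover most of the interval and each has a single
    component inside it. Bounding the two children one after the other would multiply their leaf
    counts and give only a bound for L^2. Instead one child is followed down to a subformula whose
    set [B] holds between about a quarter and a half of the interval. The product bound for [B] and
    the other child is combined, by a geometric mean, with the bound for [H] that counts components
    only and carries no leaf count. The result is again linear in L.

    A component is worth 16 doublings of length: enough to repay constant factors and the factor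
    2^(j+1) in length lost to [j] components. An end of the interval beyond which [H] continues
    costs 2 doublings.

    One background graph has to serve all gates at once. So graph and restriction are drawn
    together, each edge keeping a hidden state; given the graph, every edge is still free with
    probability at least P/(2N), where P is the star probability. Averaging then yields a graph that
    is good for every gate. *)

Section Restrictions.
Variable E : finType.

Definition cube := {ffun E -> bool}.
Definition restr := {ffun E -> option bool}.

Definition fill (s : restr) (x : cube) : cube :=
  [ffun e => odflt (x e) (s e)].

Definition comp (s r : restr) : restr :=
  [ffun e => if s e is Some b then Some b else r e].

Definition upd (x : cube) (e : E) (b : bool) : cube :=
  [ffun e' => if e' == e then b else x e'].

Implicit Types (s r C : restr) (x y : cube) (e : E) (f g : cube -> bool).

Lemma fill_comp s r x : fill (comp s r) x = fill s (fill r x).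
Proof. by apply/ffunP=> e; rewrite !ffunE; case: (s e). Qed.

Lemma upd_id x e : upd x e (x e) = x.
Proof. by apply/ffunP=> e'; rewrite ffunE; case: eqP => // ->. Qed.

Lemma fill_upd_none s x e b :
  s e = None -> fill s (upd x e b) = upd (fill s x) e b.
Proof.
by move=> h; apply/ffunP=> e'; rewrite !ffunE; case: eqP => // ->; rewrite h.
Qed.

(* [dtle t f]: [f] is computed by a decision tree of depth at most [t]. *)
Fixpoint dtle (t : nat) (f : cube -> bool) : Prop :=
  (forall x y, f x = f y) \/
  (if t is t'.+1 then exists e, forall b, dtle t' (fun x => f (upd x e b))
   else False).

Lemma dtle_const t f : (forall x y, f x = f y) -> dtle t f.
Proof. by case: t => [|t] h; left. Qed.

Lemma dtle_ext t f g : f =1 g -> dtle t f -> dtle t g.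
Proof.
elim: t f g => [|t IH] f g fg /= [h|].
- by left=> x y; rewrite -!fg.
- by [].
- by left=> x y; rewrite -!fg.
- case=> e h; right; exists e => b; apply: IH (h b) => x; exact: fg.
Qed.

Lemma dtle_leq t u f : t <= u -> dtle t f -> dtle u f.
Proof.
elim: t u f => [|t IH] [|u] f // tu [] // h; try by left.
case: h => e h; right; exists e => b; apply: IH (h b); exact: tu.
Qed.

Lemma dtle_neg t f : dtle t f -> dtle t (fun x => ~~ f x).
Proof.
elim: t f => [|t IH] f /= [h|].
- by left=> x y; rewrite (h x y).
- by [].
- by left=> x y; rewrite (h x y).
- case=> e h; right; exists e => b; exact: IH (h b).
Qed.

Lemma dtle_fill t f s : dtle t f -> dtle t (fun x => f (fill s x)).
Proof.
elim: t f => [|t IH] f [h|] //; try by left=> x y; exact: h.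
case=> e h; case se: (s e) => [c|].
- apply: (@dtle_leq t) => //; apply: dtle_ext (IH _ (h c)) => x.
  by congr f; apply/ffunP=> e'; rewrite !ffunE; case: eqP => // ->; rewrite se.
- right; exists e => b; apply: dtle_ext (IH _ (h b)) => x.
  by rewrite fill_upd_none.
Qed.

Definition dep (f : cube -> bool) : {set E} :=
  [set e | [exists x, f (upd x e true) != f (upd x e false)]].

Lemma dep_upd f e : dep f \subset e |: (dep (fun x => f (upd x e true))
    :|: dep (fun x => f (upd x e false))).
Proof.
apply/subsetP=> e'; rewrite !inE => /existsP[x nx].
case: (eqVneq e' e) => //= ne.
have C b c : upd (upd x e' b) e c = upd (upd x e c) e' b.
  apply/ffunP=> y; rewrite !ffunE; case: (eqVneq y e) => // ->.
  by rewrite eq_sym (negbTE ne).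
have K b : upd x e' b = upd (upd x e' b) e (x e).
  apply/ffunP=> y; rewrite !ffunE; case: (eqVneq y e) => // ->.
  by rewrite eq_sym (negbTE ne).
rewrite (K true) (K false) in nx.
by case: (x e) nx => nx; apply/orP; [left|right]; apply/existsP; exists x.
Qed.

(** A binary tree of depth [t] has fewer than [2 ^ t] inner nodes, each querying one variable. *)
Lemma card_dep t f : dtle t f -> #|dep f| < 2 ^ t.
Proof.
have d0 g : (forall x y, g x = g y) -> dep g = set0.
  move=> h; apply/setP=> e; rewrite !inE; apply/existsP=> -[x].
  by rewrite (h _ (upd x e false)) eqxx.
elim: t f => [|t IH] f [h|] //; try by rewrite d0 // cards0 expn_gt0.
case=> e h; have h1 := IH _ (h true); have h2 := IH _ (h false).
have hs := subset_leq_card (dep_upd f e).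
apply: (leq_ltn_trans hs).
rewrite cardsU1; apply: leq_ltn_trans (leq_add (leq_b1 _) (leq_card_setU _ _).1) _.
by rewrite expnS mul2n -addnn add1n -addSn -addnS leq_add.
Qed.

(* A term of a DNF is encoded as the least restriction that satisfies it. *)
Definition tsat (C : restr) (x : cube) : bool :=
  [forall e, if C e is Some b then x e == b else true].
Definition tvars (C : restr) : {set E} := [set e | C e != None].
Definition dnf (F : seq restr) (x : cube) : bool := has (fun C => tsat C x) F.

(** One term for each path to an accepting leaf. *)
Lemma dtle_dnf t f : dtle t f ->
  exists2 F : seq restr, all (fun C => #|tvars C| <= t) F & f =1 dnf F.
Proof.
have cst u g : (forall x y, g x = g y) -> exists2 F : seq restr,
    all (fun C => #|tvars C| <= u) F & g =1 dnf F.
  move=> h; have [x gx|nx] := pickP g.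
    exists [:: [ffun => None]] => [|y].
      rewrite /= andbT; suff -> : tvars [ffun => None] = set0 by rewrite cards0.
      by apply/setP=> e; rewrite !inE ffunE.
    rewrite (h y x) gx /dnf /= orbF; symmetry; apply/forallP=> e.
    by rewrite ffunE.
  by exists [::] => // y; rewrite nx.
elim: t f => [|t IH] f /= [h|]; try exact: cst; first by [].
case=> e h.
(* On the branch [e = b] every term receives the literal for [e]; terms demanding the opposite value
   are dropped. *)
pose add b (C : restr) : restr := [ffun e' => if e' == e then Some b else C e'].
have one b : exists2 F : seq restr, all (fun C => #|tvars C| <= t.+1) F &
   forall x, dnf F x = (x e == b) && f (upd x e b).
  have [F wF eF] := IH _ (h b).
  exists [seq add b C | C <- F & C e != Some (~~ b)].
    rewrite all_map; apply/allP=> C; rewrite mem_filter => /andP[_ CF] /=.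
    have -> : tvars (add b C) = e |: tvars C.
      by apply/setP=> e'; rewrite !inE ffunE; case: (eqVneq e' e).
    by rewrite cardsU1; exact: leq_add (leq_b1 _) (allP wF C CF).
  move=> x; rewrite eF; apply/hasP/andP.
    case=> C' /mapP[C]; rewrite mem_filter => /andP[nC CF] -> /forallP h1.
    have /eqP xb : x e == b by have := h1 e; rewrite ffunE eqxx.
    rewrite xb eqxx; split=> //; apply/hasP; exists C => //; apply/forallP=> e'.
    have := h1 e'; rewrite !ffunE; case: (eqVneq e' e) => // -> _.
    by case: (C e) nC => // c; rewrite xb; case: (c); case: (b).
  case=> /eqP xb /hasP[C CF /forallP h1]; exists (add b C).
    apply: map_f; rewrite mem_filter CF andbT; apply/eqP=> Ce.
    by have := h1 e; rewrite Ce xb; case: (b).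
  apply/forallP=> e'; rewrite ffunE; case: (eqVneq e' e) => [->|ne].
    by rewrite xb.
  exact: h1 e'.
have [F1 w1 e1] := one true; have [F2 w2 e2] := one false.
exists (F1 ++ F2); first by rewrite all_cat w1.
move=> x; rewrite /dnf has_cat -!/(dnf _ _) e1 e2.
by case xe: (x e); rewrite /= -xe upd_id ?orbF.
Qed.

Definition falsified (C s : restr) : bool :=
  [exists e, if C e is Some b then s e == Some (~~ b) else false].
Definition stars (C s : restr) : {set E} :=
  [set e | (C e != None) && (s e == None)].
Definition setv (s : restr) (V A : {set E}) : restr :=
  [ffun e => if e \in V then Some (e \in A) else s e].

(* Depth of the canonical decision tree of the DNF [F] under the restriction [s]. *)
Fixpoint cdt (F : seq restr) (s : restr) : nat :=
  if F is C :: F' then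
    if falsified C s then cdt F' s
    else if stars C s == set0 then 0
    else #|stars C s| + \max_(A in powerset (stars C s)) cdt F' (setv s (stars C s) A)
  else 0.

Lemma setv0 s (A : {set E}) : setv s set0 A = s.
Proof. by apply/ffunP=> e; rewrite ffunE inE. Qed.

(** Query all of [V]; the set [A] records the variables answered true. *)
Lemma dtle_queries t f s (V : {set E}) :
  (forall e, e \in V -> s e = None) ->
  (forall A : {set E}, A \subset V -> dtle t (fun x => f (fill (setv s V A) x))) ->
  dtle (#|V| + t) (fun x => f (fill s x)).
Proof.
move: {2}#|V| (erefl #|V|) => n; elim: n s V => [|n IH] s V cV hs hd.
  have V0 : V = set0 by apply/eqP; rewrite -cards_eq0 cV.
  rewrite V0 cards0; apply: dtle_ext (hd set0 (sub0set _)) => x.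
  by rewrite V0 setv0.
have [e eV] : exists e, e \in V by apply/card_gt0P; rewrite cV.
rewrite (cardsD1 e) eV addSn; right; exists e => b.
pose s' : restr := [ffun e' => if e' == e then Some b else s e'].
have cV' : #|V :\ e| = n by move: cV; rewrite (cardsD1 e) eV => -[].
apply: (@dtle_ext _ (fun x => f (fill s' x))) => [x|].
  congr f; apply/ffunP=> e'; rewrite !ffunE; case: (eqVneq e' e) => // ->.
  by rewrite hs.
apply: IH => // [e'|A sA].
  by rewrite !inE ffunE => /andP[/negbTE -> /hs].
pose A' := if b then e |: A else A.
have sA' : A' \subset V.
  have sAV : A \subset V by apply: subset_trans sA (subD1set _ _).
  by rewrite /A'; case: b {s' A'} => //; rewrite subUset sub1set eV.
apply: dtle_ext (hd A' sA') => x; congr f; apply/ffunP=> e'; rewrite !ffunE !inE.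
have eA : e \in A = false.
  by apply/negbTE/negP=> /(subsetP sA); rewrite !inE eqxx.
case: (eqVneq e' e) => [->|ne] /=.
  by rewrite eV /A'; case: (b) => /=; rewrite ?inE ?eqxx ?eA.
by rewrite /A'; case: (b) => //; rewrite !inE (negbTE ne).
Qed.

Lemma dnf_cons C F x : dnf (C :: F) x = tsat C x || dnf F x.
Proof. by []. Qed.

Lemma falsified_tsat C s x : falsified C s -> tsat C (fill s x) = false.
Proof.
case/existsP=> e; case Ce: (C e) => [b|] // /eqP se.
apply/negP=> /forallP /(_ e); rewrite Ce ffunE se /=; by case: (b).
Qed.

Lemma nostar_tsat C s x : ~~ falsified C s -> stars C s = set0 -> tsat C (fill s x).
Proof.
move=> /existsPn nf st; apply/forallP=> e; have := nf e.
case Ce: (C e) => [b|] //; rewrite ffunE.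
have : e \notin stars C s by rewrite st inE.
rewrite inE Ce /=; case: (s e) => // c _; rewrite /=; by case: (b); case: (c).
Qed.

(** Once its free variables are set, a term is decided: if it is falsified the tree for the
    remaining terms takes over, otherwise the DNF is true. [cdt] charges the remaining terms in both
    cases, which can only overestimate the depth. *)
Lemma dtle_cdt F s : dtle (cdt F s) (fun x => dnf F (fill s x)).
Proof.
elim: F s => [|C F IH] s; first by apply: dtle_const.
rewrite [cdt _ _]/=; case: ifPn => [fa|nf].
  by apply: dtle_ext (IH s) => x; rewrite dnf_cons falsified_tsat.
case: ifPn => [/eqP st|st].
  by apply: dtle_const => x y; rewrite !dnf_cons !nostar_tsat.
apply: (dtle_queries (f := dnf (C :: F))) => [e|A sA]; first by rewrite inE => /andP[_ /eqP].
set V := stars C s in sA *.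
apply: (@dtle_leq (cdt F (setv s V A))).
  by rewrite (bigD1 A) ?powersetE //= leq_maxl.
have [fa|nf'] := boolP (falsified C (setv s V A)).
  by apply: dtle_ext (IH _) => x; rewrite dnf_cons falsified_tsat.
apply: dtle_const => x y; rewrite !dnf_cons !nostar_tsat //;
 by apply/setP=> e; rewrite !inE !ffunE; case: ifPn; rewrite ?andbF // inE => /negbTE.
Qed.

End Restrictions.

(** * Components of unions of path segments *)

(* [lia] preprocesses every hypothesis; dropping those on sets keeps it fast. *)
Ltac nat_lia :=
  repeat match goal with
  | H : is_true (_ \subset _) |- _ => clear H
  | H : is_true (_ \in _) |- _ => clear H
  | H : is_true (_ \notin _) |- _ => clear H
  | H : context [#|_|] |- _ => clear H
  | H : @eq ?T _ _ |- _ =>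
      lazymatch T with nat => fail | bool => fail | _ => clear H end
  | H : forall _, _ |- _ => clear H
  | H := _ |- _ => clear H
  end; lia.

Section Components.
Variable k : nat.
Implicit Types (H X B W : {set 'I_k}) (x y z : 'I_k) (a b c d i : nat).

(* Edge [i] of the path joins the vertices [i] and [i.+1]. *)
Definition itv a b : {set 'I_k} := [set x : 'I_k | a <= x < b].
(** Membership for an arbitrary number, so that the position just after an interval can be tested
    even when it equals [k]. *)
Definition nm H i : bool := [exists x : 'I_k, (x == i :> nat) && (x \in H)].

(** The maximal run of [H] through [x], described by convexity; it is empty when [x] is not in
    [H]. *)
Definition cpt H x : {set 'I_k} :=
  [set y : 'I_k | [forall z : 'I_k, (minn x y <= z <= maxn x y) ==> (z \in H)]].
(** Only components lying wholly in [W] count: with [W] the edges without fixed endpoint, these are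
    the components none of whose vertices is fixed. *)
Definition cpts H W : {set {set 'I_k}} :=
  [set cpt H x | x in H & cpt H x \subset W].
Definition cc H W : nat := #|cpts H W|.

(** The edges, those of [B] included, that lose an endpoint when the vertices of [B] are fixed. *)
Definition touch B : {set 'I_k} :=
  [set z : 'I_k | [exists x in B, (x <= z.+1) && (z <= x.+1)]].

Lemma nmE H x : nm H x = (x \in H).
Proof.
apply/existsP/idP=> [[y /andP[/eqP /val_inj -> //]]|xH].
by exists x; rewrite eqxx.
Qed.

Lemma nmP H i : reflect (exists2 x : 'I_k, x = i :> nat & x \in H) (nm H i).
Proof.
by apply: (iffP existsP) => [[x /andP[/eqP <- xH]]|[x <- xH]]; exists x; rewrite ?eqxx.
Qed.

Lemma nm_lt H i : nm H i -> i < k.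
Proof. by case/nmP=> x <- _. Qed.

Lemma cptP H x y :
  reflect (forall z : 'I_k, (minn x y <= z <= maxn x y) -> z \in H) (y \in cpt H x).
Proof. by rewrite inE; apply: (iffP forallP) => h z; apply/implyP; exact: h. Qed.

Lemma cpt_refl H x : x \in H -> x \in cpt H x.
Proof. by move=> xH; apply/cptP=> z hz; suff -> : z = x by []; apply: val_inj => /=; lia. Qed.

Lemma cpt_sub H x : cpt H x \subset H.
Proof. by apply/subsetP=> y /cptP; apply; rewrite geq_minr leq_maxr. Qed.

Lemma cpt_trans H x y z : y \in cpt H x -> z \in cpt H y -> z \in cpt H x.
Proof.
move=> /cptP h1 /cptP h2; apply/cptP=> t ht.
have [h|h] := boolP (minn x y <= t <= maxn x y); first exact: h1.
by apply: h2; lia.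
Qed.

Lemma cpt_sym H x y : y \in cpt H x -> x \in cpt H y.
Proof. by move=> /cptP h; apply/cptP=> z hz; apply: h; rewrite minnC maxnC. Qed.

Lemma cpt_eq H x y : y \in cpt H x -> cpt H y = cpt H x.
Proof.
move=> h; apply/setP=> z; apply/idP/idP; first exact: cpt_trans.
exact/cpt_trans/cpt_sym.
Qed.

Lemma cpt_adj H x y : x \in H -> y \in H -> x <= y.+1 -> y <= x.+1 -> y \in cpt H x.
Proof.
move=> xH yH h1 h2; apply/cptP=> z hz.
have [e|e] : z = x \/ z = y; last 2 first.
- by rewrite e.
- by rewrite e.
have [e|e] : nat_of_ord z = x \/ nat_of_ord z = y by lia.
  by left; apply: val_inj.
by right; apply: val_inj.
Qed.

Lemma cpt_sub_mono B H x : B \subset H -> cpt B x \subset cpt H x.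
Proof.
by move=> BH; apply/subsetP=> y /cptP h; apply/cptP=> z /h; exact: subsetP.
Qed.

Lemma cptsP H W (C : {set 'I_k}) :
  reflect (exists x, [/\ x \in H, cpt H x \subset W & C = cpt H x]) (C \in cpts H W).
Proof.
apply: (iffP imsetP) => [[x]|[x [xH xW ->]]].
  by rewrite inE => /andP[xH xW] ->; exists x.
by exists x; rewrite ?inE ?xH.
Qed.

Lemma cc_mono H W W' : W \subset W' -> cc H W <= cc H W'.
Proof.
move=> WW; apply/subset_leq_card/subsetP=> C /cptsP[x [xH xW ->]].
by apply/cptsP; exists x; split=> //; exact: subset_trans WW.
Qed.

Lemma cc_disjoint H W1 W2 : [disjoint W1 & W2] -> cc H W1 + cc H W2 <= cc H (W1 :|: W2).
Proof.
move=> dW; have <- : #|cpts H W1 :|: cpts H W2| = cc H W1 + cc H W2.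
  rewrite cardsU (_ : cpts H W1 :&: cpts H W2 = set0) ?cards0 ?subn0 //.
  apply/setP=> C; rewrite inE in_set0; apply/negP=> /andP[/cptsP[x [xH xW ->]]].
  case/cptsP=> y [yH yW exy].
  have := disjointFr dW (subsetP xW _ (cpt_refl xH)).
  by rewrite (subsetP yW) // -exy cpt_refl.
apply/subset_leq_card/subsetP=> C; rewrite inE => /orP[] /cptsP[x [xH xW ->]];
 by apply/cptsP; exists x; split=> //; apply: subset_trans xW _;
    rewrite ?subsetUl ?subsetUr.
Qed.

(** A component of [H] that meets [B] contains a component of [B], from which [Phi] recovers it. One
    that misses [B] cannot even be adjacent to [B], so it avoids [touch B]. *)
Lemma cc_touch H B W : B \subset H -> cc H W <= cc B W + cc H (W :\: touch B).
Proof.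
move=> BH.
pose Phi (C : {set 'I_k}) : {set 'I_k} := if [pick x in C] is Some x then cpt H x else set0.
have : cpts H W \subset (Phi @: cpts B W) :|: cpts H (W :\: touch B).
  apply/subsetP=> C /cptsP[x [xH xW ->]]; rewrite inE.
  have [/exists_inP[y yC yB]|/exists_inPn nB] := boolP [exists y in cpt H x, y \in B].
    apply/orP; left; apply/imsetP; exists (cpt B y).
      apply/cptsP; exists y; split=> //; apply: subset_trans (cpt_sub_mono _ BH) _.
      by rewrite (cpt_eq yC).
    rewrite /Phi; case: pickP => [z zC|/(_ y)]; last by rewrite cpt_refl.
    have zH : z \in cpt H y by apply: subsetP zC; exact: cpt_sub_mono.
    by rewrite (cpt_eq zH) (cpt_eq yC).
  apply/orP; right; apply/cptsP; exists x; split=> //.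
  apply/subsetP=> z zC; rewrite inE (subsetP xW) // andbT inE.
  apply/exists_inPn=> y yB; apply/negP=> /andP[h1 h2].
  have yC : y \in cpt H x.
    have zH := subsetP (cpt_sub H x) _ zC.
    by apply: (cpt_trans zC); apply: cpt_adj => //; exact: (subsetP BH).
  by have := nB y yC; rewrite yB.
move/subset_leq_card/leq_trans; apply.
apply: leq_trans (leq_card_setU _ _).1 _.
by rewrite leq_add2r leq_imset_card.
Qed.

Lemma touch_sub B : B \subset touch B.
Proof.
by apply/subsetP=> x xB; rewrite inE; apply/exists_inP; exists x; rewrite ?leqnSn.
Qed.

(** The number of ends at which [H] continues beyond [itv a b], called stuck ends below. A nonempty
    interval contained in [H] is a component of [H] when this is 0. *)
Definition st H a b : nat := ((0 < a) && nm H a.-1) + nm H b.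

Lemma nm_sub B H i : B \subset H -> nm B i -> nm H i.
Proof. by move=> /subsetP BH /nmP[x <- xB]; rewrite nmE BH. Qed.

Lemma st_mono B H a b : B \subset H -> st B a b <= st H a b.
Proof.
move=> BH; apply: leq_add.
  by case: (0 < a) => //=; case h: (nm B _) => //; rewrite (nm_sub BH h).
by case h: (nm B _) => //; rewrite (nm_sub BH h).
Qed.

Lemma st_le2 H a b : st H a b <= 2.
Proof. by rewrite /st; case: (_ && _); case: nm. Qed.

Lemma card_itv a b : b <= k -> #|itv a b| = b - a.
Proof.
elim: b => [|b IH] bk.
  by rewrite sub0n; apply: eq_card0 => x; rewrite inE andbF.
have [ab|ab] := leqP a b; last first.
  by rewrite (eqP ab); apply: eq_card0 => x; rewrite !inE; lia.
have -> : itv a b.+1 = Ordinal bk |: itv a b.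
  apply/setP=> x; rewrite !inE.
  have -> : (x == Ordinal bk) = (nat_of_ord x == b) by [].
  move: (nat_of_ord x) => i; lia.
rewrite cardsU1 IH ?(ltnW bk) // inE /= ltnn andbF; lia.
Qed.

Lemma cpt_itv H x : x \in H -> exists c d,
  [/\ c <= x < d, d <= k, cpt H x = itv c d,
      ~~ ((0 < c) && nm H c.-1) & ~~ nm H d].
Proof.
move=> xH.
have exm : exists c, nm (cpt H x) c by exists x; rewrite nmE cpt_refl.
have exM : exists d, nm (cpt H x) d by exists x; rewrite nmE cpt_refl.
have ubM d : nm (cpt H x) d -> d <= k by move/nm_lt/ltnW.
case: (ex_minnP exm) => c cC cmin; case: (ex_maxnP exM ubM) => d dC dmax.
case/nmP: cC => c' ec c'C; case/nmP: dC => d' ed d'C.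
have cx : c <= x by apply: cmin; rewrite nmE cpt_refl.
have xd : x <= d by apply: dmax; rewrite nmE cpt_refl.
exists c, d.+1; split.
- by rewrite cx ltnS xd.
- by rewrite -ed.
- apply/setP=> y; rewrite [RHS]inE ltnS; apply/idP/idP=> [yC|/andP[cy yd]].
    by rewrite cmin ?dmax // nmE.
  apply/cptP=> z hz; move/cptP: c'C => hc; move/cptP: d'C => hd.
  have [zx|xz] := leqP z x; first by apply: hc; rewrite ec; lia.
  by apply: hd; rewrite ed; lia.
- apply/negP=> /andP[c0 /nmP[y ey yH]].
  suff : c <= c.-1 by lia.
  apply: cmin; apply/nmP; exists y => //.
  have c'H := subsetP (cpt_sub H x) _ c'C.
  by apply: (cpt_trans c'C); apply: cpt_adj => //; lia.
- apply/negP=> /nmP[y ey yH].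
  suff : d.+1 <= d by lia.
  apply: dmax; apply/nmP; exists y => //.
  have d'H := subsetP (cpt_sub H x) _ d'C.
  by apply: (cpt_trans d'C); apply: cpt_adj => //; lia.
Qed.

Lemma itvE a b x : (x \in itv a b) = (a <= x < b).
Proof. by rewrite inE. Qed.

Lemma itv_sub a b c d : a <= c -> d <= b -> itv c d \subset itv a b.
Proof. by move=> ac db; apply/subsetP=> x; rewrite !itvE; lia. Qed.

Lemma cpt_of_itv X c d x : itv c d \subset X -> x \in itv c d -> d <= k ->
  st X c d = 0 -> cpt X x = itv c d.
Proof.
move=> sX; rewrite itvE => hx dk; rewrite /st => s0.
apply/setP=> y; apply/idP/idP=> [/cptP hy|yI]; last first.
  apply/cptP=> z hz; apply: (subsetP sX); move: yI; rewrite !itvE; nat_lia.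
rewrite itvE; apply/andP; split.
  rewrite leqNgt; apply/negP=> yc.
  have ck : c.-1 < k by nat_lia.
  have h : nm X c.-1 by rewrite -[c.-1]/(nat_of_ord (Ordinal ck)) nmE; apply: hy => /=; nat_lia.
  by move: s0; rewrite h; nat_lia.
rewrite ltnNge; apply/negP=> yd.
have ck : d < k by have := ltn_ord y; nat_lia.
have h : nm X d by rewrite -[d]/(nat_of_ord (Ordinal ck)) nmE; apply: hy => /=; nat_lia.
by move: s0; rewrite h; nat_lia.
Qed.

(** A longest component has at least the average length. *)
Lemma max_cpt H x : x \in H -> exists2 y, y \in H &
  #|H| <= #|cpts H setT| * #|cpt H y|.
Proof.
move=> xH; have [y yH ymax] := @arg_maxnP _ x (fun y => y \in H) (fun y => #|cpt H y|) xH.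
exists y => //; apply: (@leq_trans (\sum_(C in cpts H setT) #|C|)).
  apply: leq_trans (leq_card_cover _); apply/subset_leq_card/subsetP=> z zH.
  apply/bigcupP; exists (cpt H z); last exact: cpt_refl.
  by apply/cptsP; exists z; rewrite subsetT.
rewrite -sum_nat_const; apply: leq_sum => C /cptsP[z [zH _ ->]]; exact: ymax.
Qed.

(** A run of [X] inside the interval is a component of [X] unless it is cut off at an end where [X]
    continues. So there are at most [cc + st] runs, and a longest one is taken. *)
Lemma pieces X a b : b <= k -> X :&: itv a b != set0 -> exists c d,
  [/\ a <= c, c < d, d <= b, itv c d \subset X &
    [/\ #|X :&: itv a b| <= (cc X (itv a b) + st X a b) * (d - c),
        c = a \/ ~~ nm X c.-1 & d = b \/ ~~ nm X d]].
Proof.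
move=> bk /set0Pn[x0 x0Y]; set Y := X :&: itv a b in x0Y *.
have [x xY hx] := max_cpt x0Y.
have YX : Y \subset X by rewrite subsetIl.
have struct y : y \in Y -> exists c d, [/\ c <= y < d, cpt Y y = itv c d, a <= c, d <= b &
   [/\ itv c d \subset X, c = a \/ ~~ nm X c.-1 & d = b \/ ~~ nm X d]].
  move=> yY; have [c [d [cyd dk eC nl nr]]] := cpt_itv yY.
  have sI : itv c d \subset Y by rewrite -eC cpt_sub.
  have h1 z : c <= z < d -> z \in Y by move=> hz; apply: (subsetP sI); rewrite itvE.
  have ck : c < k by nat_lia.
  have dk' : d.-1 < k by nat_lia.
  have ac : a <= c.
    by have := h1 (Ordinal ck); rewrite /= !inE /=; nat_lia.
  have db : d <= b.
    by have := h1 (Ordinal dk'); rewrite /= !inE /=; nat_lia.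
  exists c, d; split=> //; split; first exact: subset_trans YX.
    have [|ca] := eqVneq c a; [by left|right].
    apply: contra nl => /nmP[z ez zX]; apply/andP; split; first nat_lia.
    by apply/nmP; exists z => //; rewrite !inE zX ez; nat_lia.
  have [|ca] := eqVneq d b; [by left|right].
  apply: contra nr => /nmP[z ez zX].
  by apply/nmP; exists z => //; rewrite !inE zX ez; nat_lia.
have hcard : #|cpts Y setT| <= cc X (itv a b) + st X a b.
  (* The runs cut off by the left and by the right end, at most one each. *)
  pose TL := [set cpt Y z | z in [set z : 'I_k | (z == a :> nat) && ((0 < a) && nm X a.-1)]].
  pose TR := [set cpt Y z | z in [set z : 'I_k | (z == b.-1 :> nat) && nm X b]].
  have c1 (i : nat) (be : bool) : #|[set z : 'I_k | (z == i :> nat) && be]| <= be.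
    case: be => /=.
      case: (ltnP i k) => ik.
        rewrite -(cards1 (Ordinal ik)); apply/subset_leq_card/subsetP=> z.
        by rewrite !inE andbT => /eqP h; apply/eqP/val_inj.
      rewrite (_ : [set _ | _] = set0) ?cards0 //; apply/setP=> z; rewrite !inE.
      by have := ltn_ord z; nat_lia.
    by rewrite (_ : [set _ | _] = set0) ?cards0 //; apply/setP=> z; rewrite !inE andbF.
  have : cpts Y setT \subset cpts X (itv a b) :|: (TL :|: TR).
    apply/subsetP=> C /cptsP[y [yY _ ->]].
    have [c [d [cyd eC ac db [sX hc hd]]]] := struct y yY.
    rewrite !inE; have [/andP[/eqP ca la]|nla] := boolP ((c == a) && ((0 < a) && nm X a.-1)).
      apply/orP; right; apply/orP; left; apply/imsetP.
      have ck : c < k by nat_lia.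
      exists (Ordinal ck); first by rewrite inE /= ca eqxx la.
      by apply/esym/cpt_eq; rewrite eC itvE /=; nat_lia.
    have [/andP[/eqP ca la]|nra] := boolP ((d == b) && nm X b).
      apply/orP; right; apply/orP; right; apply/imsetP.
      have ck : d.-1 < k by nat_lia.
      exists (Ordinal ck); first by rewrite inE /= ca eqxx la.
      by apply/esym/cpt_eq; rewrite eC itvE /=; nat_lia.
    apply/orP; left; apply/cptsP; exists y.
    have <- : cpt X y = cpt Y y.
      rewrite eC; apply: cpt_of_itv => //; rewrite ?itvE ?cyd //; first by nat_lia.
      rewrite /st; apply/eqP; rewrite addn_eq0 !eqb0; apply/andP; split.
        by case: hc nla => [->|/negbTE ->]; rewrite ?eqxx ?andbF.
      by case: hd nra => [->|/negbTE ->]; rewrite ?eqxx ?andbF.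
    split=> //; first exact: (subsetP YX).
    rewrite (_ : cpt X y = itv c d); first exact: itv_sub.
    apply: cpt_of_itv => //; rewrite ?itvE ?cyd //; first by nat_lia.
    rewrite /st; apply/eqP; rewrite addn_eq0 !eqb0; apply/andP; split.
      by case: hc nla => [->|/negbTE ->]; rewrite ?eqxx ?andbF.
    by case: hd nra => [->|/negbTE ->]; rewrite ?eqxx ?andbF.
  move/subset_leq_card/leq_trans; apply.
  apply: leq_trans (leq_card_setU _ _).1 _; rewrite leq_add2l.
  apply: leq_trans (leq_card_setU _ _).1 _.
  by apply: leq_add; apply: leq_trans (leq_imset_card _ _) _; exact: c1.
have [c [d [cyd eC ac db [sX hc hd]]]] := struct x xY.
exists c, d; split=> //; first by nat_lia.
split=> //; apply: leq_trans hx _; rewrite eC card_itv ?(leq_trans db) //.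
by rewrite leq_mul2r hcard orbT.
Qed.

(** Removing a run destroys at most the one component it belongs to. If the run has a stuck end,
    that component leaves [itv a b] and was never counted. *)
Lemma pieces_rest X a b c d : a <= c -> c < d -> d <= b -> b <= k ->
  itv c d \subset X -> c = a \/ ~~ nm X c.-1 -> d = b \/ ~~ nm X d ->
  cc X (itv a b) <= cc X (itv a b :\: itv c d) + (st X c d == 0).
Proof.
move=> ac cd db bk sX hc hd.
have ck : c < k by nat_lia.
have key x : x \in X -> cpt X x \subset itv a b -> ~~ (cpt X x \subset itv a b :\: itv c d) ->
   Ordinal ck \in cpt X x.
  move=> xX xI /subsetPn[z zC]; rewrite inE (subsetP xI) // andbT negbK => zI.
  apply: cpt_trans zC _; apply/cptP=> t ht; apply: (subsetP sX).
  by move: zI ht; rewrite !itvE /=; nat_lia.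
have [s0|s1] := eqVneq (st X c d) 0.
  rewrite addn1; have : cpts X (itv a b) \subset cpt X (Ordinal ck) |: cpts X (itv a b :\: itv c d).
    apply/subsetP=> C /cptsP[x [xX xI ->]]; rewrite in_setU1.
    have [h|h] := boolP (cpt X x \subset itv a b :\: itv c d).
      by apply/orP; right; apply/cptsP; exists x.
    by rewrite -(cpt_eq (key x xX xI h)) eqxx.
  move/subset_leq_card/leq_trans; apply.
  by rewrite cardsU1 -add1n leq_add2r leq_b1.
rewrite addn0; apply/subset_leq_card/subsetP=> C /cptsP[x [xX xI ->]].
apply/cptsP; exists x; split=> //; apply: contraT => h; have hk := key x xX xI h.
case/eqP: s1; rewrite /st; apply/eqP; rewrite addn_eq0 !eqb0; apply/andP; split.
  apply/negP=> /andP[c0 /nmP[z ez zX]]; case: hc => [ca|]; last by rewrite -ez nmE zX.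
  have zC : z \in cpt X x.
    by apply: (cpt_trans hk); apply: cpt_adj => //; [apply: (subsetP sX); rewrite itvE /=; nat_lia| |] => /=; nat_lia.
  by have := subsetP xI _ zC; rewrite itvE; nat_lia.
apply/negP=> /nmP[z ez zX]; case: hd => [ca|]; last by rewrite -ez nmE zX.
have dk : d.-1 < k by nat_lia.
have dC : Ordinal dk \in cpt X x.
  by apply: (cpt_trans hk); apply/cptP=> t ht; apply: (subsetP sX); move: ht; rewrite itvE /=; nat_lia.
have zC : z \in cpt X x.
  by apply: (cpt_trans dC); apply: cpt_adj => //; [apply: (subsetP sX); rewrite itvE /=; nat_lia| |] => /=; nat_lia.
by have := subsetP xI _ zC; rewrite itvE; nat_lia.
Qed.

(** Two successive gaps of [X] in the interval are separated by a component of [X], so there are at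
    most [cc + 1] gaps. The [2] pays for the two outermost positions of a longest gap, which may
    share a vertex with [X]. *)
Lemma gap X a b : a <= b -> b <= k -> exists c d,
  [/\ a <= c, c <= d, d <= b, itv c d \subset itv a b :\: touch X &
      b - a <= #|X :&: itv a b| + (cc X (itv a b)).+1 * (d - c + 2)].
Proof.
move=> ab bk; set M := itv a b :\: X.
have cM : #|M| + #|X :&: itv a b| = b - a.
  by rewrite -(card_itv a bk) -(cardsID X (itv a b)) setIC addnC.
have [M0|/set0Pn[x0 x0M]] := eqVneq M set0.
  exists a, a; split=> //; last by rewrite -cM M0 cards0 add0n leq_addr.
  by apply/subsetP=> x; rewrite itvE; nat_lia.
have [x xM hx] := max_cpt x0M.
have [c [d [cxd dk eC nl nr]]] := cpt_itv xM.
have hT : #|cpts M setT| <= (cc X (itv a b)).+1.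
  (* The last positions of the gaps. All but the very last one, [m], are followed by a component of
     [X] inside the interval, and [g] sends them injectively to these components. *)
  pose Ends := [set y in M | ~~ nm M y.+1].
  have h1 : cpts M setT \subset [set cpt M y | y in Ends].
    apply/subsetP=> C /cptsP[y [yM _ ->]].
    have [c' [d' [cyd dk' eC' _ nr']]] := cpt_itv yM.
    have ck : d'.-1 < k by nat_lia.
    have h : Ordinal ck \in cpt M y by rewrite eC' itvE /=; nat_lia.
    apply/imsetP; exists (Ordinal ck); last by rewrite (cpt_eq h).
    rewrite inE (subsetP (cpt_sub _ _) _ h) /= prednK //; nat_lia.
  apply: leq_trans (subset_leq_card h1) _; apply: leq_trans (leq_imset_card _ _) _.
  have [E0|/set0Pn[e0 e0E]] := eqVneq Ends set0; first by rewrite E0 cards0.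
  have [m mE mmax] := @arg_maxnP _ e0 (fun y => y \in Ends) (fun y : 'I_k => y : nat) e0E.
  rewrite (cardsD1 m) mE add1n ltnS.
  pose g (y : 'I_k) := if [pick w : 'I_k | w == y.+1 :> nat] is Some w then cpt X w else set0.
  have gE y : y \in Ends :\ m -> exists w : 'I_k, [/\ w = y.+1 :> nat, w \in X, g y = cpt X w & y < m].
    rewrite !inE => /and3P[ym /andP[yX yI] ny].
    have lym : y < m.
      rewrite ltn_neqAle; apply/andP; split; first exact: ym.
      by apply: (mmax y); rewrite !inE yX yI.
    have wk : y.+1 < k by have := ltn_ord m; nat_lia.
    exists (Ordinal wk); split=> //.
      apply: contraNT ny => nX; apply/nmP; exists (Ordinal wk) => //.
      by rewrite !inE nX /=; move: mE; rewrite !inE => /andP[/andP[_ mI] _]; nat_lia.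
    rewrite /g; case: pickP => [w /eqP hw|/(_ (Ordinal wk))]; last by rewrite eqxx.
    by congr cpt; apply: val_inj.
  rewrite -(card_in_imset (f := g)).
    apply/subset_leq_card/subsetP=> C /imsetP[y yE ->].
    have [w [ew wX -> lym]] := gE y yE; apply/cptsP; exists w; split=> //.
    apply/subsetP=> z /cptP hz; move: yE; rewrite !inE => /and3P[_ /andP[yX yI] _].
    have := mE; rewrite !inE => /andP[/andP[mX mI] _].
    have zy : y < z.
      by rewrite ltnNge; apply/negP=> zy; move/negP: yX; apply; apply: hz; nat_lia.
    have zm : z < m.
      by rewrite ltnNge; apply/negP=> mz; move/negP: mX; apply; apply: hz; nat_lia.
    nat_lia.
  have gsym y y' : y \in Ends :\ m -> y' \in Ends :\ m -> y < y' -> g y = g y' -> False.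
    move=> yE y'E yy'.
    have [w [ew wX -> lym]] := gE y yE; have [w' [ew' w'X -> lym']] := gE y' y'E.
    move=> eg; have /cptP h : w' \in cpt X w by rewrite eg cpt_refl.
    by move: y'E; rewrite !inE => /and3P[_ /andP[/negP yX _] _]; apply: yX; apply: h; nat_lia.
  move=> y y' yE y'E eg; apply: val_inj => /=.
  have [|h|//] := ltngtP y y'; first by move=> /(gsym _ _ yE y'E)/(_ eg).
  by case: (gsym _ _ y'E yE h (esym eg)).
have sM : itv c d \subset M by rewrite -eC cpt_sub.
have inM z : c <= z < d -> z \in M by move=> hz; apply: (subsetP sM); rewrite itvE.
have ck : c < k by nat_lia.
have dk' : d.-1 < k by nat_lia.
have ac : a <= c by have := inM (Ordinal ck); rewrite /= !inE /=; nat_lia.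
have db : d <= b by have := inM (Ordinal dk'); rewrite /= !inE /=; nat_lia.
have hM : #|M| <= (cc X (itv a b)).+1 * (d - c).
  by apply: leq_trans hx _; rewrite eC card_itv // leq_mul2r hT orbT.
have [cd2|cd2] := leqP 2 (d - c); last first.
  exists a, a; split=> //; first by apply/subsetP=> z; rewrite itvE; nat_lia.
  rewrite -cM addnC leq_add2l; apply: leq_trans hM _; rewrite leq_mul2l; nat_lia.
exists c.+1, d.-1; split; try nat_lia.
  apply/subsetP=> z; rewrite [z \in itv _ _]itvE inE [z \in itv _ _]itvE => hz; apply/andP; split; last by nat_lia.
  rewrite inE; apply/exists_inPn=> y yX; apply/negP=> hy.
  by have := inM y; rewrite inE yX; nat_lia.
rewrite -cM addnC leq_add2l; apply: leq_trans hM _; rewrite leq_mul2l; nat_lia.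
Qed.

End Components.

(** * Splitting an interval between two sets *)

Section Step.
Variable k : nat.
Implicit Types (H X Y B W : {set 'I_k}) (a b c d r v : nat).

(* The exponents [v] for which the density of dependence on [H] is bounded by N^(-v/16) when
   [W] consists of the edges with no fixed endpoint. *)
Definition good H W v : Prop :=
  v <= 16 * cc H W \/
  exists a b r, [/\ b <= k, itv k a b \subset H :&: W, 2 ^ (r + 2 * st H a b) <= b - a
    & v <= r + 16 * cc H (W :\: itv k a b)].

Lemma setDD_sub (T : finType) (A B C : {set T}) : B \subset A -> C \subset B ->
  (A :\: B) :|: (B :\: C) \subset A :\: C.
Proof.
move=> BA CB; apply/subsetP=> x; rewrite !inE.
case xB: (x \in B); case xC: (x \in C) => //=.
- by rewrite (subsetP BA).
- by rewrite (subsetP CB) in xB.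
- by rewrite orbF.
Qed.

Lemma setD_disj (T : finType) (A B C : {set T}) : [disjoint A :\: B & B :\: C].
Proof.
rewrite -setI_eq0; apply/eqP/setP=> x; rewrite !inE.
by case: (x \in B); rewrite /= ?andbF.
Qed.

(** A component of [H] outside [I] either is charged to a component of [X] inside it or avoids
    [touch X]. The components of [X] in [I :\: I'] are disjoint from those charged. *)
Lemma account1 H X W (I I' : {set 'I_k}) : X \subset H -> I \subset W -> I' \subset I ->
  cc H (W :\: I) + cc X (I :\: I') <= cc X (W :\: I') + cc H (W :\: touch X).
Proof.
move=> XH IW I'I; have h1 := cc_touch (W :\: I) XH.
have h2 : cc H (W :\: I :\: touch X) <= cc H (W :\: touch X).
  by apply: cc_mono; apply: setSD; apply: subsetDl.
have h3 : cc X (W :\: I) + cc X (I :\: I') <= cc X (W :\: I').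
  apply: leq_trans (cc_disjoint _ (setD_disj _ _ _)) _.
  by apply: cc_mono; exact: setDD_sub.
move: (cc H _) (cc H (W :\: I :\: _)) (cc X (W :\: I)) h1 h2 h3 => *; nat_lia.
Qed.

(** The same charging, first to [X] and then to [Y]. *)
Lemma account2 H X Y W (I : {set 'I_k}) : X \subset H -> Y \subset H ->
  cc H (W :\: I) <= cc X (W :\: I) + cc Y (W :\: I :\: touch X) + cc H (W :\: touch X :\: touch Y).
Proof.
move=> XH YH; have h1 := cc_touch (W :\: I) XH.
have h2 := cc_touch (W :\: I :\: touch X) YH.
have h3 : cc H (W :\: I :\: touch X :\: touch Y) <= cc H (W :\: touch X :\: touch Y).
  by apply: cc_mono; do 2 apply: setSD; apply: subsetDl.
apply: leq_trans h1 _; rewrite -addnA leq_add2l; apply: leq_trans h2 _.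
by rewrite leq_add2l.
Qed.

(* Ways to bound the density of dependence on [H] for a gate whose children depend on [X]
   and [Y]: use the bound for [X] and the components of [H] away from [X] (A); use only the
   components of [X], then the bound for [Y] with [X] fixed (B); descend from [X] to a
   subformula depending on a set [B] that contains about [m] elements of [I], and take the
   geometric mean of the bound for [B] then [Y] and of the trivial bound for [H] (C). *)
Definition ruleA H X W v := exists2 v', good X W v' & v <= v' + 16 * cc H (W :\: touch X).
Definition ruleB H X Y W v := exists2 v', good Y (W :\: touch X) v' &
  v <= 16 * cc X W + v' + 16 * cc H (W :\: touch X :\: touch Y).
Definition ruleC H X Y W v := exists (I : {set 'I_k}) (m : nat), 0 < m < #|X :&: I| /\
  forall B, B \subset X -> #|B :&: I| <= m -> m < 2 * #|B :&: I| ->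
    ruleA H B W v \/
    exists v1 v2, [/\ good B W v1, good Y (W :\: touch B) v2 &
      2 * v <= v1 + v2 + 16 * cc H (W :\: touch B :\: touch Y) + 16 * cc H W].

(** [X] already breaks the interval into so many components that they outweigh its length. *)
Lemma ruleA_small H X W a b r v : X \subset H -> itv k a b \subset W ->
  v <= r + 16 * cc H (W :\: itv k a b) -> r <= 16 * cc X (itv k a b) ->
  ruleA H X W v.
Proof.
move=> XH IW hv hr; exists (16 * cc X W); first by left.
have h1 := cc_touch (W :\: itv k a b) XH.
have h2 : cc H (W :\: itv k a b :\: touch X) <= cc H (W :\: touch X).
  by apply: cc_mono; apply: setSD; apply: subsetDl.
have h3 : cc X (W :\: itv k a b) + cc X (itv k a b) <= cc X W.
  apply: leq_trans (cc_disjoint _ _) _; first by rewrite disjoints_subset subsetDr.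
  by apply: cc_mono; rewrite subUset subsetDl.
move: (cc X _) (cc H _) (cc H _) (cc H _) (cc X _) (cc X _) h1 h2 h3 hv hr => *; nat_lia.
Qed.

(** Shrinking the interval to a part contained in [X] loses [r - r'] doublings, repaid by the
    components of [X] in the rest. *)
Lemma ruleA_itv H X W a b c d r r' v : X \subset H -> itv k a b \subset W ->
  v <= r + 16 * cc H (W :\: itv k a b) ->
  d <= k -> a <= c -> d <= b -> itv k c d \subset X ->
  2 ^ (r' + 2 * st X c d) <= d - c ->
  r <= r' + 16 * cc X (itv k a b :\: itv k c d) ->
  ruleA H X W v.
Proof.
move=> XH IW hv dk ac db sX h2 hr.
have sI : itv k c d \subset itv k a b by exact: itv_sub.
exists (r' + 16 * cc X (W :\: itv k c d)).
  right; exists c, d, r'; split=> //.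
  by rewrite subsetI sX (subset_trans sI).
have h1 := account1 XH IW sI.
move: (cc X _) (cc H _) (cc H _) (cc X _) h1 hv hr => *; nat_lia.
Qed.

(** A long gap of [X] lies in [Y] and away from [touch X], so the components of [X] followed by this
    gap give rule B; the [4] doublings in reserve cover two stuck ends. If every gap is short, the
    gaps fill at most a quarter of the interval. *)
Lemma stuck H X Y W a b r v : X :|: Y = H ->
  b <= k -> itv k a b \subset H :&: W -> 2 ^ r <= b - a ->
  v <= r + 16 * cc H (W :\: itv k a b) -> 0 < cc X (itv k a b) ->
  [\/ ruleA H X W v, ruleB H X Y W v |
      16 * cc X (itv k a b) < r /\ 3 * (b - a) <= 4 * #|X :&: itv k a b|].
Proof.
move=> eH bk; rewrite subsetI => /andP[IH IW] hl hv j0.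
have XH : X \subset H by rewrite -eH subsetUl.
have YH : Y \subset H by rewrite -eH subsetUr.
have [hr|hr] := leqP r (16 * cc X (itv k a b)); first by constructor 1; exact: (ruleA_small XH IW hv hr).
have ab : a <= b by rewrite ltnW // -subn_gt0 (leq_trans _ hl) ?expn_gt0.
have [c [d [ac cd db sI hg]]] := gap X ab bk.
have [hd|hd] := leqP (2 ^ (r - 16 * cc X (itv k a b) + 4)) (d - c); last first.
  constructor 3; split=> //.
  have hj : (cc X (itv k a b)).+1 <= 2 ^ cc X (itv k a b) by exact: ltn_expl.
  move: (cc X _) (#|_|) hr j0 hg hd hj => j x hr j0 hg hd hj.
  (* In the exponent, [- 16 j + 5 + j + 2] is negative for [j >= 1]. *)
  have e1 : 2 ^ (r - 16 * j + 5) * 2 ^ j * 4 <= 2 ^ r.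
    rewrite -expnD -[4]/(2 ^ 2) -expnD leq_exp2l //; nat_lia.
  have e2 : d - c + 2 <= 2 ^ (r - 16 * j + 5).
    rewrite (addnS _ 4) expnS; have : 1 < 2 ^ (r - 16 * j + 4) by rewrite -{1}(expn0 2) ltn_exp2l //; nat_lia.
    nat_lia.
  have e3 : j.+1 * (d - c + 2) <= 2 ^ j * 2 ^ (r - 16 * j + 5) by exact: leq_mul.
  nat_lia.
constructor 2; have sY : itv k c d \subset Y.
  apply/subsetP=> x xI; have := subsetP sI _ xI; rewrite in_setD => /andP[xt xI'].
  have := subsetP IH _ xI'; rewrite -eH inE => /orP[xX|//].
  by rewrite (subsetP (touch_sub X)) in xt.
have sI' : itv k c d \subset itv k a b by exact: itv_sub.
exists (r - 16 * cc X (itv k a b) + 16 * cc Y (W :\: touch X :\: itv k c d)).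
  right; exists c, d, (r - 16 * cc X (itv k a b)); split=> //.
  - exact: leq_trans db bk.
  - rewrite subsetI sY; apply: subset_trans sI _; exact: setSD.
  - apply: leq_trans hd; rewrite leq_exp2l // leq_add2l.
    by rewrite (leq_mul2l 2 _ 2) st_le2.
have h1 := account2 W (itv k a b) XH YH.
have h2 : cc Y (W :\: itv k a b :\: touch X) <= cc Y (W :\: touch X :\: itv k c d).
  apply: cc_mono; apply/subsetP=> x; rewrite !in_setD => /and3P[-> xI ->].
  by rewrite !andbT; apply: contra xI; exact: subsetP.
have h3 : cc X (W :\: itv k a b) + cc X (itv k a b) <= cc X W.
  apply: leq_trans (cc_disjoint _ _) _; first by rewrite disjoints_subset subsetDr.
  by apply: cc_mono; rewrite subUset subsetDl.
move: (cc X (itv k a b)) (cc X _) (cc H _) (cc H _) (cc Y _) (cc X _) (cc Y _) h1 h2 h3 hv hr => *; nat_lia.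
Qed.

Lemma cc_gt0 X W x : x \in X -> cpt X x \subset W -> 0 < cc X W.
Proof. by move=> xX xW; apply/card_gt0P; exists (cpt X x); apply/cptsP; exists x. Qed.

(** If [H] stopped at [b], the run of [X] through the last position would be a component inside the
    interval or would cover the interval. *)
Lemma ext_right H X a b (x : 'I_k) : X \subset H -> x = b.-1 :> nat -> a < b -> b <= k ->
  x \in X -> cc X (itv k a b) = 0 -> ~~ (itv k a b \subset X) -> nm H b.
Proof.
move=> XH ex ab bk xX j0 nI; apply: contraT => nb.
have [c [d [cxd dk eC nl nr]]] := cpt_itv xX.
have sX : itv k c d \subset X by rewrite -eC cpt_sub.
have db : d = b.
  apply/eqP; rewrite eqn_leq; apply/andP; split; last by nat_lia.
  rewrite leqNgt; apply: contra nb => bd; have bk' : b < k by nat_lia.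
  apply/nmP; exists (Ordinal bk') => //; apply: (subsetP XH); apply: (subsetP sX).
  by rewrite itvE /=; nat_lia.
have [ac|ca] := leqP a c.
  have := @cc_gt0 X (itv k a b) x xX; rewrite j0 => h; apply: h.
  by rewrite eC db; apply: itv_sub.
case/negP: nI; apply: subset_trans sX; rewrite db; apply: itv_sub => //; exact: ltnW.
Qed.

Lemma ext_left H X a b (x : 'I_k) : X \subset H -> x = a :> nat -> a < b -> b <= k ->
  x \in X -> cc X (itv k a b) = 0 -> ~~ (itv k a b \subset X) -> (0 < a) && nm H a.-1.
Proof.
move=> XH ex ab bk xX j0 nI; apply: contraT => nb.
have [c [d [cxd dk eC nl nr]]] := cpt_itv xX.
have sX : itv k c d \subset X by rewrite -eC cpt_sub.
have ca : c = a.
  apply/eqP; rewrite eqn_leq; apply/andP; split; first by nat_lia.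
  rewrite leqNgt; apply: contra nb => bd; have bk' : a.-1 < k by nat_lia.
  apply/andP; split; first by nat_lia.
  apply/nmP; exists (Ordinal bk') => //; apply: (subsetP XH); apply: (subsetP sX).
  by rewrite itvE /=; nat_lia.
have [db|bd] := leqP d b.
  have := @cc_gt0 X (itv k a b) x xX; rewrite j0 => h; apply: h.
  by rewrite eC ca; apply: itv_sub.
case/negP: nI; apply: subset_trans sX; rewrite ca; apply: itv_sub => //; exact: ltnW.
Qed.

Lemma no_inner H H1 H2 a b : H1 :|: H2 = H -> a < b -> b <= k -> itv k a b \subset H ->
  cc H1 (itv k a b) = 0 -> cc H2 (itv k a b) = 0 ->
  ~~ (itv k a b \subset H1) -> ~~ (itv k a b \subset H2) -> st H a b = 2.
Proof.
move=> eH ab bk IH j1 j2 n1 n2.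
have H1H : H1 \subset H by rewrite -eH subsetUl.
have H2H : H2 \subset H by rewrite -eH subsetUr.
have ak : a < k by nat_lia.
have bk' : b.-1 < k by nat_lia.
have hl : (0 < a) && nm H a.-1.
  have : Ordinal ak \in H by apply: (subsetP IH); rewrite itvE /=; nat_lia.
  rewrite -eH inE eH => /orP[] h; first exact: (@ext_left _ _ a b (Ordinal ak) H1H).
  exact: (@ext_left _ _ a b (Ordinal ak) H2H).
have hr : nm H b.
  have : Ordinal bk' \in H by apply: (subsetP IH); rewrite itvE /=; nat_lia.
  rewrite -eH inE eH => /orP[] h; first exact: (@ext_right _ _ a b (Ordinal bk') H1H).
  exact: (@ext_right _ _ a b (Ordinal bk') H2H).
by rewrite /st hl hr.
Qed.

Lemma st_piece X a b c d : c = a \/ ~~ nm X c.-1 -> d = b \/ ~~ nm X d ->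
  st X c d <= st X a b.
Proof.
move=> hc hd; rewrite /st; apply: leq_add.
  by case: hc => [->|/negbTE ->]; rewrite ?andbF.
by case: hd => [->|/negbTE ->].
Qed.

Lemma st_piece1 X a b c d : c = a \/ ~~ nm X c.-1 -> d = b \/ ~~ nm X d ->
  itv k c d \subset X -> ~~ (itv k a b \subset X) -> st X c d <= 1.
Proof.
move=> hc hd sX nI; rewrite /st.
case: hc => [ec|/negbTE ->]; last by rewrite andbF; case: nm.
case: hd => [ed|/negbTE ->]; last by rewrite addn0; case: (_ && _).
by rewrite ec ed in sX; rewrite sX in nI.
Qed.

(** The longest run of [X] loses at most [j + 1] doublings. They are repaid by 16 for each other
    component, or by the 2 doublings of a stuck end of [H] that the run does not have. Nothing
    repays them only when [j = 1] and the interval has no stuck end. *)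
Lemma one_inner H X Y W a b r v : X :|: Y = H ->
  b <= k -> itv k a b \subset H :&: W -> 2 ^ (r + 2 * st H a b) <= b - a ->
  v <= r + 16 * cc H (W :\: itv k a b) -> 0 < cc X (itv k a b) ->
  [\/ ruleA H X W v, ruleB H X Y W v |
      [/\ st H a b = 0, cc X (itv k a b) = 1, 16 < r & 3 * (b - a) <= 4 * #|X :&: itv k a b|]].
Proof.
move=> eH bk IHW hl hv j0.
have hl' : 2 ^ r <= b - a by apply: leq_trans hl; rewrite leq_exp2l // leq_addr.
have [hA|hB|[hr h3]] := stuck eH bk IHW hl' hv j0; [by constructor 1|by constructor 2|].
have [IH IW] := andP (etrans (esym (subsetI _ _ _)) IHW).
have XH : X \subset H by rewrite -eH subsetUl.
have ba0 : 0 < b - a by apply: leq_trans hl'; rewrite expn_gt0.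
have Y0 : X :&: itv k a b != set0.
  by apply: contraTneq h3 => ->; rewrite cards0 muln0 -ltnNge muln_gt0.
have [c [d [ac cd db sX [hcd hc hd]]]] := pieces bk Y0.
have hst := st_piece hc hd.
have hst2 := st_le2 X a b.
have hstH : st X a b <= st H a b := st_mono a b XH.
have hrest := pieces_rest ac cd db bk sX hc hd.
set j := cc X (itv k a b) in j0 hr hcd hrest *.
have hj : j.+1 <= 2 ^ j by exact: ltn_expl.
(* Three quarters of the length are shared by at most [j + 2] runs; this is tight for [j = 1]. *)
have hj2 : 4 * (j + 2) <= 3 * 2 ^ j.+1.
  move: j0 hj; clear; case: j => // -[|j] // _; rewrite !expnS => h; nat_lia.
have hlen : b - a <= 2 ^ j.+1 * (d - c).
  have e1 : (j + st X a b) * (d - c) <= (j + 2) * (d - c) by rewrite leq_mul2r leq_add2l hst2 orbT.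
  have e2 : 4 * (j + 2) * (d - c) <= 3 * 2 ^ j.+1 * (d - c) by rewrite leq_mul2r hj2 orbT.
  move: (#|_|) h3 hcd => x h3 hcd; move: (2 ^ j.+1) e2 => y e2.
  move: (st X a b) e1 hcd => z e1 hcd.
  have e3 : x <= (j + 2) * (d - c) by exact: leq_trans hcd e1.
  move: e2 e3; rewrite -!mulnA; move: (_ * (d - c)) (y * _) => p t; clear -h3; nat_lia.
have hlen2 m : m <= r + 2 * st H a b - j.+1 -> 2 ^ m <= d - c.
  move=> hm; have : 2 ^ (m + j.+1) <= b - a.
    by apply: leq_trans hl; rewrite leq_exp2l //; nat_lia.
  rewrite expnD mulnC => /leq_trans /(_ hlen); by rewrite leq_pmul2l // expn_gt0.
have dk : d <= k by exact: leq_trans bk.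
have [s0|s1] := eqVneq (st X c d) 0.
  have [h|h] := boolP ((0 < st H a b) || (1 < j)).
    constructor 1; apply: (@ruleA_itv H X W a b c d r (r + 2 * st H a b - j.+1) v) => //.
      by rewrite s0 muln0 addn0; apply: hlen2.
    move: hrest; rewrite s0 eqxx; move: (cc X _) => y hrest; nat_lia.
  constructor 3; split=> //; by move: h hr j0; clear; move: j => j; nat_lia.
constructor 1; apply: (@ruleA_itv H X W a b c d r (r - j.+1) v) => //.
  by apply: hlen2; move: hst hstH hr; clear; move: (st _ _ _) (st _ _ _) (st _ _ _) => *; nat_lia.
by move: hrest; rewrite (negbTE s1); move: (cc X _) => y hrest; nat_lia.
Qed.

(** [B] covers at most half of the interval and [Y] has one run of at least three quarters, so [B]
    leaves a long gap inside that run. With [j] components of [B], the run of [B] loses [j + 2]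
    doublings and the gap [j + 7]. The other components of [B] return [16 (j - 1)], and the
    interval, a component of [H], returns 16 through the geometric mean; [16 j] exceeds
    [2 j + 9]. *)
Lemma step_C H X Y W a b r v : X :|: Y = H ->
  b <= k -> itv k a b \subset H :&: W -> 2 ^ r <= b - a ->
  v <= r + 16 * cc H (W :\: itv k a b) -> st H a b = 0 -> 16 < r ->
  3 * (b - a) <= 4 * #|X :&: itv k a b| ->
  3 * (b - a) <= 4 * #|Y :&: itv k a b| -> cc Y (itv k a b) = 1 ->
  ruleC H X Y W v.
Proof.
move=> eH bk IHW hl hv s0 r16 hX hY jY.
have [IH IW] := andP (etrans (esym (subsetI _ _ _)) IHW).
have XH : X \subset H by rewrite -eH subsetUl.
have YH : Y \subset H by rewrite -eH subsetUr.
have ba0 : 0 < b - a by apply: leq_trans hl; rewrite expn_gt0.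
have ak : a < k by nat_lia.
have H0 : 0 < cc H (itv k a b).
  apply: (@cc_gt0 _ _ (Ordinal ak)); first by apply: (subsetP IH); rewrite itvE /=; nat_lia.
  by rewrite (cpt_of_itv IH) ?itvE //=; nat_lia.
have hb2 : (b - a)./2.*2 <= b - a by rewrite -{2}(odd_double_half (b - a)) leq_addl.
have hb3 : b - a <= (b - a)./2.*2.+1.
  by rewrite -{1}(odd_double_half (b - a)) -add1n leq_add2r leq_b1.
have ba2 : 2 ^ 2 <= b - a.
  by apply: leq_trans hl; rewrite leq_exp2l //; exact: leq_trans r16.
exists (itv k a b), (b - a)./2; split.
  by move: (#|_|) hX => x hX; nat_lia.
move=> B BX hB1 hB2.
have BH : B \subset H by exact: subset_trans XH.
set j := cc B (itv k a b).
have [hr|hr] := leqP r (16 * j).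
  by left; exact: (ruleA_small BH IW hv hr).
right.
have B0 : B :&: itv k a b != set0.
  by apply: contraTneq hB2 => ->; rewrite cards0 muln0.
have [c1 [d1 [ac1 cd1 db1 sB [hcd1 hc1 hd1]]]] := pieces bk B0.
have sB0 : st B a b = 0 by apply/eqP; rewrite -leqn0 -s0 st_mono.
have sY0 : st Y a b = 0 by apply/eqP; rewrite -leqn0 -s0 st_mono.
have hst1 : st B c1 d1 = 0 by apply/eqP; rewrite -leqn0 -sB0 st_piece.
have hrest := pieces_rest ac1 cd1 db1 bk sB hc1 hd1.
rewrite -/j hst1 eqxx in hrest.
rewrite sB0 addn0 -/j in hcd1.
have j0 : 0 < j by rewrite lt0n; apply: contraTneq hcd1 => ->; rewrite mul0n leqn0 cards_eq0.
have hj : j.+1 <= 2 ^ j by exact: ltn_expl.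
have len1 : b - a <= 2 ^ j.+2 * (d1 - c1).
  have e1 : j * (d1 - c1) <= 2 ^ j * (d1 - c1) by rewrite leq_mul2r (ltnW hj) orbT.
  rewrite !expnS mulnA -mulnA; move: (#|_|) hB1 hB2 hcd1 => x; move: (2 ^ j * _) (j * _) e1 => y z *; nat_lia.
have Y0 : Y :&: itv k a b != set0.
  by apply: contraTneq hY => ->; rewrite cards0 muln0 -ltnNge muln_gt0.
have [c' [d' [ac' cd' db' sY [hcd' _ _]]]] := pieces bk Y0.
rewrite sY0 addn0 jY mul1n in hcd'.
have dk' : d' <= k by exact: leq_trans bk.
have [c2 [d2 [cc2 cd2 dd2 s2 hg]]] := gap B (ltnW cd') dk'.
have hjQ : cc B (itv k c' d') <= j by apply: cc_mono; exact: itv_sub.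
have hBQ : #|B :&: itv k c' d'| <= #|B :&: itv k a b|.
  by apply: subset_leq_card; apply: setIS; exact: itv_sub.
have len2 : b - a <= 2 ^ j * 4 * (d2 - c2 + 2).
  have e1 : (cc B (itv k c' d')).+1 * (d2 - c2 + 2) <= 2 ^ j * (d2 - c2 + 2).
    by rewrite leq_mul2r (leq_trans _ hj) ?orbT.
  rewrite [2 ^ j * 4]mulnC -mulnA.
  move: (2 ^ j * _) (_.+1 * _) (#|_|) (#|_|) (#|_|) e1 hg hcd' hY hB1 hBQ => *; nat_lia.
have hr2 : 2 ^ (r - j - 7 + 4) <= d2 - c2.
  have h : 2 ^ (r - j - 7 + 5) * (2 ^ j * 4) <= (d2 - c2 + 2) * (2 ^ j * 4).
    rewrite [leqRHS]mulnC; apply: leq_trans len2; apply: leq_trans hl.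
    by rewrite -[4]/(2 ^ 2) -!expnD leq_exp2l //; nat_lia.
  rewrite leq_pmul2r ?muln_gt0 ?expn_gt0 // (addnS _ 4) expnS in h.
  have : 2 ^ 2 <= 2 ^ (r - j - 7 + 4) by rewrite leq_exp2l //; nat_lia.
  by move: (2 ^ _) h => y; nat_lia.
have hr1 : 2 ^ (r - j.+2) <= d1 - c1.
  rewrite -(@leq_pmul2l (2 ^ j.+2)) ?expn_gt0 //; apply: leq_trans len1; apply: leq_trans hl.
  by rewrite -expnD leq_exp2l //; nat_lia.
have sI1 : itv k c1 d1 \subset itv k a b by exact: itv_sub.
have sI2 : itv k c2 d2 \subset itv k a b.
  by apply: itv_sub; [exact: leq_trans cc2 | exact: leq_trans db'].
exists (r - j.+2 + 16 * cc B (W :\: itv k c1 d1)).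
exists (r - j - 7 + 16 * cc Y (W :\: touch B :\: itv k c2 d2)); split.
- right; exists c1, d1, (r - j.+2); split=> //; first exact: leq_trans bk.
    by rewrite subsetI sB (subset_trans sI1).
  by rewrite hst1 muln0 addn0.
- right; exists c2, d2, (r - j - 7); split=> //; first exact: leq_trans dk'.
    rewrite subsetI; apply/andP; split; last first.
      apply: subset_trans s2 _; apply: setSD; apply: subset_trans IW; exact: itv_sub.
    by apply: subset_trans sY; exact: itv_sub.
  by apply: leq_trans hr2; rewrite leq_exp2l // leq_add2l (leq_mul2l 2 _ 2) st_le2.
have h1 := account2 W (itv k a b) BH YH.
have h2 : cc Y (W :\: itv k a b :\: touch B) <= cc Y (W :\: touch B :\: itv k c2 d2).
  apply: cc_mono; apply/subsetP=> x; rewrite !in_setD => /and3P[-> xI ->].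
  by rewrite !andbT; apply: contra xI; exact: subsetP.
have h3 : cc H (W :\: itv k a b) + cc H (itv k a b) <= cc H W.
  apply: leq_trans (cc_disjoint _ _) _; first by rewrite disjoints_subset subsetDr.
  by apply: cc_mono; rewrite subUset subsetDl.
have h4 : cc B (W :\: itv k a b) + cc B (itv k a b :\: itv k c1 d1) <= cc B (W :\: itv k c1 d1).
  apply: leq_trans (cc_disjoint _ (setD_disj _ _ _)) _.
  by apply: cc_mono; exact: setDD_sub.
move: h1 h2 h3 h4 hrest hv hr j0 H0; rewrite -/j; clear -r16.
move: (cc _ _) (cc _ _) (cc _ _) (cc _ _) (cc _ _) (cc _ _) (cc _ _) (cc _ _) (cc _ _) => *; nat_lia.
Qed.

(** The cases are the numbers of components of [H1] and [H2] inside the interval. If neither has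
    any, both ends are stuck; the larger set has a run of a quarter of the length with at most one
    stuck end. The factor 4 is why [good] charges two doublings per stuck end. *)
Theorem step H H1 H2 W v : H1 :|: H2 = H -> good H W v ->
  [\/ v <= 16 * cc H W, ruleA H H1 W v \/ ruleA H H2 W v,
      ruleB H H1 H2 W v \/ ruleB H H2 H1 W v | ruleC H H1 H2 W v].
Proof.
move=> eH [hv|[a [b [r [bk IHW hl hv]]]]]; first by constructor 1.
have eH' : H2 :|: H1 = H by rewrite setUC.
have [IH IW] := andP (etrans (esym (subsetI _ _ _)) IHW).
have H1H : H1 \subset H by rewrite -eH subsetUl.
have H2H : H2 \subset H by rewrite -eH subsetUr.
have ba0 : a < b by rewrite -subn_gt0; apply: leq_trans hl; rewrite expn_gt0.
have contains X : X \subset H -> itv k a b \subset X -> ruleA H X W v.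
  move=> XH sX; apply: (@ruleA_itv H X W a b a b r r v) => //.
    by apply: leq_trans hl; rewrite leq_exp2l // leq_add2l (leq_mul2l 2) st_mono.
  exact: leq_addr.
have [n1|n1] := boolP (itv k a b \subset H1); first by constructor 2; left; exact: contains.
have [n2|n2] := boolP (itv k a b \subset H2); first by constructor 2; right; exact: contains.
have [j1|j1] := posnP (cc H1 (itv k a b)); have [j2|j2] := posnP (cc H2 (itv k a b)).
- have s2 := no_inner eH ba0 bk IH j1 j2 n1 n2.
  suff bigpiece X : X \subset H -> cc X (itv k a b) = 0 -> ~~ (itv k a b \subset X) ->
      b - a <= 2 * #|X :&: itv k a b| -> ruleA H X W v.
    have : b - a <= #|H1 :&: itv k a b| + #|H2 :&: itv k a b|.
      rewrite -(card_itv a bk); apply: leq_trans (leq_card_setU _ _).1.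
      by apply: subset_leq_card; rewrite -setIUl eH subsetI IH subxx.
    have [h|h] := leqP (b - a) (2 * #|H1 :&: itv k a b|).
      by move=> _; constructor 2; left; exact: bigpiece.
    move=> h'; constructor 2; right; apply: bigpiece => //.
    by move: (#|_|) (#|_|) h h' => *; nat_lia.
  move=> XH jX nX hX.
  have Y0 : X :&: itv k a b != set0.
    by apply: contraTneq hX => ->; rewrite cards0 muln0 -ltnNge subn_gt0.
  have [c [d [ac cd db sX [hcd hc hd]]]] := pieces bk Y0.
  have hs := st_piece1 hc hd sX nX; have hs2 := st_le2 X a b.
  apply: (@ruleA_itv H X W a b c d r r v) => //; [exact: leq_trans bk| |exact: leq_addr].
  apply: (@leq_trans (2 ^ (r + 2))); first by rewrite leq_exp2l // leq_add2l (leq_mul2l 2 _ 1).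
  have e : 2 ^ (r + 2) * 4 <= (d - c) * 4.
    rewrite -[4]/(2 ^ 2) -expnD -addnA.
    apply: (leq_trans (leq_trans _ hl)); first by rewrite s2.
    rewrite jX add0n in hcd.
    have : st X a b * (d - c) <= 2 * (d - c) by rewrite leq_mul2r hs2 orbT.
    by move: (_ * (d - c)) (#|_|) hcd hX => *; nat_lia.
  by rewrite leq_pmul2r in e.
- have [hA|hB|[s0 _ _ _]] := one_inner eH' bk IHW hl hv j2.
  + by constructor 2; right.
  + by constructor 3; right.
  (* The interval is a whole component of [H], so a position of [H1] in it would create a component
     of [H1] inside it. *)
  case/negP: n2; apply/subsetP=> x xI; have xH := subsetP IH x xI.
  move: (xH); rewrite -eH inE => /orP[xX|//].
  have := @cc_gt0 H1 (itv k a b) x xX; rewrite j1 => h; have /h : cpt H1 x \subset itv k a b.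
    by rewrite -(cpt_of_itv IH xI bk s0) cpt_sub_mono.
  by [].
- have [hA|hB|[s0 _ _ _]] := one_inner eH bk IHW hl hv j1.
  + by constructor 2; left.
  + by constructor 3; left.
  case/negP: n1; apply/subsetP=> x xI; have xH := subsetP IH x xI.
  move: (xH); rewrite -eH inE => /orP[//|xX].
  have := @cc_gt0 H2 (itv k a b) x xX; rewrite j2 => h; have /h : cpt H2 x \subset itv k a b.
    by rewrite -(cpt_of_itv IH xI bk s0) cpt_sub_mono.
  by [].
- have [hA|hB|[s0 _ r16 h1]] := one_inner eH bk IHW hl hv j1.
  + by constructor 2; left.
  + by constructor 3; left.
  have [hA|hB|[_ jj2 _ h2]] := one_inner eH' bk IHW hl hv j2.
  + by constructor 2; right.
  + by constructor 3; right.
  constructor 4; apply: step_C eH bk IHW _ hv s0 r16 h1 h2 jj2.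
  by apply: leq_trans hl; rewrite leq_exp2l // leq_addr.
Qed.

End Step.

Local Open Scope ring_scope.

(** * The switching lemma *)

Section Measure.
Variables (R : realFieldType) (T : finType) (W : T -> R).
Hypothesis W0 : forall x, 0 <= W x.

Definition mu (P : pred T) : R := \sum_(x | P x) W x.

Lemma mu_ge0 P : 0 <= mu P.
Proof. exact: sumr_ge0. Qed.

Lemma mu_sub (P Q : pred T) : (forall x, P x -> Q x) -> mu P <= mu Q.
Proof.
move=> PQ; rewrite /mu [leLHS]big_mkcond [leRHS]big_mkcond; apply: ler_sum => x _.
by case: ifP => [/PQ ->|_] //; case: ifP.
Qed.

Lemma mu_union (I : finType) (P : pred T) (J : pred I) (Q : I -> pred T) :
  (forall x, P x -> exists2 i, J i & Q i x) ->
  mu P <= \sum_(i | J i) mu (Q i).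
Proof.
move=> PQ; rewrite /mu [leRHS](eq_bigr (fun i => \sum_x if Q i x then W x else 0));
  last by move=> i _; rewrite big_mkcond.
rewrite exchange_big big_mkcond /=; apply: ler_sum => x _; case: ifP => [Px|_].
  have [i Ji Qi] := PQ x Px.
  by rewrite (bigD1 i) //= Qi lerDl; apply: sumr_ge0 => j _; case: ifP.
by apply: sumr_ge0 => j _; case: ifP.
Qed.

Lemma muID (P Q : pred T) :
  mu P = mu (fun x => P x && Q x) + mu (fun x => P x && ~~ Q x).
Proof. by rewrite /mu (bigID Q). Qed.

Lemma mu_inj (U : finType) (W' : U -> R) (h : T -> U) (P : pred T) (Q : pred U) c :
  {in P &, injective h} -> (forall x, P x -> Q (h x)) ->
  (forall y, 0 <= W' y) -> 0 <= c ->
  (forall x, P x -> W x <= c * W' (h x)) ->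
  mu P <= c * \sum_(y | Q y) W' y.
Proof.
move=> hI PQ W'0 c0 hW.
rewrite /mu mulr_sumr; apply: (@le_trans _ _ (\sum_(x | P x) c * W' (h x))).
  by apply: ler_sum => x; exact: hW.
have -> : \sum_(x | P x) c * W' (h x) = \sum_(y in [set h x | x in P]) c * W' y.
  by rewrite big_imset.
rewrite [leLHS]big_mkcond [leRHS]big_mkcond; apply: ler_sum => y _.
case: imsetP => [[x Px ->]|_]; first by rewrite PQ.
by case: ifP => // _; rewrite mulr_ge0.
Qed.

End Measure.

Lemma sum_subset_expr (R : realFieldType) (E : finType) (B : {set E}) (x : R) :
  \sum_(V : {set E} | V \subset B) x ^+ #|V| = (1 + x) ^+ #|B|.
Proof.
have -> : (1 + x) ^+ #|B| = \prod_e ((if e \in B then x else 0) + 1).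
  rewrite (bigID (mem B)) /= [X in _ * X]big1 ?mulr1; last by move=> e /negbTE ->; rewrite add0r.
  rewrite (eq_bigr (fun=> 1 + x)) => [|e ->]; last by rewrite addrC.
  by rewrite prodr_const.
rewrite bigA_distr [LHS]big_mkcond /=; apply: eq_bigr => V _.
case: ifPn => [sV|/subsetPn[e eV eB]]; last first.
  by rewrite (bigD1 e) //= eV (negbTE eB) mul0r.
rewrite -big_mkcond (eq_bigr (fun=> x)) ?prodr_const // => e eV.
by rewrite (subsetP sV).
Qed.

Section Switching.
Variables (R : realFieldType) (E : finType).
Implicit Types (s r C : restr E) (V A : {set E}) (p : R).

Definition rw p (o : option bool) : R := if o is None then p else (1 - p) / 2.
Definition rweight p r : R := \prod_e rw p (r e).

Lemma rw_ge0 p o : 0 <= p <= 1 -> 0 <= rw p o.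
Proof. by case/andP=> p0 p1; case: o => [_|] //=; lra. Qed.

Lemma rweight_ge0 p r : 0 <= p <= 1 -> 0 <= rweight p r.
Proof. by move=> hp; apply: prodr_ge0 => e _; exact: rw_ge0. Qed.

Lemma rweight_sum p : \sum_r rweight p r = 1.
Proof.
rewrite /rweight -(bigA_distr_bigA (fun _ : E => rw p)) /= big1 // => e _.
by rewrite (bigD1 None) //= (bigD1 (Some true)) //= (bigD1 (Some false)) //=
   big1 ?addr0; [lra | case=> [[]|]].
Qed.

Notation Pr p := (mu (rweight p)).

(** Events preserved when [r] fixes more variables among those left free by [s]. Conditioning on
    such events is what survives the induction over the terms of a DNF. *)
Definition closed_outside s (D : pred (restr E)) := forall r r' : restr E,
  D r -> (forall e, r' e = r e \/ r e = None /\ s e = None) -> D r'.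

Lemma comp_setv s r V A : comp (setv s V A) r = setv (comp s r) V A.
Proof. by apply/ffunP=> e; rewrite !ffunE; case: ifP. Qed.

Lemma cdt_tail C F s (D : pred (restr E)) t V :
  let DV r := [&& D r, ~~ falsified C (comp s r) & stars C (comp s r) == V] in
  V != set0 -> forall r, DV r -> (t <= cdt (C :: F) (comp s r))%N ->
  exists2 A : {set E}, A \subset V & (DV r) && (t - #|V| <= cdt F (comp (setv s V A) r))%N.
Proof.
move=> DV V0 r DVr; case/and3P: (DVr) => _ nf /eqP sV.
rewrite /= (negbTE nf) sV (negbTE V0).
have [|A AV ->] := @eq_bigmax_cond {set E} (mem (powerset V)) (fun A : {set E} => cdt F (setv (comp s r) V A)).
  by apply/card_gt0P; exists set0; rewrite !inE sub0set.
move=> h; exists A; first by move: AV; rewrite /= inE.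
by rewrite DVr comp_setv leq_subLR.
Qed.

(** Give the stars in [V] the values that [C] demands. For fixed [V] this is injective, leaves [C]
    unfalsified and without stars, and replaces weight [p] by [(1 - p) / 2] at each star. *)
Lemma Pr_stars p C s (D : pred (restr E)) V : 0 < p < 1 -> closed_outside s D ->
  Pr p (fun r => [&& D r, ~~ falsified C (comp s r) & stars C (comp s r) == V]) <=
  (2 * p / (1 - p)) ^+ #|V| *
  Pr p (fun r => [&& D r, ~~ falsified C (comp s r) & stars C (comp s r) == set0]).
Proof.
move=> /andP[p0 p1] cD.
pose h (r : restr E) : restr E := [ffun e => if e \in V then C e else r e].
have inV r e : stars C (comp s r) == V -> e \in V ->
    [/\ r e = None, s e = None & exists b, C e = Some b].
  move=> /eqP <-; rewrite inE ffunE; case: (s e) => [c|]; first by rewrite andbF.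
  by case: (C e) => // b /eqP ->; split=> //; exists b.
apply: (mu_inj (h := h)).
- move=> r r' /and3P[_ _ Vr] /and3P[_ _ Vr'] /ffunP hh; apply/ffunP=> e.
  have := hh e; rewrite !ffunE; case: ifP => // eV _.
  by have [-> _ _] := inV _ _ Vr eV; have [-> _ _] := inV _ _ Vr' eV.
- move=> r /and3P[Dr nf Vr].
  have hc e : h r e = r e \/ r e = None /\ s e = None.
    rewrite ffunE; case: ifP => eV; last by left.
    by right; have [] := inV _ _ Vr eV.
  rewrite (cD r) //=; apply/andP; split.
    apply/existsPn=> e; have /existsPn/(_ e) := nf.
    case Ce: (C e) => [b|] //; rewrite !ffunE; case: ifP => eV //.
    have [_ -> _] := inV _ _ Vr eV; rewrite Ce => _.
    by apply/eqP=> -[]; case: (b).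
  apply/eqP/setP=> e; rewrite inE [RHS]inE !ffunE.
  case: ifP => eV.
    by have [_ -> [b ->]] := inV _ _ Vr eV.
  by move: eV; rewrite -(eqP Vr) inE ffunE.
- by move=> r; apply: rweight_ge0; rewrite !ltW.
- by apply: exprn_ge0; apply: divr_ge0; lra.
move=> r /and3P[_ _ Vr].
rewrite /rweight (bigID (mem V)) [X in _ <= _ * X](bigID (mem V)) /= mulrA.
rewrite [X in _ <= _ * X](eq_bigr (fun e => rw p (r e))); last first.
  by move=> e /negbTE eV; rewrite ffunE eV.
rewrite ler_wpM2r //.
  by apply: prodr_ge0 => e _; apply: rw_ge0; rewrite !ltW.
rewrite (eq_bigr (fun=> p)); last by move=> e eV; have [-> _ _] := inV _ _ Vr eV.
rewrite [X in _ <= _ * X](eq_bigr (fun=> (1 - p) / 2)); last first.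
  by move=> e eV; rewrite ffunE eV; have [_ _ [b ->]] := inV _ _ Vr eV.
rewrite !prodr_const -exprMn.
suff -> : 2 * p / (1 - p) * ((1 - p) / 2) = p by [].
by field; lra.
Qed.

(** For an unfalsified term with nonempty star set [V] there are [2 ^ #|V|] answers, the stars cost
    [(2 * p / (1 - p)) ^+ #|V|], and the remaining terms have to supply depth [t - #|V|]. The
    hypothesis on [w] says precisely that these contributions, relative to [g ^+ t], sum to at most
    1 over all [V]. *)
Lemma switching_closed p (g : R) w (F : seq (restr E)) s (D : pred (restr E)) t :
  0 < p < 1 -> 0 < g <= 1 -> (1 + 2 * (2 * p / (1 - p)) / g) ^+ w <= 2 ->
  all (fun C => #|tvars C| <= w)%N F -> closed_outside s D ->
  Pr p (fun r => D r && (t <= cdt F (comp s r))%N) <= g ^+ t * Pr p D.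
Proof.
move=> hp hg hw; have W0 r : 0 <= rweight p r.
  by case/andP: hp => ? ?; apply: rweight_ge0; rewrite !ltW.
have [p0 p1] := andP hp; have [g0 g1] := andP hg.
elim: F s D t => [|C F IH] s D [|t].
1,3: by move=> _ _; rewrite expr0 mul1r; apply: mu_sub => // r /andP[].
  move=> _ _; rewrite /mu big_pred0 ?mulr_ge0 ?exprn_ge0 ?(ltW g0) //; last first.
    by move=> r; rewrite /= andbF.
  exact: mu_ge0.
rewrite [all _ _]/=; move=> /andP[wC wF] cD.
pose DV V r := [&& D r, ~~ falsified C (comp s r) & stars C (comp s r) == V].
rewrite (muID _ _ (fun r => falsified C (comp s r))).
have h1 : Pr p (fun r => D r && (t.+1 <= cdt (C :: F) (comp s r))%N && falsified C (comp s r))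
    <= g ^+ t.+1 * Pr p (fun r => D r && falsified C (comp s r)).
  apply: le_trans (IH s _ t.+1 wF _).
    by apply: mu_sub => // r /andP[/andP[-> +] fr]; rewrite /= fr.
  move=> r r' /andP[Dr fr] hr; rewrite (cD r) //=.
  case/existsP: fr => e; case Ce: (C e) => [b|] // h; apply/existsP; exists e.
  rewrite Ce ffunE; move: h; rewrite ffunE; case: (s e) => // /eqP re.
  by have [->|[]] := hr e; rewrite re.
have h2 : Pr p (fun r => D r && (t.+1 <= cdt (C :: F) (comp s r))%N && ~~ falsified C (comp s r))
    <= \sum_(V : {set E} | (V \subset tvars C) && (V != set0)) \sum_(A : {set E} | A \subset V)
       Pr p (fun r => DV V r && (t.+1 - #|V| <= cdt F (comp (setv s V A) r))%N).
  apply: (@le_trans _ _ (\sum_(V : {set E} | (V \subset tvars C) && (V != set0))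
     Pr p (fun r => DV V r && (t.+1 <= cdt (C :: F) (comp s r))%N))).
    apply: mu_union => // r /andP[/andP[Dr tr] nf]; exists (stars C (comp s r)).
      apply/andP; split.
        by apply/subsetP=> e; rewrite !inE => /andP[].
      by apply/negP=> st; move: tr; rewrite /= (negbTE nf) st.
    by rewrite /DV Dr nf eqxx tr.
  apply: ler_sum => V /andP[_ V0]; apply: mu_union => // r /andP[DVr tr].
  exact: (cdt_tail V0 DVr tr).
(* The event [DV V] is closed relative to [setv s V A]: all stars of [C] are now set, so no later
   fixing can falsify [C] or change [V]. *)
have h3 V A : V != set0 -> A \subset V ->
   Pr p (fun r => DV V r && (t.+1 - #|V| <= cdt F (comp (setv s V A) r))%N) <=
   g ^+ t.+1 * (g^-1 ^+ #|V| * Pr p (DV V)).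
  move=> V0 sA; apply: le_trans (IH (setv s V A) (DV V) (t.+1 - #|V|)%N wF _) _.
    move=> r r' /and3P[Dr nf /eqP Vr] hr; apply/and3P; split.
    - apply: cD Dr _ => e; have [->|[re]] := hr e; first by left.
      by rewrite ffunE; case: ifP => // _ se; right.
    - apply/existsPn=> e; have /existsPn/(_ e) := nf; case Ce: (C e) => [b|] //.
      rewrite !ffunE; case se: (s e) => [//|]; have [-> //|[re]] := hr e.
      rewrite ffunE; case: ifP => // eV _.
      by move: eV; rewrite -Vr inE Ce ffunE se re.
    - apply/eqP/setP=> e; have := Vr => /setP/(_ e); rewrite !inE !ffunE.
      case se: (s e) => [//|]; have [-> //|[re]] := hr e.
      by rewrite ffunE; case: ifP => // eV _; rewrite re /= andbT => ->.
  rewrite mulrA ler_wpM2r ?mu_ge0 //.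
  rewrite exprVn; have gV : 0 < g ^+ #|V| by apply: exprn_gt0.
  rewrite ler_pdivlMr // -exprD; apply: ler_wiXn2l; by rewrite ?(ltW g0) // addnC -leq_subLR.
have t2 : 0 <= 2 * p / (1 - p) by apply: divr_ge0; lra.
have h4 : \sum_(V : {set E} | (V \subset tvars C) && (V != set0)) \sum_(A : {set E} | A \subset V)
       Pr p (fun r => DV V r && (t.+1 - #|V| <= cdt F (comp (setv s V A) r))%N) <=
   \sum_(V : {set E} | (V \subset tvars C) && (V != set0))
     (2 * (2 * p / (1 - p)) / g) ^+ #|V| * (g ^+ t.+1 * Pr p (DV set0)).
  apply: ler_sum => V /andP[_ V0].
  apply: (@le_trans _ _ (\sum_(A : {set E} | A \subset V) g ^+ t.+1 * (g^-1 ^+ #|V| * Pr p (DV V)))).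
    by apply: ler_sum => A sA; exact: h3.
  rewrite sumr_const.
  have -> : #|(fun A : {set E} => A \subset V)| = (2 ^ #|V|)%N.
    by rewrite -card_powerset; apply: eq_card => A; rewrite inE.
  have := Pr_stars C V hp cD; rewrite -/(DV V) -/(DV set0) => hs.
  move: hs; set T := 2 * p / (1 - p); clearbody T; move=> hs.
  rewrite -[leLHS]mulr_natl natrX !exprMn.
  have -> : 2%:R ^+ #|V| * (g ^+ t.+1 * (g^-1 ^+ #|V| * Pr p (DV V))) =
     2 ^+ #|V| * g ^+ t.+1 * g^-1 ^+ #|V| * Pr p (DV V) by rewrite !mulrA.
  have -> : 2 ^+ #|V| * T ^+ #|V| * g^-1 ^+ #|V| * (g ^+ t.+1 * Pr p (DV set0)) =
     2 ^+ #|V| * g ^+ t.+1 * g^-1 ^+ #|V| * (T ^+ #|V| * Pr p (DV set0)) by ring.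
  by rewrite ler_wpM2l // !mulr_ge0 ?exprn_ge0 ?invr_ge0 // ltW.
have h5 : \sum_(V : {set E} | (V \subset tvars C) && (V != set0))
     (2 * (2 * p / (1 - p)) / g) ^+ #|V| <= 1.
  have x0 : 0 <= 2 * (2 * p / (1 - p)) / g.
    by apply: divr_ge0; [apply: mulr_ge0 | exact: ltW].
  have := sum_subset_expr (tvars C) (2 * (2 * p / (1 - p)) / g).
  rewrite (bigD1 set0) ?sub0set //= cards0 expr0 => /eqP.
  rewrite -subr_eq0 => /eqP heq.
  have hle : (1 + 2 * (2 * p / (1 - p)) / g) ^+ #|tvars C| <= 2.
    apply: le_trans hw; apply: ler_weXn2l => //; lra.
  by lra.
apply: le_trans (lerD h1 (le_trans h2 h4)) _.
rewrite -mulr_suml (muID _ D (fun r => falsified C (comp s r))) mulrDr lerD2l.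
have hD : Pr p (DV set0) <= Pr p (fun r => D r && ~~ falsified C (comp s r)).
  by apply: mu_sub => // r /and3P[-> ->].
apply: (@le_trans _ _ (1 * (g ^+ t.+1 * Pr p (DV set0)))).
  by rewrite ler_wpM2r // mulr_ge0 ?mu_ge0 // exprn_ge0 // ltW.
by rewrite mul1r ler_wpM2l // exprn_ge0 // ltW.
Qed.

End Switching.

Lemma mu_has (R : realFieldType) (T : finType) (W : T -> R) (I : Type) (l : seq I)
    (Q : I -> pred T) : (forall x, 0 <= W x) ->
  mu W (fun x => has (fun i => Q i x) l) <= \sum_(i <- l) mu W (Q i).
Proof.
move=> W0; elim: l => [|i l IH]; first by rewrite big_nil /mu big_pred0.
rewrite big_cons (muID _ _ (Q i)); apply: lerD.
  by apply: mu_sub => // x /andP[].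
apply: le_trans IH; apply: mu_sub => // x /=.
by case: (Q i x) => //=; rewrite ?andbF ?andbT.
Qed.

Lemma sum_option_bool (V : nmodType) (F : option bool -> V) :
  \sum_a F a = F None + (F (Some true) + F (Some false)).
Proof.
by rewrite (bigD1 None) //= (bigD1 (Some true)) //= (bigD1 (Some false)) //=
   big1 ?addr0 // => [[[]|]].
Qed.

(** * Composition of independent random restrictions *)

Section Pushforward.
Variables (R : realFieldType) (E : finType).

Lemma sum_prod_map (A B : finType) (w : A -> R) (h : A -> B)
    (phi : {ffun E -> B} -> R) :
  \sum_(q : {ffun E -> A}) (\prod_e w (q e)) * phi [ffun e => h (q e)] =
  \sum_(r : {ffun E -> B}) (\prod_e \sum_(a | h a == r e) w a) * phi r.
Proof.
rewrite (partition_big (fun q : {ffun E -> A} => [ffun e => h (q e)]) predT) //=.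
apply: eq_bigr => r _; rewrite (bigA_distr_big_dep (fun e a => h a == r e) (fun _ => w)) /= mulr_suml.
apply: eq_big => q.
  apply/eqP/familyP=> [<- e|hf]; first by rewrite unfold_in ffunE.
  by apply/ffunP=> e; rewrite ffunE; have := hf e; rewrite unfold_in => /eqP.
by move=> /eqP ->.
Qed.

Lemma sum_ffun_pair (A B : finType) (G : {ffun E -> A} -> {ffun E -> B} -> R) :
  \sum_r1 \sum_r2 G r1 r2 =
  \sum_(q : {ffun E -> A * B}) G [ffun e => (q e).1] [ffun e => (q e).2].
Proof.
rewrite pair_big /=.
rewrite (reindex (fun q : {ffun E -> A * B} => ([ffun e => (q e).1], [ffun e => (q e).2]))) //=.
exists (fun q : {ffun E -> A} * {ffun E -> B} => [ffun e => (q.1 e, q.2 e)]) => [q _|[q1 q2] _].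
  by apply/ffunP=> e; rewrite !ffunE; case: (q e).
by congr pair; apply/ffunP=> e; rewrite !ffunE.
Qed.

(** In each coordinate a star survives exactly when both restrictions have one there. *)
Lemma rweight_comp (p1 p2 : R) (phi : restr E -> R) :
  \sum_(r1 : restr E) rweight p1 r1 * (\sum_(r2 : restr E) rweight p2 r2 * phi (comp r1 r2)) =
  \sum_(r : restr E) rweight (p1 * p2) r * phi r.
Proof.
under eq_bigr => r1 _ do rewrite mulr_sumr.
rewrite (sum_ffun_pair (fun r1 r2 => rweight p1 r1 * (rweight p2 r2 * phi (comp r1 r2)))).
pose h (ab : option bool * option bool) := if ab.1 is Some b then Some b else ab.2.
pose w (ab : option bool * option bool) := rw p1 ab.1 * rw p2 ab.2.
transitivity (\sum_(q : {ffun E -> option bool * option bool})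
   (\prod_e w (q e)) * phi [ffun e => h (q e)]).
  apply: eq_bigr => q _; rewrite mulrA; congr (_ * phi _).
    by rewrite /rweight -big_split; apply: eq_bigr => e _; rewrite !ffunE.
  by apply/ffunP=> e; rewrite !ffunE.
rewrite sum_prod_map; apply: eq_bigr => r _; congr (_ * _).
apply: eq_bigr => e _; rewrite big_mkcond.
rewrite -(pair_bigA _ (fun a b => if h (a, b) == r e then w (a, b) else 0)) /=.
rewrite !sum_option_bool /w /h /=.
by case: (r e) => [[]|] /=; field.
Qed.

End Pushforward.

(** * Bounded-depth formulas under random restrictions *)

Section AC.
Variable E : finType.
Implicit Types (f : cube E -> bool) (r : restr E).

(* Functions computed by formulas of depth at most [d] and size at most [s]
   whose leaves read at most one variable; negations of gates are free. *)
Fixpoint AC (d s : nat) (f : cube E -> bool) : Prop :=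
  (0 < s)%N /\ dtle 1 f \/
  if d is d'.+1 then
    exists (b : bool) (l : seq (nat * (cube E -> bool))),
      [/\ (0 < s)%N, (\sum_(q <- l) q.1 <= s)%N,
          forall q, List.In q l -> AC d' q.1 q.2 &
          forall x, f x = b (+) has (fun q => q.2 x) l]
  else False.

Lemma AC_map (h : cube E -> cube E) d s f :
  (forall g, dtle 1 g -> dtle 1 (g \o h)) -> AC d s f -> AC d s (f \o h).
Proof.
move=> hh; elim: d s f => [|d IH] s f [[s0 hf]|] //; try by left; split=> //; exact: hh.
case=> b [l [s0 ls lA fE]]; right.
exists b, [seq (q.1, q.2 \o h) | q <- l]; split=> //.
- by rewrite big_map.
- by move=> q /List.in_map_iff[q' [<- ql]]; apply: IH; exact: lA ql.
- by move=> x; rewrite /= fE has_map.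
Qed.

Lemma dnf_seq t (l : seq (cube E -> bool)) :
  (forall g, List.In g l -> dtle t g) ->
  exists2 F : seq (restr E), all (fun C => #|tvars C| <= t)%N F &
     forall x, has (fun g => g x) l = dnf F x.
Proof.
elim: l => [|g l IH] hl; first by exists [::].
have [F1 w1 e1] := dtle_dnf (hl g (or_introl erefl)).
have [|F2 w2 e2] := IH; first by move=> g' hg'; apply: hl; right.
by exists (F1 ++ F2) => [|x]; rewrite ?all_cat ?w1 //= /dnf has_cat e1 e2.
Qed.

End AC.

Section ACSwitch.
Variables (R : realFieldType) (E : finType).
Notation Pr p := (@mu R _ (rweight p)).

(** The bit [b] covers conjunctions through negation. Failure means canonical depth at least
    [t + 1], so [g ^+ t] is a rounding of [g ^+ t.+1]. *)
Lemma switching (p g : R) t (l : seq (cube E -> bool)) (b : bool) :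
  0 < p < 1 -> 0 < g <= 1 -> (1 + 2 * (2 * p / (1 - p)) / g) ^+ t <= 2 ->
  (forall h, List.In h l -> dtle t h) ->
  Pr p (fun r : restr E => ~~ `[< dtle t (fun x => b (+) has (fun h => h (fill r x)) l) >])
   <= g ^+ t.
Proof.
move=> hp hg hw hl; have [F wF eF] := dnf_seq hl.
have hp' : 0 <= p <= 1 by lra.
have := @switching_closed R E p g t F [ffun=> None] predT t.+1 hp hg hw wF _.
rewrite {2}/mu rweight_sum mulr1 => h.
have {}h := h (fun _ _ _ _ => isT).
apply: (@le_trans _ _ (g ^+ t.+1)); last by case/andP: hg => g0 g1; apply: ler_wiXn2l => //; exact: ltW.
apply: le_trans h; apply: mu_sub => [r|r]; first exact: rweight_ge0.
have -> : comp [ffun=> None] r = r by apply/ffunP=> e; rewrite !ffunE.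
rewrite /= ltnNge; apply: contraNN => hc; apply/asboolP.
have := dtle_leq hc (dtle_cdt F r).
case: b => hd; last by apply: dtle_ext hd => x; rewrite /= eF.
by apply: dtle_ext (dtle_neg hd) => x; rewrite /= eF.
Qed.

(** The restriction is composed of [d] independent ones, one per level; each turns gates over
    shallow trees into shallow trees. The sizes of the children add up to at most [s], and the gate
    itself contributes one more failure event. *)
Theorem AC_switching (p g : R) t d s (f : cube E -> bool) :
  0 < p < 1 -> 0 < g <= 1 -> (1 + 2 * (2 * p / (1 - p)) / g) ^+ t <= 2 ->
  (0 < t)%N -> AC d s f ->
  Pr (p ^+ d) (fun r : restr E => ~~ `[< dtle t (fun x => f (fill r x)) >])
   <= (s * d)%:R * g ^+ t.
Proof.
move=> hp hg hw t0.
have [[p0 p1] [g0 g1]] : (0 < p /\ p < 1) /\ (0 < g /\ g <= 1) by move/andP: hp; move/andP: hg.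
have gt : 0 <= g ^+ t by rewrite exprn_ge0 // ltW.
have leaf d' f' : dtle 1 f' ->
  Pr (p ^+ d') (fun r : restr E => ~~ `[< dtle t (fun x => f' (fill r x)) >]) = 0.
  move=> h; rewrite /mu big_pred0 // => r; apply/negbTE; rewrite negbK; apply/asboolP.
  exact/dtle_fill/(dtle_leq t0).
elim: d s f => [|d IH] s f [[s0 hf]|] //.
- by rewrite leaf // mulr_ge0 // ler0n.
- by rewrite leaf // mulr_ge0 // ler0n.
case=> b [l [s0 ls lA fE]].
have pd0 : 0 <= p ^+ d <= 1 by rewrite exprn_ge0 ?exprn_ile1 // ltW.
have p01 : 0 <= p <= 1 by rewrite !ltW.
pose bad r := has (fun q : nat * (cube E -> bool) => ~~ `[< dtle t (fun x => q.2 (fill r x)) >]) l.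
have hbad : Pr (p ^+ d) bad <= (s * d)%:R * g ^+ t.
  apply: le_trans (mu_has _ _ _) _; first by move=> r; exact: rweight_ge0.
  apply: (@le_trans _ _ (\sum_(q <- l) (q.1 * d)%:R * g ^+ t)).
    elim: l lA {ls fE bad} => [|q l IHl] lA; first by rewrite !big_nil.
    rewrite !big_cons; apply: lerD; first by apply: IH; apply: lA; left.
    by apply: IHl => q' hq'; apply: lA; right.
  rewrite -mulr_suml ler_wpM2r // -natr_sum ler_nat -big_distrl /= leq_mul2r ls orbT //.
rewrite exprSr /mu big_mkcond.
pose bd r : R := if ~~ `[< dtle t (fun x => f (fill r x)) >] then 1 else 0.
rewrite (eq_bigr (fun r => rweight (p ^+ d * p) r * bd r)); last first.
  by move=> r _; rewrite /bd; case: ifP; rewrite ?mulr1 ?mulr0.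
rewrite -rweight_comp (bigID bad) /=.
apply: (@le_trans _ _ ((s * d)%:R * g ^+ t + g ^+ t)); last first.
  by rewrite -{2}[g ^+ t]mul1r -mulrDl ler_wpM2r // mulnS natrD addrC lerD2r ler1n.
apply: lerD.
  apply: le_trans hbad; apply: ler_sum => r _.
  rewrite -[leRHS]mulr1 ler_wpM2l ?rweight_ge0 //.
  rewrite -(rweight_sum E p); apply: ler_sum => r' _.
  by rewrite -[leRHS]mulr1 ler_wpM2l ?rweight_ge0 // /bd; case: ifP.
apply: (@le_trans _ _ (\sum_(r : restr E) rweight (p ^+ d) r * g ^+ t)); last first.
  by rewrite -mulr_suml rweight_sum mul1r.
rewrite [leLHS]big_mkcond; apply: ler_sum => r _; case: ifPn => [nb|_]; last first.
  by rewrite mulr_ge0 ?rweight_ge0.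
rewrite ler_wpM2l ?rweight_ge0 //.
have hl : forall h, List.In h [seq (fun x => q.2 (fill r x)) | q <- l] -> dtle t h.
  move: nb; rewrite /bad; elim: l {lA fE ls bad hbad} => [|q l IHl] //=.
  by rewrite negb_or negbK => /andP[/asboolP hq hl] h [<-|] //; exact: IHl.
apply: le_trans (switching b hp hg hw hl).
rewrite /mu [leRHS]big_mkcond; apply: ler_sum => r' _; rewrite /bd.
have -> : `[< dtle t (fun x => f (fill (comp r r') x)) >] =
  `[< dtle t (fun x => b (+) has (fun h => h (fill r' x)) [seq (fun x => q.2 (fill r x)) | q <- l]) >].
  apply: asbool_equiv_eq; split; apply: dtle_ext => x;
  by rewrite has_map fE; congr (_ (+) _); apply: eq_has => q /=; rewrite fill_comp.
by case: ifP; rewrite ?mulr1 ?mulr0.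
Qed.

End ACSwitch.

(** * Sensitivity of binary formulas *)

Section Sensitivity.
Variables (k N : nat).

Definition edges : finType := ('I_k * 'I_N * 'I_N)%type.
Definition embedding := {ffun 'I_k.+1 -> 'I_N}.
Implicit Types (X x : cube edges) (a b : embedding) (H Z B : {set 'I_k}) (i : 'I_k)
  (S T : {set 'I_k.+1}) (g : cube edges -> bool).

Definition lo i : 'I_k.+1 := widen_ord (leqnSn k) i.
Definition hi i : 'I_k.+1 := lift ord0 i.
Definition edge a i : edges := (i, a (lo i), a (hi i)).
Definition plant X a Z : cube edges := [ffun e => X e || [exists i in Z, e == edge a i]].

(* The gate [g], seen as a function of the planted edges [Z \subset H], depends on all of them. *)
Definition sens g X H a : bool :=
  [forall i in H, [exists Z : {set 'I_k}, (Z \subset H) &&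
     (g (plant X a (i |: Z)) != g (plant X a (Z :\ i)))]].

Lemma edge_inj a i j : edge a i = edge a j -> i = j.
Proof. by case. Qed.

Lemma plant_upd X a Z i :
  plant X a (i |: Z) = upd (plant X a (Z :\ i)) (edge a i) true.
Proof.
apply/ffunP=> e; rewrite !ffunE; case: eqP => [->|ne].
  by apply/orP; right; apply/existsP; exists i; rewrite setU11 eqxx.
congr (_ || _); apply/exists_inP/exists_inP=> -[j jZ /eqP ej]; exists j; rewrite ?ej //.
  by move: jZ; rewrite !inE => /orP[/eqP ji|->]; [rewrite ej ji in ne | rewrite andbT; apply/eqP=> ji; rewrite ej ji in ne].
by move: jZ; rewrite !inE => /andP[_ ->]; rewrite orbT.
Qed.

Lemma plantF X a Z i : X (edge a i) = false -> plant X a (Z :\ i) (edge a i) = false.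
Proof.
move=> Xi; rewrite ffunE Xi /=; apply/negbTE/negP=> /exists_inP[j jZ /eqP /edge_inj ij].
by move: jZ; rewrite -ij !inE eqxx.
Qed.

Lemma plantT X a Z i : X (edge a i) -> plant X a (i |: Z) = plant X a (Z :\ i).
Proof.
move=> Xi; rewrite plant_upd; apply/ffunP=> e; rewrite ffunE; case: eqP => // ->.
by rewrite ffunE Xi.
Qed.

Lemma sens_dep g X H a i : sens g X H a -> i \in H -> edge a i \in dep g.
Proof.
move=> /forall_inP hs iH; have /existsP[Z /andP[_ hZ]] := hs i iH.
have [Xi|/negbTE Xi] := boolP (X (edge a i)); first by rewrite plantT ?eqxx in hZ.
rewrite inE; apply/existsP; exists (plant X a (Z :\ i)); rewrite -plant_upd.
by rewrite (_ : upd _ _ false = plant X a (Z :\ i)) // -(plantF Z Xi) upd_id.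
Qed.

Lemma sens_leaf g X H a : dtle 1 g -> sens g X H a -> (#|H| <= 1)%N.
Proof.
move=> /card_dep; rewrite expn1 ltnS => h hs; apply: leq_trans h.
rewrite -(card_imset _ (@edge_inj a)); apply/subset_leq_card/subsetP=> e /imsetP[i iH ->].
exact: sens_dep hs iH.
Qed.

(** Each child receives the positions of [H] on which it depends. It ignores the others ([restr]),
    hence stays sensitive when only its own positions vary; a position ignored by both children is
    ignored by the gate. *)
Lemma sens_op (op : bool -> bool -> bool) g1 g2 X H a :
  sens (fun x => op (g1 x) (g2 x)) X H a ->
  exists H1 H2, [/\ H1 :|: H2 = H, sens g1 X H1 a & sens g2 X H2 a].
Proof.
move=> /forall_inP hs.
pose D (g : cube edges -> bool) := [set i in H | [exists Z : {set 'I_k}, (Z \subset H) &&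
     (g (plant X a (i |: Z)) != g (plant X a (Z :\ i)))]].
have DH g : D g \subset H by apply/subsetP=> i; rewrite inE => /andP[].
have restr g Z : Z \subset H -> g (plant X a Z) = g (plant X a (Z :&: D g)).
  move: {2}#|Z :\: D g| (leqnn #|Z :\: D g|) => n; elim: n Z => [|n IH] Z hn ZH.
    congr (g (plant _ _ _)); apply/esym/setIidPl.
    by rewrite -setD_eq0 -cards_eq0 -leqn0.
  have [Z0|/set0Pn[i]] := eqVneq (Z :\: D g) set0.
    by apply: IH => //; rewrite Z0 cards0.
  rewrite inE => /andP[iD iZ].
  have hZ : g (plant X a Z) = g (plant X a (Z :\ i)).
    apply/eqP; apply: contraNT iD => hne; rewrite inE (subsetP ZH) //=.
    by apply/existsP; exists Z; rewrite ZH (setUidPr _) ?sub1set.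
  have -> : Z :&: D g = (Z :\ i) :&: D g.
    apply/setP=> j; rewrite !in_setI in_setD1; have [->|//] := eqVneq j i.
    by rewrite (negbTE iD) andbF.
  rewrite hZ; apply: IH; last by apply: subset_trans ZH; exact: subD1set.
  rewrite -ltnS; apply: leq_trans hn.
  rewrite [in X in (_ < X)%N](cardsD1 i) inE iD iZ add1n ltnS.
  by apply/subset_leq_card/subsetP=> j; rewrite !inE => /and3P[-> -> ->].
have sensD g : sens g X (D g) a.
  apply/forall_inP=> i iD; move: (iD); rewrite inE => /andP[iH /existsP[Z /andP[ZH hZ]]].
  apply/existsP; exists (Z :&: D g); rewrite subsetIr /=.
  rewrite restr in hZ; last by rewrite subUset sub1set iH.
  rewrite [X in _ != X]restr in hZ; last by apply: subset_trans ZH; exact: subD1set.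
  have -> : i |: (Z :&: D g) = (i |: Z) :&: D g.
    apply/setP=> j; rewrite !(in_setI, in_setU1); have [->|//] := eqVneq j i; by rewrite iD.
  have -> // : (Z :&: D g) :\ i = (Z :\ i) :&: D g.
  by apply/setP=> j; rewrite !(in_setI, in_setD1) andbA.
exists (D g1), (D g2); split=> //; apply/setP=> i; rewrite in_setU.
apply/orP/idP=> [[]|iH]; try exact: subsetP.
have /existsP[Z /andP[ZH hZ]] := hs i iH.
have [e1|n1] := eqVneq (g1 (plant X a (i |: Z))) (g1 (plant X a (Z :\ i))); last first.
  by left; rewrite inE iH; apply/existsP; exists Z; rewrite ZH.
have [e2|n2] := eqVneq (g2 (plant X a (i |: Z))) (g2 (plant X a (Z :\ i))); last first.
  by right; rewrite inE iH; apply/existsP; exists Z; rewrite ZH.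
by rewrite e1 e2 eqxx in hZ.
Qed.

Definition verts B : {set 'I_k.+1} := [set v | [exists i in B, (v == lo i) || (v == hi i)]].
Definition free S : {set 'I_k} := [set i | (lo i \notin S) && (hi i \notin S)].
Definition agree S a b : bool := [forall v in S, a v == b v].

Lemma free_verts S B : free (S :|: verts B) = free S :\: touch B.
Proof.
have hv v : (v \in verts B) = [exists j in B, (v == lo j) || (v == hi j)] by rewrite inE.
apply/setP=> i; rewrite [LHS]inE !in_setU !hv in_setD [i \in free S]inE [i \in touch B]inE !negb_or.
have -> : [exists x in B, (x <= i.+1)%N && (i <= x.+1)%N] =
   [exists j in B, (lo i == lo j) || (lo i == hi j)] || [exists j in B, (hi i == lo j) || (hi i == hi j)].
  apply/exists_inP/orP=> [[j jB hj]|].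
    have [ij|ij] := leqP i j; [have [e|e] : i = j :> nat \/ i.+1 = j :> nat by lia|].
    - by left; apply/exists_inP; exists j; rewrite // -!val_eqE /= e eqxx.
    - by right; apply/exists_inP; exists j; rewrite // -!val_eqE /= /bump /= add1n e eqxx.
    - left; apply/exists_inP; exists j; rewrite // -!val_eqE /= /bump /= add1n.
      by apply/orP; right; lia.
  by case=> /exists_inP[j jB]; rewrite -!val_eqE /= /bump /= ?add1n => hj; exists j => //; lia.
rewrite negb_or; move: [exists j in B, _] [exists j in B, _] => [] [];
by case: (lo i \in S); case: (hi i \in S).
Qed.

Lemma agreeP S a b : reflect {in S, a =1 b} (agree S a b).
Proof. by apply: (iffP forall_inP) => h v /h /eqP. Qed.

Lemma agree_sym S a b : agree S a b = agree S b a.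
Proof. by apply/agreeP/agreeP=> h v /h. Qed.
Lemma agreeU S T a b : agree (S :|: T) a b = agree S a b && agree T a b.
Proof.
apply/agreeP/andP=> [h|[/agreeP h1 /agreeP h2] v]; last by rewrite inE => /orP[/h1|/h2].
by split; apply/agreeP=> v hv; apply: h; rewrite inE hv ?orbT.
Qed.

Lemma agree_trans S a b (c : embedding) : agree S a b -> agree S b c -> agree S a c.
Proof. by move=> /agreeP h1 /agreeP h2; apply/agreeP=> v hv; rewrite h1 ?h2. Qed.

Lemma agree_edge B a b i : agree (verts B) a b -> i \in B -> edge a i = edge b i.
Proof.
move=> /agreeP h iB; rewrite /edge !h // inE; apply/exists_inP; exists i => //;
 by rewrite eqxx ?orbT.
Qed.

Lemma plant_agree X B Z a b : agree (verts B) a b -> Z \subset B -> plant X a Z = plant X b Z.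
Proof.
move=> h ZB; apply/ffunP=> e; rewrite !ffunE; congr (_ || _).
apply: eq_existsb => i; case iZ: (i \in Z) => //=.
by rewrite (agree_edge h) // (subsetP ZB).
Qed.

Lemma sens_agree g X H a b : agree (verts H) a b -> sens g X H a -> sens g X H b.
Proof.
move=> h /forall_inP hs; apply/forall_inP=> i iH.
have /existsP[Z /andP[ZH hZ]] := hs i iH; apply/existsP; exists Z; rewrite ZH /=.
by rewrite -!(plant_agree X h) // ?subUset ?sub1set ?iH // (subset_trans _ ZH) // subD1set.
Qed.

Lemma card_agree S b : #|[set a | agree S a b]| = (N ^ (k.+1 - #|S|))%N.
Proof.
pose F (v : 'I_k.+1) : pred 'I_N := if v \in S then pred1 (b v) else predT.
have -> : #|[set a | agree S a b]| = #|family F|.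
  apply: eq_card => a; rewrite inE; apply/agreeP/familyP=> h v.
    by rewrite /F; case: ifP => // vS; rewrite unfold_in /= h.
  by move=> vS; have := h v; rewrite /F vS unfold_in /= => /eqP.
rewrite card_family foldrE big_image /= (bigID (mem S)) /= big1 => [|v vS]; last first.
  by rewrite /F vS card1.
rewrite mul1n (eq_bigr (fun=> N)) => [|v /negbTE vS]; last by rewrite /F vS card_ord.
rewrite prod_nat_const; congr (_ ^ _)%N.
apply: (@addnI #|S|); rewrite subnKC; last by rewrite -[leqRHS]card_ord max_card.
by rewrite -[RHS]card_ord -(cardC S); congr (_ + _)%N; exact: eq_card.
Qed.

(** * Densities of sets of embeddings *)

Section Density.
Variable R : realFieldType.
Implicit Types (P Q : pred embedding) (u w : R).

(* Every class of embeddings agreeing on [S] meets [P] with density at most [u]. *)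
Definition bdd S P u : Prop := forall b,
  #|[set a | agree S a b & P a]|%:R <= u * (N ^ (k.+1 - #|S|))%:R.

Lemma bdd_sub S P Q u w : {subset P <= Q} -> u <= w -> bdd S Q u -> bdd S P w.
Proof.
move=> PQ uw hQ b; apply: (@le_trans _ _ (u * (N ^ (k.+1 - #|S|))%:R)); last first.
  by rewrite ler_wpM2r // ler0n.
apply: le_trans (hQ b); rewrite ler_nat; apply/subset_leq_card/subsetP=> a.
by rewrite !inE => /andP[-> /PQ].
Qed.

Lemma bddU S P Q u w : bdd S P u -> bdd S Q w -> bdd S (fun a => P a || Q a) (u + w).
Proof.
move=> hP hQ b; rewrite mulrDl; apply: le_trans (lerD (hP b) (hQ b)).
rewrite -natrD ler_nat; apply: leq_trans (leq_card_setU _ _).1.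
by apply/subset_leq_card/subsetP=> a; rewrite !inE => /andP[->].
Qed.

Lemma bdd_pred0 S u : 0 <= u -> bdd S pred0 u.
Proof.
move=> u0 b; rewrite (_ : [set _ | _] = set0) ?cards0 ?mulr_ge0 ?ler0n //.
by apply/setP=> a; rewrite !inE andbF.
Qed.

Lemma bdd_has S (I : Type) (l : seq I) (P : I -> pred embedding) (u : I -> R) :
  (forall t : I, List.In t l -> bdd S (P t) (u t)) ->
  bdd S (fun a => has (fun t => P t a) l) (\sum_(t <- l) u t).
Proof.
elim: l => [|t l IH] h; first by rewrite big_nil; exact: bdd_pred0.
rewrite big_cons; apply: bddU; first by apply: h; left.
by apply: IH => t' ht'; apply: h; right.
Qed.

Lemma bdd_exists S (I : finType) (J : pred I) (P : I -> pred embedding) u :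
  0 <= u -> (forall t : I, J t -> bdd S (P t) u) ->
  bdd S (fun a => [exists t : I, J t && P t a]) (#|I|%:R * u).
Proof.
move=> u0 h; rewrite mulr_natl cardE.
have -> : u *+ size (enum I) = \sum_(t <- enum I) u by rewrite big_const_seq count_predT iter_addr_0.
apply: (@bdd_sub _ _ (fun a => has (fun t => J t && P t a) (enum I)) _ _ _ (lexx _)).
  by move=> a /existsP[t ht]; apply/hasP; exists t; rewrite ?mem_enum.
apply: bdd_has => t _; have [Jt|nJt] := boolP (J t).
  by apply: bdd_sub (h t Jt) => // a /andP[].
by apply: bdd_sub (bdd_pred0 S u0) => // a /andP[Jt]; rewrite Jt in nJt.
Qed.

(** Chain rule: [P] depends only on the vertices in [T], and once these are fixed as well [Q] has
    density at most [w]. *)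
Lemma bdd_join S T P Q u w : (0 < N)%N -> 0 <= w ->
  (forall a b, agree T a b -> P a -> P b) ->
  bdd S P u -> bdd (S :|: T) Q w -> bdd S (fun a => P a && Q a) (u * w).
Proof.
move=> N0 w0 dP hP hQ b; set c := (N ^ (k.+1 - #|S :|: T|))%N.
have c0 : 0 < c%:R :> R by rewrite ltr0n expn_gt0 N0.
rewrite -(ler_pM2r c0) -natrM.
(* Count pairs of embeddings that agree on [S :|: T], both of them in [P] and one of them in [Q]. *)
have -> : (#|[set a | agree S a b & P a && Q a]| * c =
   \sum_(a0 in [set a | agree S a b & P a]) #|[set a | agree (S :|: T) a a0 & Q a]|)%N.
  rewrite -sum_nat_const (eq_bigr (fun a => #|[set a0 | agree (S :|: T) a0 a]|)); last first.
    by move=> a _; rewrite card_agree.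
  under eq_bigr => a _ do rewrite -sum1_card.
  under [RHS]eq_bigr => a _ do rewrite -sum1_card.
  rewrite (exchange_big_dep (fun a0 => a0 \in [set a | agree S a b & P a])) /=.
    apply: eq_bigr => a0; rewrite inE => /andP[a0S a0P]; apply: eq_bigl => a.
    rewrite !inE [agree (S :|: T) a0 a]agree_sym; have [h|//] := boolP (agree (S :|: T) a a0); last by rewrite andbF.
    move: (h); rewrite agreeU => /andP[hS hT].
    by rewrite (agree_trans hS a0S) (dP _ _ _ a0P) // ?andbT // agree_sym.
  move=> a a0; rewrite !inE agreeU => /and3P[aS aP _] /andP[hS hT].
  by rewrite (agree_trans hS aS) (dP _ _ _ aP) // agree_sym.
rewrite natr_sum.
apply: (@le_trans _ _ (\sum_(a0 in [set a | agree S a b & P a]) w * c%:R)).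
  by apply: ler_sum => a0 _; exact: hQ.
rewrite sumr_const -[leLHS]mulr_natl mulrA ler_pM2r //.
rewrite -[leRHS]mulrA [w * _]mulrC mulrA ler_wpM2r //; exact: hP.
Qed.

End Density.

End Sensitivity.

(** * Binary formulas *)

Section Trees.
Variable E : finType.

Inductive bt : Type :=
| BLeaf of cube E -> bool
| BNode of (bool -> bool -> bool) & bt & bt.

Fixpoint beval (t : bt) (x : cube E) : bool :=
  match t with BLeaf g => g x | BNode op l r => op (beval l x) (beval r x) end.
Fixpoint bsize (t : bt) : nat :=
  match t with BLeaf _ => 1 | BNode _ l r => bsize l + bsize r end.
Fixpoint bdepth (t : bt) : nat :=
  match t with BLeaf _ => 0 | BNode _ l r => (maxn (bdepth l) (bdepth r)).+1 end.
Fixpoint subs (t : bt) : seq bt :=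
  t :: match t with BLeaf _ => [::] | BNode _ l r => subs l ++ subs r end.

Fixpoint okt (Q : (cube E -> bool) -> Prop) (t : bt) : Prop :=
  Q (beval t) /\
  match t with BLeaf g => dtle 1 g | BNode _ l r => okt Q l /\ okt Q r end.

Lemma okt_eval Q t : okt Q t -> Q (beval t).
Proof. by case: t => [g|op l r] []. Qed.

Lemma in_cat_list (A : Type) (x : A) s1 s2 : List.In x (s1 ++ s2) -> List.In x s1 \/ List.In x s2.
Proof. by elim: s1 => [|y s1 IH] /=; [right | case=> [->|/IH[]]; auto]. Qed.

Lemma okt_subs Q t u : okt Q t -> List.In u (subs t) -> okt Q u /\ (bdepth u <= bdepth t)%N.
Proof.
elim: t => [g|op l IHl r IHr] h [<-|] //= hu.
have [_ [hl hr]] := h; case: (in_cat_list hu) => [/(IHl hl)|/(IHr hr)] [? ?];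
 split=> //; apply: leqW; rewrite leq_max; apply/orP; [by left | by right].
Qed.

Lemma bsize_gt0 t : (0 < bsize t)%N.
Proof. by elim: t => //= op l hl r hr; rewrite addn_gt0 hl. Qed.

(** Subtrees rooted at the same level have disjoint sets of leaves. *)
Lemma sum_subs t : (\sum_(u <- subs t) bsize u <= (bdepth t).+1 * bsize t)%N.
Proof.
elim: t => [g|op l IHl r IHr]; first by rewrite /= big_seq1.
rewrite [subs _]/= big_cons big_cat /= mulSn leq_add2l.
apply: leq_trans (leq_add IHl IHr) _; rewrite mulnDr.
by apply: leq_add; rewrite leq_mul2r ltnS ?leq_maxl ?leq_maxr orbT.
Qed.

Lemma size_subs t : (size (subs t) <= 2 * bsize t)%N.
Proof.
suff : ((size (subs t)).+1 <= 2 * bsize t)%N by exact: ltnW.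
elim: t => //= op l IHl r IHr; rewrite size_cat mulnDr.
by apply: leq_trans (leq_add IHl IHr); rewrite addSn addnS.
Qed.

End Trees.

(** * The density bound by induction over a binary formula *)

Section Recursion.
Variables (k N : nat) (R : realFieldType) (X : cube (edges k N)) (eps Lam : R) (D : nat).
Hypotheses (N0 : (0 < N)%N) (eps0 : 0 < eps) (eps1 : eps <= 1) (Lam1 : 1 <= Lam) (D0 : (0 < D)%N).
Implicit Types (H B : {set 'I_k}) (S T : {set 'I_k.+1}) (g : cube (edges k N) -> bool)
  (t u : bt (edges k N)) (v n : nat) (C : R).

(** [eps] will be N^(-1/16): a component costs a full factor N, a doubling of length a sixteenth
    root of it, and all exponents stay natural numbers. *)
Definition small g : Prop :=
  forall S H, bdd S (sens g X H) (Lam * eps ^+ (16 * cc H (free S))).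

Let eps_ge v : 0 <= eps ^+ v. Proof. exact/exprn_ge0/ltW. Qed.
Let eps_le v w : (v <= w)%N -> eps ^+ w <= eps ^+ v.
Proof. by move=> h; apply: ler_wiXn2l => //; exact: ltW. Qed.
Let Lam0 : 0 <= Lam. Proof. exact: le_trans Lam1. Qed.

(** The smaller of two bounds is at most their geometric mean. *)
Lemma bdd_geomean S (P : pred (embedding k N)) (a b c : R) :
  0 <= a -> 0 <= b -> 0 <= c -> a * b <= c ^+ 2 -> bdd S P a -> bdd S P b -> bdd S P c.
Proof.
move=> a0 b0 c0 ab hPa hPb.
have [ac|ca] := leP a c; first exact: bdd_sub hPa.
have [bc|cb] := leP b c; first exact: bdd_sub hPb.
suff : c ^+ 2 < a * b by rewrite ltNge ab.
by rewrite expr2; apply: ltr_pM.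
Qed.

Definition bounded n C := forall H t S v, (#|H| <= n)%N -> okt small t -> (bdepth t < D)%N ->
  good H (free S) v -> bdd S (sens (beval t) X H) (C * (bsize t)%:R * eps ^+ v).

Lemma bound_A n C H B u g S v : 0 <= C -> bounded n C -> (#|B| <= n)%N ->
  okt small u -> (bdepth u < D)%N -> small g -> ruleA H B (free S) v ->
  bdd S (fun a => sens (beval u) X B a && sens g X H a) (Lam * C * (bsize u)%:R * eps ^+ v).
Proof.
move=> C0 hn hB hu hd hg [v' hv' hv].
have h1 := hn B u S v' hB hu hd hv'.
have h2 := hg (S :|: verts B) H; rewrite free_verts in h2.
have := bdd_join N0 (mulr_ge0 Lam0 (eps_ge _)) (fun a b => @sens_agree k N (beval u) X B a b) h1 h2.
apply: bdd_sub => //.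
have -> : C * (bsize u)%:R * eps ^+ v' * (Lam * eps ^+ (16 * cc H (free S :\: touch B))) =
  Lam * C * (bsize u)%:R * eps ^+ (v' + 16 * cc H (free S :\: touch B)) by rewrite exprD; move: (_%:R) (eps ^+ _) (eps ^+ _) => *; ring.
by apply: ler_wpM2l; [rewrite !mulr_ge0 ?ler0n | exact: eps_le].
Qed.

(** For [g1] only smallness is used, so a single leaf count enters. *)
Lemma bound_B n C H B1 B2 g1 u2 g S v : 0 <= C -> bounded n C -> (#|B2| <= n)%N ->
  small g1 -> okt small u2 -> (bdepth u2 < D)%N -> small g -> ruleB H B1 B2 (free S) v ->
  bdd S (fun a => sens g1 X B1 a && (sens (beval u2) X B2 a && sens g X H a))
    (Lam ^+ 2 * C * (bsize u2)%:R * eps ^+ v).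
Proof.
move=> C0 hn hB hg1 hu hd hg [v' hv' hv].
rewrite -free_verts in hv'; have h1 := hn B2 u2 _ v' hB hu hd hv'.
have h2 := hg (S :|: verts B1 :|: verts B2) H; rewrite !free_verts in h2.
have h12 := bdd_join N0 (mulr_ge0 Lam0 (eps_ge _)) (fun a b => @sens_agree k N (beval u2) X B2 a b) h1 h2.
have w0 : 0 <= C * (bsize u2)%:R * eps ^+ v' * (Lam * eps ^+ (16 * cc H (free S :\: touch B1 :\: touch B2))).
  by do !apply: mulr_ge0.
have := bdd_join N0 w0 (fun a b => @sens_agree k N g1 X B1 a b) (hg1 S B1) h12.
apply: bdd_sub => //.
set x := cc B1 _; set y := cc H _.
have -> : Lam * eps ^+ (16 * x) * (C * (bsize u2)%:R * eps ^+ v' * (Lam * eps ^+ (16 * y))) =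
  Lam ^+ 2 * C * (bsize u2)%:R * eps ^+ (16 * x + v' + 16 * y).
  rewrite (exprD eps (16 * x + v') (16 * y)) (exprD eps (16 * x) v').
  by move: (_%:R) (eps ^+ (16 * x)) (eps ^+ v') (eps ^+ (16 * y)) => *; ring.
by apply: ler_wpM2l; [rewrite !mulr_ge0 ?ler0n ?exprn_ge0 | exact: eps_le].
Qed.

(** Here both children are bounded inductively, at the price of a product of two leaf counts. *)
Lemma bound_join n C H B1 B2 u1 u2 g S v1 v2 : 0 <= C -> bounded n C ->
  (#|B1| <= n)%N -> (#|B2| <= n)%N ->
  okt small u1 -> (bdepth u1 < D)%N -> okt small u2 -> (bdepth u2 < D)%N -> small g ->
  good B1 (free S) v1 -> good B2 (free S :\: touch B1) v2 ->
  bdd S (fun a => sens (beval u1) X B1 a && (sens (beval u2) X B2 a && sens g X H a))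
    (Lam * C ^+ 2 * (bsize u1)%:R * (bsize u2)%:R *
     eps ^+ (v1 + v2 + 16 * cc H (free S :\: touch B1 :\: touch B2))).
Proof.
move=> C0 hn hB1 hB2 hu1 hd1 hu2 hd2 hg gv1 gv2.
rewrite -free_verts in gv2.
have h0 := hn B1 u1 _ v1 hB1 hu1 hd1 gv1; have h1 := hn B2 u2 _ v2 hB2 hu2 hd2 gv2.
have h2 := hg (S :|: verts B1 :|: verts B2) H; rewrite !free_verts in h2.
have h12 := bdd_join N0 (mulr_ge0 Lam0 (eps_ge _)) (fun a b => @sens_agree k N (beval u2) X B2 a b) h1 h2.
have w0 : 0 <= C * (bsize u2)%:R * eps ^+ v2 * (Lam * eps ^+ (16 * cc H (free S :\: touch B1 :\: touch B2))).
  by do !apply: mulr_ge0.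
have := bdd_join N0 w0 (fun a b => @sens_agree k N (beval u1) X B1 a b) h0 h12.
apply: bdd_sub => //.
set y := cc H _; rewrite (exprD eps (v1 + v2) (16 * y)) (exprD eps v1 v2) le_eqVlt.
apply/orP; left; apply/eqP.
move: (bsize u1)%:R (bsize u2)%:R (eps ^+ v1) (eps ^+ v2) (eps ^+ (16 * y)) => *; ring.
Qed.

(** Move to a child whose set still has more than [m] positions in [I]. When neither has, one of
    them has more than [m / 2]. A leaf is never the starting point, as its set has at most one
    position. *)
Lemma descend (I : {set 'I_k}) m t H a : okt small t -> (0 < m < #|H :&: I|)%N ->
  sens (beval t) X H a -> exists B, exists2 u, List.In u (subs t) &
    [/\ B \subset H, (#|B :&: I| <= m)%N, (m < 2 * #|B :&: I|)%N & sens (beval u) X B a].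
Proof.
elim: t H => [g|op l IHl r IHr] H /=.
  case=> _ hg hm hs; have := sens_leaf hg hs.
  have := subset_leq_card (subsetIl H I); move: hm.
  by move: #|H| #|H :&: I| => x y *; lia.
case=> _ [okl okr] hm /sens_op[H1 [H2 [eH s1 s2]]].
have hc : (#|H :&: I| <= #|H1 :&: I| + #|H2 :&: I|)%N.
  by apply: leq_trans (leq_card_setU _ _).1; rewrite -setIUl eH.
have [S1 S2] : H1 \subset H /\ H2 \subset H by rewrite -eH subsetUl subsetUr.
have [m1|m1] := leqP #|H1 :&: I| m; last first.
  have [|B [u hu [BH h1 h2 h3]]] := IHl H1 okl _ s1; first by rewrite m1; case/andP: hm => ->.
  exists B, u; first by right; apply/List.in_or_app; left.
  by split=> //; exact: subset_trans S1.
have [m2|m2] := leqP #|H2 :&: I| m; last first.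
  have [|B [u hu [BH h1 h2 h3]]] := IHr H2 okr _ s2; first by rewrite m2; case/andP: hm => ->.
  exists B, u; first by right; apply/List.in_or_app; right.
  by split=> //; exact: subset_trans S2.
have self t' : List.In t' (subs t') by case: t' => [g|op' l' r']; left.
have [h|h] := leqP (2 * #|H1 :&: I|) m.
  exists H2, r; first by right; apply/List.in_or_app; right; exact: self.
  split=> //; move: hm hc h; move: #|H :&: I| #|H1 :&: I| #|H2 :&: I| => *; lia.
by exists H1, l; first by right; apply/List.in_or_app; left; exact: self.
Qed.

(** The loss at one gate: at most two uses of smallness, [D] for the sum over the subformulas and
    [2 ^ k] for the choice of [B]. *)
Definition kap : R := Lam ^+ 2 * D%:R * (2 ^ k)%:R.

Let D1 : 1 <= D%:R :> R. Proof. by rewrite ler1n. Qed.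
Let Lam_sq : Lam <= Lam ^+ 2. Proof. by rewrite expr2 ler_peMr. Qed.

Lemma kap_ge : Lam ^+ 2 * D%:R <= kap.
Proof. by rewrite /kap ler_peMr ?mulr_ge0 ?exprn_ge0 ?ler0n // ler1n expn_gt0. Qed.

Lemma Lam2_kap : Lam ^+ 2 <= kap.
Proof. by apply: le_trans kap_ge; rewrite ler_peMr ?exprn_ge0. Qed.

Lemma Lam_kap : Lam <= kap. Proof. exact: le_trans Lam_sq Lam2_kap. Qed.

Lemma kap_ge0 : 0 <= kap. Proof. exact: le_trans Lam_kap. Qed.

Lemma sub_const C c (L1 L : nat) v : 0 <= C -> c <= kap -> (L1 <= L)%N ->
  c * C * L1%:R * eps ^+ v <= C * kap * L%:R * eps ^+ v.
Proof.
move=> C0 cK LL; rewrite ler_wpM2r //.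
apply: (@le_trans _ _ (C * kap * L1%:R)).
  by rewrite ler_wpM2r ?ler0n // mulrC ler_wpM2l.
by rewrite ler_wpM2l ?ler_nat // mulr_ge0 // kap_ge0.
Qed.

Lemma sum_subs_D t : (bdepth t < D)%N -> (\sum_(u <- subs t) bsize u <= D * bsize t)%N.
Proof. by move=> h; apply: leq_trans (sum_subs t) _; rewrite leq_mul2r h orbT. Qed.

(** Summed over the subformulas, the bound for [B] followed by [H2] has a leaf factor of at most
    [(D * L) ^ 2]; smallness for [H] has none. Their geometric mean is linear in [L]. *)
Lemma gate_C n C H H1 H2 t1 t2 g S v : 0 <= C -> bounded n C ->
  H1 :|: H2 = H -> (#|H1| <= n)%N -> (#|H2| <= n)%N ->
  okt small t1 -> okt small t2 -> (bdepth t1 < D)%N -> (bdepth t2 < D)%N -> small g ->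
  ruleC H H1 H2 (free S) v ->
  bdd S (fun a => sens g X H a && (sens (beval t1) X H1 a && sens (beval t2) X H2 a))
    (C * kap * (bsize t1 + bsize t2)%:R * eps ^+ v).
Proof.
move=> C0 hn eH n1 n2 ok1 ok2 d1 d2 hg [I [m [hm hC]]].
pose J (B : {set 'I_k}) := [&& B \subset H1, #|B :&: I| <= m & m < 2 * #|B :&: I|]%N.
pose P (B : {set 'I_k}) (a : embedding k N) :=
  has (fun u => sens (beval u) X B a) (subs t1) && (sens (beval t2) X H2 a && sens g X H a).
set L := (bsize t1 + bsize t2)%N.
pose c : R := Lam * C * (D * L)%:R * eps ^+ v.
have c0 : 0 <= c by rewrite /c !mulr_ge0 ?ler0n.
have hB B : J B -> bdd S (P B) c.
  case/and3P=> BH1 hB1 hB2.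
  have hBn : (#|B| <= n)%N by apply: leq_trans n1; exact: subset_leq_card.
  have hsum : (\sum_(u <- subs t1) bsize u <= D * L)%N.
    by apply: leq_trans (sum_subs_D d1) _; rewrite leq_mul2l leq_addr orbT.
  have [hA|[v1 [v2 [g1 g2 hv]]]] := hC B BH1 hB1 hB2.
    apply: (@bdd_sub _ _ _ _ _ (fun a => has (fun u => sens (beval u) X B a && sens g X H a) (subs t1))
      (\sum_(u <- subs t1) Lam * C * (bsize u)%:R * eps ^+ v) _).
    - by move=> a /andP[hh /andP[_ hg']]; rewrite unfold_in; elim: (subs t1) hh => //= u l IH /orP[->|/IH ->]; rewrite ?hg' ?orbT.
    - rewrite -mulr_suml -mulr_sumr -natr_sum ler_wpM2r // ler_wpM2l ?mulr_ge0 //.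
      by rewrite ler_nat.
    apply: bdd_has => u hu; have [oku du] := okt_subs ok1 hu.
    exact: (bound_A C0 hn hBn oku (leq_ltn_trans du d1) hg hA).
  set y := cc H (free S :\: touch B :\: touch H2) in hv; set y' := cc H (free S) in hv.
  apply: (@bdd_geomean S (P B)
    (Lam * C ^+ 2 * (\sum_(u <- subs t1) bsize u)%:R * (bsize t2)%:R * eps ^+ (v1 + v2 + 16 * y))
    (Lam * eps ^+ (16 * y'))) => //.
  - do 3 (apply: mulr_ge0 => //); apply: mulr_ge0 => //; exact: exprn_ge0.
  - exact: mulr_ge0.
  - have e1 : (\sum_(u <- subs t1) bsize u)%:R * (bsize t2)%:R <= (D * L)%:R ^+ 2 :> R.
      rewrite expr2 -!natrM ler_nat leq_mul // /L mulnDr.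
      apply: leq_trans (leq_addl _ _); exact: leq_pmull.
    have e2 : eps ^+ (v1 + v2 + 16 * y) * eps ^+ (16 * y') <= eps ^+ v * eps ^+ v.
      rewrite -(exprD eps (v1 + v2 + 16 * y) (16 * y')) -(exprD eps v v).
      by apply: eps_le; clear - hv; lia.
    rewrite /c; move: (eps ^+ (v1 + v2 + 16 * y)) (eps ^+ (16 * y')) (eps ^+ v) e2 (eps_ge (v1 + v2 + 16 * y)) (eps_ge (16 * y')).
    move: (_%:R) ((bsize t2)%:R) ((D * L)%:R) e1 (ler0n R (\sum_(u <- subs t1) bsize u)%N) (ler0n R (bsize t2)).
    move=> p p' q e1 p0 p'0 x x' z e2 x0 x'0.
    have -> : Lam * C ^+ 2 * p * p' * x * (Lam * x') = Lam ^+ 2 * C ^+ 2 * ((p * p') * (x * x')) by ring.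
    have -> : (Lam * C * q * z) ^+ 2 = Lam ^+ 2 * C ^+ 2 * (q ^+ 2 * (z * z)) by ring.
    by rewrite ler_wpM2l ?mulr_ge0 ?exprn_ge0 // ler_pM // mulr_ge0.
  - apply: (@bdd_sub _ _ _ _ _ (fun a => has (fun u => sens (beval u) X B a && (sens (beval t2) X H2 a && sens g X H a)) (subs t1))
      (\sum_(u <- subs t1) Lam * C ^+ 2 * (bsize u)%:R * (bsize t2)%:R * eps ^+ (v1 + v2 + 16 * y)) _).
    + by move=> a /andP[hh hg']; rewrite unfold_in; elim: (subs t1) hh => //= u l IH /orP[->|/IH ->]; rewrite ?hg' ?orbT.
    + by rewrite -!mulr_suml -mulr_sumr -natr_sum.
    apply: bdd_has => u hu; have [oku du] := okt_subs ok1 hu.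
    have hj := @bound_join n C H B H2 u t2 g S v1 v2 C0 hn hBn n2 oku (leq_ltn_trans du d1) ok2 d2 hg g1 g2.
    exact: hj.
  - by apply: bdd_sub (hg S H) => // a /andP[_ /andP[_]].
apply: bdd_sub (bdd_exists c0 hB).
  move=> a /andP[sg /andP[s1 s2]]; have [B [u hu [BH h1 h2 h3]]] := descend ok1 hm s1.
  apply/existsP; exists B; rewrite /J BH h1 h2 /P s2 sg /= andbT.
  by elim: (subs t1) hu => //= u' l IH [->|/IH ->]; rewrite ?h3 ?orbT.
have -> : #|{: {set 'I_k}}| = (2 ^ k)%N by rewrite -cardsT -powersetT card_powerset cardsT card_ord.
rewrite /c /kap natrM.
have -> : (2 ^ k)%:R * (Lam * C * (D%:R * L%:R) * eps ^+ v) =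
   (Lam * D%:R * (2 ^ k)%:R) * C * L%:R * eps ^+ v :> R.
  by move: (2 ^ k)%:R D%:R L%:R (eps ^+ v) => *; ring.
apply: sub_const => //; rewrite /kap ler_wpM2r ?ler0n // ler_wpM2r ?ler0n //.
Qed.

Lemma gate n C H H1 H2 t1 t2 g S v : 1 <= C -> bounded n C ->
  H1 :|: H2 = H -> (#|H1| <= n)%N -> (#|H2| <= n)%N ->
  okt small t1 -> okt small t2 -> (bdepth t1 < D)%N -> (bdepth t2 < D)%N -> small g ->
  good H (free S) v ->
  bdd S (fun a => sens g X H a && (sens (beval t1) X H1 a && sens (beval t2) X H2 a))
    (C * kap * (bsize t1 + bsize t2)%:R * eps ^+ v).
Proof.
move=> C1 hn eH n1 n2 ok1 ok2 d1 d2 hg hgood; have C0 : 0 <= C by exact: le_trans C1.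
have ks1 := okt_eval ok1; have ks2 := okt_eval ok2.
have [hv|[hA|hA]|[hB|hB]|hC] := step eH hgood.
- apply: (@bdd_sub _ _ _ _ _ (sens g X H) (Lam * eps ^+ (16 * cc H (free S))) _).
  + by move=> a /andP[].
  + apply: (@le_trans _ _ (Lam * C * 1%:R * eps ^+ v)).
      rewrite mulr1 -!mulrA ler_wpM2l //; apply: le_trans (eps_le hv) _.
      by rewrite ler_peMl.
    by apply: sub_const => //; [exact: Lam_kap | rewrite addn_gt0 bsize_gt0].
  exact: hg.
- apply: bdd_sub (bound_A C0 hn n1 ok1 d1 hg hA); first by move=> a /andP[h1 /andP[h2 _]]; rewrite unfold_in h1 h2.
  by apply: sub_const; rewrite ?leq_addr // Lam_kap.
- apply: bdd_sub (bound_A C0 hn n2 ok2 d2 hg hA); first by move=> a /andP[h1 /andP[_ h2]]; rewrite unfold_in h1 h2.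
  by apply: sub_const; rewrite ?leq_addl // Lam_kap.
- apply: bdd_sub (bound_B C0 hn n2 ks1 ok2 d2 hg hB); first by move=> a /andP[h1 /andP[h2 h3]]; rewrite unfold_in h1 h2 h3.
  by apply: sub_const; rewrite ?leq_addl // Lam2_kap.
- apply: bdd_sub (bound_B C0 hn n1 ks2 ok1 d1 hg hB); first by move=> a /andP[h1 /andP[h2 h3]]; rewrite unfold_in h1 h2 h3.
  by apply: sub_const; rewrite ?leq_addr // Lam2_kap.
exact: gate_C C0 hn eH n1 n2 ok1 ok2 d1 d2 hg hC.
Qed.

Lemma good_small H W v : (#|H| <= 1)%N -> good H W v -> (v <= 16 * cc H W)%N.
Proof.
move=> H1 [//|[a [b [r [bk /subsetIP[IH IW] hl hv]]]]].
have hba : (b - a <= 1)%N by rewrite -(card_itv a bk); apply: leq_trans (subset_leq_card IH) H1.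
have r0 : r = 0%N.
  have : (2 ^ (r + 2 * st H a b) <= 2 ^ 0)%N by exact: leq_trans hl hba.
  by rewrite leq_exp2l //; lia.
apply: leq_trans hv _; rewrite r0 add0n leq_mul2l; apply: cc_mono; exact: subsetDl.
Qed.

(** The loss when the bound on [#|H|] grows by one: [D] for the levels of the tree, the square for
    the pair of children's sets, [kap] for the gate. *)
Definition blowup : R := D%:R * (2 ^ k)%:R ^+ 2 * kap.

Lemma kap_blowup : kap <= blowup.
Proof.
rewrite /blowup ler_peMl ?kap_ge0 // -[leLHS]mulr1 ler_pM //.
by rewrite exprn_ege1 // ler1n expn_gt0.
Qed.

Lemma blowup_ge1 : 1 <= blowup.
Proof. exact: le_trans Lam1 (le_trans Lam_kap kap_blowup). Qed.

Lemma small_bound n H t S v : okt small t -> (#|H| <= 1)%N -> good H (free S) v ->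
  bdd S (sens (beval t) X H) (blowup ^+ n.+1 * (bsize t)%:R * eps ^+ v).
Proof.
move=> ok H1 hg; apply: bdd_sub (okt_eval ok S H) => //.
apply: (@le_trans _ _ (blowup ^+ n.+1 * 1 * eps ^+ v)); last first.
  rewrite ler_wpM2r // ler_wpM2l ?ler1n ?bsize_gt0 // exprn_ge0 //.
  exact: le_trans blowup_ge1.
rewrite mulr1; apply: ler_pM => //; last exact/eps_le/good_small.
apply: le_trans (le_trans Lam_kap kap_blowup) _.
by rewrite exprS ler_peMr ?exprn_ege1 ?blowup_ge1 // (le_trans _ blowup_ge1).
Qed.

(** Induction on the size of [H], and within it on the tree. Either a child is sensitive on all of
    [H], and the inner induction applies, or both sets are proper and [gate] applies. The gate terms
    are added, giving depth times size, so the constant is multiplied at most once per element of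
    [H] and not once per level. *)
Theorem recursion n : bounded n (blowup ^+ n.+1).
Proof.
elim: n => [|n IH] H t S v hH ok hd hg.
  by apply: small_bound => //; exact: leq_trans hH _.
set C := blowup ^+ n.+1 in IH.
have C1 : 1 <= C by rewrite exprn_ege1 // blowup_ge1.
have C0 : 0 <= C by exact: le_trans C1.
pose K : R := (2 ^ k)%:R ^+ 2 * (C * kap) * eps ^+ v.
have K0 : 0 <= K.
  by apply: mulr_ge0 => //; apply: mulr_ge0; [exact: exprn_ge0 | exact/mulr_ge0/kap_ge0].
suff h : bdd S (sens (beval t) X H) ((bdepth t).+1%:R * (bsize t)%:R * K).
  apply: bdd_sub h => //; rewrite [leRHS](_ : _ = D%:R * (bsize t)%:R * K); last first.
    rewrite exprS -/C /K /blowup; move: (2 ^ k)%:R D%:R (bsize t)%:R (eps ^+ v) => *; ring.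
  by rewrite ler_wpM2r // ler_wpM2r ?ler0n // ler_nat.
elim: t ok hd => [g|op l IHl r IHr] ok hd.
  have [H1|H1] := leqP #|H| 1.
    apply: bdd_sub (okt_eval ok S H) => //; rewrite /= !mul1r /K.
    apply: ler_pM => //; last exact/eps_le/good_small.
    apply: le_trans Lam_kap _.
    rewrite mulrA ler_peMl ?kap_ge0 //; rewrite -[leLHS]mulr1 ler_pM //.
    by rewrite exprn_ege1 // ler1n expn_gt0.
  case: ok => _ hl; apply: bdd_sub (bdd_pred0 S (_ : 0 <= (bdepth (BLeaf g)).+1%:R * (bsize (BLeaf g))%:R * K)) => //.
    by move=> a ha; have := sens_leaf hl ha; rewrite leqNgt H1.
  by rewrite !mulr_ge0 ?ler0n.
have hgt := okt_eval ok; have [_ [okl okr]] := ok.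
have hdl : (bdepth l < D)%N by apply: leq_trans hd; rewrite /= ltnS; apply: leqW; exact: leq_maxl.
have hdr : (bdepth r < D)%N by apply: leq_trans hd; rewrite /= ltnS; apply: leqW; exact: leq_maxr.
have hl := IHl okl hdl; have hr := IHr okr hdr.
set d := bdepth (BNode op l r); set L := (bsize l + bsize r)%N.
pose J (p : {set 'I_k} * {set 'I_k}) := [&& p.1 :|: p.2 == H, p.1 != H & p.2 != H].
pose P (p : {set 'I_k} * {set 'I_k}) (a : embedding k N) :=
  sens (beval (BNode op l r)) X H a && (sens (beval l) X p.1 a && sens (beval r) X p.2 a).
have hP p : J p -> bdd S (P p) (C * kap * L%:R * eps ^+ v).
  case/and3P=> /eqP e e1 e2.
  have ltH (B : {set 'I_k}) : B \subset H -> B != H -> (#|B| <= n)%N.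
    move=> BH nB; rewrite -ltnS; apply: leq_trans hH; apply: proper_card.
    by rewrite properEneq nB.
  have s1 : p.1 \subset H by rewrite -e subsetUl.
  have s2 : p.2 \subset H by rewrite -e subsetUr.
  exact: (@gate n C H p.1 p.2 l r (beval (BNode op l r)) S v C1 IH e (ltH _ s1 e1) (ltH _ s2 e2)
    okl okr hdl hdr hgt hg).
have x0 : 0 <= C * kap * L%:R * eps ^+ v by rewrite !mulr_ge0 ?ler0n ?kap_ge0.
apply: bdd_sub (bddU (bddU hl hr) (bdd_exists x0 hP)).
  move=> a ha; rewrite unfold_in; have {}ha : sens (fun x => op (beval l x) (beval r x)) X H a by [].
  have [H1 [H2 [e s1 s2]]] := sens_op ha.
  have [e1|n1] := eqVneq H1 H; first by rewrite -e1 s1.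
  have [e2|n2] := eqVneq H2 H; first by rewrite -e2 s2 orbT.
  by apply/orP; right; apply/existsP; exists (H1, H2); rewrite /J /P /= e eqxx n1 n2 s1 s2 ha.
have -> : #|{: {set 'I_k} * {set 'I_k}}| = ((2 ^ k) ^ 2)%N.
  by rewrite card_prod -cardsT -powersetT card_powerset cardsT card_ord mulnn.
have -> : ((2 ^ k) ^ 2)%:R * (C * kap * L%:R * eps ^+ v) = L%:R * K.
  by rewrite natrX /K; move: (2 ^ k)%:R L%:R (eps ^+ v) => *; ring.
rewrite -!mulrDl ler_wpM2r // -!natrM -!natrD ler_nat.
have -> : bsize (BNode op l r) = L by [].
rewrite [leqRHS]mulSn [leqRHS]addnC leq_add2r /L mulnDr.
by apply: leq_add; rewrite leq_mul2r /d /= ltnS ?leq_maxl ?leq_maxr orbT.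
Qed.

End Recursion.

(** * Random restrictions of a layered graph *)

Lemma sum_pair (V : nmodType) (A B : finType) (F : A * B -> V) :
  \sum_c F c = \sum_a \sum_b F (a, b).
Proof. by rewrite pair_bigA; apply: eq_bigr => -[]. Qed.

Section Cells.
Variables (R : realFieldType) (E : finType) (q P : R).
Hypotheses (q0 : 0 < q) (q1 : q <= 1) (P_gt0 : 0 < P) (P_le1 : P <= 1).

(* A cell [(y, (r, z))] sets an edge to [y && odflt z r]; the edge is free when [y] holds
   and [r] is a star. *)
Definition cell : finType := (bool * (option bool * bool))%type.
Definition cweight (c : cell) : R := (if c.1 then q else 1 - q) * (rw P c.2.1 * 2^-1).
Definition cval (c : cell) : bool := c.1 && odflt c.2.2 c.2.1.
Definition cstar (c : cell) : bool := c.1 && (c.2.1 == None).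

Definition world := {ffun E -> cell}.
Implicit Types (w : world) (X : cube E) (D : {set E}).
Definition wweight w : R := \prod_e cweight (w e).
Definition wval w : cube E := [ffun e => cval (w e)].
Definition wmask w : {ffun E -> bool} := [ffun e => (w e).1].
Definition wrestr w : restr E := [ffun e => (w e).2.1].

Lemma cweight_ge0 c : 0 <= cweight c.
Proof.
have h : 0 <= rw P c.2.1 by apply: rw_ge0; rewrite (ltW P_gt0) P_le1.
apply: mulr_ge0; last by rewrite mulr_ge0 ?invr_ge0 ?ler0n.
by case: ifP => _; [exact: ltW | rewrite subr_ge0].
Qed.

Lemma wweight_ge0 w : 0 <= wweight w.
Proof. by apply: prodr_ge0 => e _; exact: cweight_ge0. Qed.

Lemma sum_cell (F : cell -> R) : \sum_c F c =
  F (true, (None, true)) + F (true, (None, false)) +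
  F (true, (Some true, true)) + F (true, (Some true, false)) +
  F (true, (Some false, true)) + F (true, (Some false, false)) +
  (F (false, (None, true)) + F (false, (None, false)) +
  F (false, (Some true, true)) + F (false, (Some true, false)) +
  F (false, (Some false, true)) + F (false, (Some false, false))).
Proof.
rewrite sum_pair big_bool /=.
by congr (_ + _); rewrite sum_pair sum_option_bool !big_bool /= !addrA.
Qed.

Lemma sum_cweight : \sum_c cweight c = 1.
Proof. by rewrite sum_cell /cweight /rw /=; field. Qed.

Lemma sum_cval : \sum_(c | cval c) cweight c = q / 2.
Proof. by rewrite big_mkcond sum_cell /cweight /cval /rw /=; field. Qed.

Lemma eta_ge0 : 0 <= q * P / 2.
Proof. by apply: divr_ge0 => //; apply: mulr_ge0; exact: ltW. Qed.

(** A cell is free with value [b] with probability exactly [q * P / 2], for either [b]. So whichever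
    value is observed, the edge is free with at least that conditional probability. *)
Lemma sum_cstar b : q * P / 2 * \sum_(c | cval c == b) cweight c <=
  \sum_(c | (cval c == b) && cstar c) cweight c.
Proof.
have -> : \sum_(c | (cval c == b) && cstar c) cweight c = q * P / 2.
  by rewrite big_mkcond sum_cell /cweight /cval /cstar /rw /=; case: b => /=; field.
have le1 : \sum_(c | cval c == b) cweight c <= 1.
  rewrite -sum_cweight [leRHS](bigID (fun c => cval c == b)) /= lerDl.
  by apply: sumr_ge0 => c _; exact: cweight_ge0.
by rewrite -[leRHS]mulr1 ler_wpM2l // eta_ge0.
Qed.

Lemma sum_world (Q : E -> pred cell) :
  mu wweight (fun w => [forall e, Q e (w e)]) = \prod_e \sum_(c | Q e c) cweight c.
Proof.
rewrite (bigA_distr_big_dep Q (fun _ => cweight)) /mu; apply: eq_bigl => w.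
by apply/forallP/familyP => h e; have := h e.
Qed.

Lemma wweight_sum : \sum_w wweight w = 1.
Proof.
transitivity (mu wweight (fun w => [forall e : E, true])).
  by apply: eq_bigl => w; symmetry; exact/forallP.
rewrite (sum_world (fun _ _ => true)) big1 // => e _; exact: sum_cweight.
Qed.

Lemma mu_wval D : mu wweight (fun w => [forall e in D, wval w e]) = (q / 2) ^+ #|D|.
Proof.
transitivity (mu wweight (fun w => [forall e, (e \in D) ==> cval (w e)])).
  by apply: eq_bigl => w; apply: eq_forallb => e; rewrite ffunE.
rewrite (sum_world (fun e c => (e \in D) ==> cval c)) (bigID (mem D)) /=.
rewrite [X in _ * X]big1 ?mulr1 => [|e /negbTE eD]; last first.
  by rewrite -[RHS]sum_cweight; apply: eq_bigl => c; rewrite eD.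
rewrite (eq_bigr (fun=> q / 2)) ?prodr_const // => e eD.
by rewrite -sum_cval; apply: eq_bigl => c; rewrite eD.
Qed.

Lemma mu_star X D :
  (q * P / 2) ^+ #|D| * mu wweight (fun w => wval w == X) <=
  mu wweight (fun w => (wval w == X) && [forall e in D, cstar (w e)]).
Proof.
have -> : mu wweight (fun w => wval w == X) = \prod_e \sum_(c | cval c == X e) cweight c.
  rewrite -(sum_world (fun e c => cval c == X e)); apply: eq_bigl => w.
  apply/eqP/forallP => [<- e|h]; first by rewrite ffunE.
  by apply/ffunP=> e; rewrite ffunE; exact/eqP.
have -> : mu wweight (fun w => (wval w == X) && [forall e in D, cstar (w e)]) =
   \prod_e \sum_(c | (cval c == X e) && ((e \in D) ==> cstar c)) cweight c.
  rewrite -(sum_world (fun e c => (cval c == X e) && ((e \in D) ==> cstar c))); apply: eq_bigl => w.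
  apply/andP/forallP => [[/eqP <- /forallP h] e|h]; first by rewrite ffunE eqxx /=; exact: h.
  split; last by apply/forallP=> e; case/andP: (h e).
  by apply/eqP/ffunP=> e; rewrite ffunE; case/andP: (h e) => /eqP.
rewrite (bigID (mem D)) [leRHS](bigID (mem D)) /= mulrA.
have nn Q : 0 <= \sum_(c | Q c) cweight c by apply: sumr_ge0 => c _; exact: cweight_ge0.
apply: ler_pM.
- apply: mulr_ge0; last by apply: prodr_ge0.
  exact/exprn_ge0/eta_ge0.
- exact: prodr_ge0.
- rewrite -prodr_const -big_split /=; apply: ler_prod => e eD.
  rewrite mulr_ge0 ?eta_ge0 //=.
  apply: le_trans (sum_cstar (X e)) _; rewrite le_eqVlt; apply/orP; left; apply/eqP.
  by apply: eq_bigl => c; rewrite eD.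
- rewrite le_eqVlt; apply/orP; left; apply/eqP; apply: eq_bigr => e /negbTE eD.
  by apply: eq_bigl => c; rewrite eD andbT.
Qed.

(** Mask and restriction are independent, so a bound valid for every fixed mask holds on average. *)
Lemma mu_restr (B : {ffun E -> bool} -> pred (restr E)) x :
  (forall y, mu (rweight P) (B y) <= x) ->
  mu wweight (fun w => B (wmask w) (wrestr w)) <= x.
Proof.
move=> hB; rewrite /mu big_mkcond /=.
pose yw (y : {ffun E -> bool}) : R := \prod_e (if y e then q else 1 - q).
pose zw (z : {ffun E -> bool}) : R := \prod_(e : E) 2^-1.
pose I y r : R := if B y r then 1 else 0.
have -> : \sum_(w : world) (if B (wmask w) (wrestr w) then wweight w else 0) =
   \sum_y \sum_r \sum_z yw y * (rweight P r * zw z) * I y r.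
  transitivity (\sum_y \sum_(rz : {ffun E -> option bool * bool})
     yw y * (\prod_e (rw P (rz e).1 * 2^-1)) * I y [ffun e => (rz e).1]).
    rewrite (sum_ffun_pair (fun y (rz : {ffun E -> option bool * bool}) => _)) /=.
    apply: eq_bigr => w _; have -> : B (wmask w) (wrestr w) =
       B [ffun e => (w e).1] [ffun e => ([ffun e => (w e).2] e).1].
      by congr (B _ _); apply/ffunP=> e; rewrite !ffunE.
    rewrite /I; case: ifP => _; rewrite ?mulr0 // mulr1 /wweight /yw -big_split /=.
    by apply: eq_bigr => e _; rewrite !ffunE.
  apply: eq_bigr => y _.
  rewrite (sum_ffun_pair (fun r z => yw y * (rweight P r * zw z) * I y r)).
  apply: eq_bigr => rz _; congr (_ * _ * I _ _).
  by rewrite /rweight /zw -big_split; apply: eq_bigr => e _; rewrite !ffunE.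
have zs : \sum_z zw z = 1.
  rewrite /zw -(bigA_distr_bigA (fun (_ : E) (_ : bool) => 2^-1)) /= big1 // => e _.
  by rewrite big_bool /=; field.
have ys : \sum_y yw y = 1.
  rewrite /yw -(bigA_distr_bigA (fun (_ : E) (b : bool) => if b then q else 1 - q)) /= big1 // => e _.
  by rewrite big_bool /=; ring.
apply: (@le_trans _ _ (\sum_y yw y * x)); last by rewrite -mulr_suml ys mul1r.
apply: ler_sum => y _.
apply: (@le_trans _ _ (yw y * mu (rweight P) (B y))).
  rewrite /mu [in leRHS]big_mkcond mulr_sumr; apply: ler_sum => r _.
  have -> : \sum_z yw y * (rweight P r * zw z) * I y r = yw y * (rweight P r * (\sum_z zw z)) * I y r.
    by rewrite !(mulr_sumr, mulr_suml).
  by rewrite zs mulr1 /I; case: ifP => _; rewrite ?mulr1 ?mulr0.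
by rewrite ler_wpM2l //; apply: prodr_ge0 => e _; case: ifP => _; [exact: ltW | rewrite subr_ge0].
Qed.

End Cells.

(** * Vertices and edges of whole components *)

Section Cover.
Variable k : nat.
Implicit Types (H W : {set 'I_k}) (i j x : 'I_k).

Definition hull H W : {set 'I_k} := cover (cpts H W).

Lemma hullP H W x : reflect (x \in H /\ cpt H x \subset W) (x \in hull H W).
Proof.
apply: (iffP bigcupP) => [[C /cptsP[y [yH yW ->]] xC]|[xH xW]].
  by rewrite (cpt_eq xC); split=> //; exact: subsetP (cpt_sub H y) _ xC.
by exists (cpt H x); [apply/cptsP; exists x | exact: cpt_refl].
Qed.

Lemma hull_subl H W : hull H W \subset H.
Proof. by apply/subsetP=> x /hullP[]. Qed.

Lemma hull_subr H W : hull H W \subset W.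
Proof. by apply/subsetP=> x /hullP[xH /subsetP]; apply; exact: cpt_refl. Qed.

Lemma hull_adj H W i j : i \in hull H W -> j \in H -> (i <= j.+1)%N -> (j <= i.+1)%N ->
  j \in hull H W.
Proof.
move=> /hullP[iH iW] jH h1 h2; apply/hullP; split=> //.
by rewrite (cpt_eq (cpt_adj iH jH h1 h2)).
Qed.

Lemma hull_verts H W i j : i \in hull H W -> j \in H ->
  [|| lo j == lo i, lo j == hi i, hi j == lo i | hi j == hi i] -> j \in hull H W.
Proof.
move=> iU jH h; apply: (hull_adj iU jH); move: h;
rewrite -!val_eqE /= /bump /= !add1n; nat_lia.
Qed.

(** A union of paths is a forest. The upper endpoints of all edges and the lower endpoint of the
    first edge of each component are distinct vertices. *)
Lemma card_verts_hull H W : (#|hull H W| + cc H W <= #|verts (hull H W)|)%N.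
Proof.
pose St := [set x in hull H W | ~~ ((0 < x)%N && nm H x.-1)].
have hi_inj : injective (@hi k) by move=> i j /lift_inj.
have lo_inj : injective (@lo k) by move=> i j /(congr1 val) /= h; apply: val_inj.
have cSt : (cc H W <= #|St|)%N.
  apply: leq_trans (leq_imset_card (cpt H) St); apply/subset_leq_card/subsetP=> C.
  case/cptsP=> y [yH yW ->]; have [c [d [cyd dk eC nl nr]]] := cpt_itv yH.
  have ck : (c < k)%N by nat_lia.
  have cC : Ordinal ck \in cpt H y by rewrite eC itvE /=; nat_lia.
  apply/imsetP; exists (Ordinal ck); last by rewrite (cpt_eq cC).
  rewrite inE nl andbT; apply/hullP; rewrite (cpt_eq cC); split=> //.
  exact: subsetP (cpt_sub H y) _ cC.
rewrite -(card_imset _ hi_inj); apply: leq_trans (leq_add (leqnn _) cSt) _.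
rewrite -(card_imset _ lo_inj).
have <- : #|(@hi k @: hull H W) :|: (@lo k @: St)| = (#|@hi k @: hull H W| + #|@lo k @: St|)%N.
  rewrite cardsU (_ : _ :&: _ = set0) ?cards0 ?subn0 //.
  apply/setP=> v; rewrite in_setI in_set0; apply/negP=> /andP[/imsetP[i iU ->] /imsetP[j jS e]].
  move: jS; rewrite inE => /andP[jU /negP]; apply.
  move/(congr1 val): e; rewrite /= /bump /= add1n => e; rewrite -e /=.
  by rewrite nmE; exact: subsetP (hull_subl H W) _ iU.
apply/subset_leq_card/subsetP=> v; rewrite in_setU inE => /orP[] /imsetP[i iU ->].
  by apply/exists_inP; exists i; rewrite ?eqxx ?orbT.
by apply/exists_inP; exists i; rewrite ?eqxx //; move: iU; rewrite inE => /andP[].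
Qed.

End Cover.

Lemma dtle_coord (E : finType) (h : cube E -> cube E) t (g : cube E -> bool) :
  (forall e, exists c : bool -> bool, forall x : cube E, h x e = c (x e)) ->
  dtle t g -> dtle t (fun x => g (h x)).
Proof.
move=> hh; elim: t g => [|t IH] g [hg|] //; try by left=> x y; exact: hg.
case=> e hg; right; exists e => b; have [c hc] := hh e.
apply: dtle_ext (IH _ (hg (c b))) => x; congr g; apply/ffunP=> e'; rewrite ffunE.
case: (eqVneq e' e) => [->|ne]; first by rewrite hc ffunE eqxx.
by have [c' hc'] := hh e'; rewrite !hc' ffunE (negbTE ne).
Qed.

(** * Gates are small over a suitable background *)

Section Smallness.
Variables (k N : nat) (R : realFieldType) (d t : nat) (p : R) (T : bt (edges k N)).
Hypotheses (N0 : (0 < N)%N) (p0 : 0 < p) (p1 : p < 1).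
Notation V := (edges k N).
Implicit Types (X x : cube V) (a b : embedding k N) (Z H : {set 'I_k}) (w : world V).

Definition mask (y : {ffun V -> bool}) (x : cube V) : cube V := [ffun e => y e && x e].
Notation P := (p ^+ d).
Notation q := (N%:R^-1 : R).
Notation Pr := (mu (@wweight R V q P)).

Definition bad_at w (u : bt V) a Z : bool :=
  ~~ `[< dtle t (fun x => beval u (plant (mask (wmask w) (fill (wrestr w) x)) a Z)) >].
Definition bad w : bool := [exists az : embedding k N * {set 'I_k}, has (fun u => bad_at w u az.1 az.2) (subs T)].

Let q_gt0 : 0 < q. Proof. by rewrite invr_gt0 ltr0n. Qed.
Let q_le1 : q <= 1. Proof. by rewrite invf_le1 ?ltr0n // ler1n. Qed.
Let P_gt0 : 0 < P. Proof. exact: exprn_gt0. Qed.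
Let P_le1 : P <= 1. Proof. by rewrite exprn_ile1 // ltW. Qed.
Let W0 w : 0 <= wweight q P w. Proof. exact: wweight_ge0. Qed.

Lemma plant_coord (y : {ffun V -> bool}) a Z e :
  exists c : bool -> bool, forall x, plant (mask y x) a Z e = c (x e).
Proof.
by exists (fun v : bool => (y e && v) || [exists i in Z, e == edge a i]) => x; rewrite !ffunE.
Qed.

(** Masking and planting act on each coordinate separately, so they preserve [AC]. The switching
    lemma is then applied to every subformula, embedding and planted set. *)
Lemma Pr_bad (g : R) s : (0 < t)%N -> 0 < g <= 1 ->
  (1 + 2 * (2 * p / (1 - p)) / g) ^+ t <= 2 -> okt (AC d s) T ->
  Pr bad <= (N ^ k.+1 * 2 ^ k * size (subs T))%:R * ((s * d)%:R * g ^+ t).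
Proof.
move=> t0 hg hw ok; have hp : 0 < p < 1 by rewrite p0 p1.
have one u a Z : List.In u (subs T) -> Pr (fun w => bad_at w u a Z) <= (s * d)%:R * g ^+ t.
  move=> hu; have [oku _] := okt_subs ok hu.
  apply: (mu_restr q_gt0 q_le1 (B := fun y r =>
     ~~ `[< dtle t (fun x => beval u (plant (mask y (fill r x)) a Z)) >])) => y.
  apply: (AC_switching (f := fun x => beval u (plant (mask y x) a Z)) hp hg hw t0).
  apply: (@AC_map _ (fun x => plant (mask y x) a Z)); last exact: okt_eval oku.
  by move=> f; apply: dtle_coord; exact: plant_coord.
have x0 : 0 <= (s * d)%:R * g ^+ t by rewrite mulr_ge0 // exprn_ge0 //; case/andP: hg => /ltW.
apply: le_trans (mu_union W0 (J := predT)
   (Q := fun az w => has (fun u => bad_at w u az.1 az.2) (subs T)) _) _.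
  by move=> w /existsP[az haz]; exists az.
apply: (@le_trans _ _ (\sum_(az : embedding k N * {set 'I_k}) (size (subs T))%:R * ((s * d)%:R * g ^+ t))).
  apply: ler_sum => -[a Z] _; apply: le_trans (mu_has _ _ W0) _.
  have : forall u, List.In u (subs T) -> Pr (fun w => bad_at w u a Z) <= (s * d)%:R * g ^+ t.
    by move=> u hu; exact: one.
  elim: (subs T) => [|u l IH] hl; first by rewrite big_nil mul0r.
  rewrite big_cons /= -natr1 mulrDl mul1r addrC; apply: lerD; last by apply: hl; left.
  by apply: IH => u' hu'; apply: hl; right.
rewrite sumr_const -[leLHS]mulr_natl mulrA -natrM.
rewrite card_prod card_ffun !card_ord -cardsT -powersetT card_powerset cardsT card_ord.
by rewrite lexx.
Qed.

Section AtX.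
Variable X : cube V.
Notation mass := (Pr (fun w => wval w == X)).
Hypotheses (mass_gt0 : 0 < mass)
  (few_bad : Pr (fun w => (wval w == X) && bad w) * (N ^ k.+1)%:R <= mass).

Definition alive w (u : bt V) b : {set V} :=
  \bigcup_(Z : {set 'I_k}) dep (fun x => beval u (plant (mask (wmask w) (fill (wrestr w) x)) b Z)).

Lemma card_alive w u b : ~~ bad w -> List.In u (subs T) -> (#|alive w u b| <= 2 ^ (k + t))%N.
Proof.
move=> nb hu.
have cle (Z : {set 'I_k}) : (#|dep (fun x => beval u (plant (mask (wmask w) (fill (wrestr w) x)) b Z))| <= 2 ^ t)%N.
  apply/ltnW/card_dep/asboolP; rewrite -[`[< _ >]]negbK -/(bad_at w u b Z).
  move: nb => /existsPn/(_ (b, Z)) /=; elim: (subs T) hu => //= v l IH [->|hv].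
    by rewrite negb_or => /andP[].
  by rewrite negb_or => /andP[_]; exact: IH.
rewrite /alive; apply: (@leq_trans (\sum_(Z : {set 'I_k}) 2 ^ t)); last first.
  by rewrite sum_nat_const -cardsT -powersetT card_powerset cardsT card_ord expnD.
elim/big_rec2: _ => [|Z n A _ hA]; first by rewrite cards0.
by apply: leq_trans (leq_card_setU _ _).1 (leq_add (cle Z) hA).
Qed.

(** Planted edges in [U] are free, so they can be realised by the input [x0]; those outside [U]
    coincide with edges of [b]. Thus the sensitivity at [a] is seen by a restricted function that
    knows only [b]. *)
Lemma sens_alive w u a b (H U : {set 'I_k}) i : wval w = X -> sens (beval u) X H a ->
  U \subset H -> (forall j, j \in H -> j \notin U -> edge a j = edge b j) ->
  (forall j, j \in U -> cstar (w (edge a j))) -> i \in U -> edge a i \in alive w u b.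
Proof.
move=> wX hs UH hab hstar iU; have iH := subsetP UH _ iU.
have /existsP[Z /andP[ZH hZ]] := forall_inP hs i iH.
have Xi : X (edge a i) = false.
  by apply/negbTE/negP=> Xi; rewrite plantT ?eqxx in hZ.
pose x0 : cube V := [ffun e => (w e).2.2 || [exists j in (Z :\ i) :&: U, e == edge a j]].
pose F x := plant (mask (wmask w) (fill (wrestr w) x)) b (Z :\: U).
have star j : j \in U -> (w (edge a j)).1 /\ (w (edge a j)).2.1 = None.
  by move=> /hstar /andP[? /eqP].
have F0 : plant X a (Z :\ i) = F x0.
  apply/ffunP=> e; rewrite !ffunE -wX !ffunE /cval.
  have [/exists_inP[j jZ /eqP ej]|nex] := boolP [exists j in (Z :\ i) :&: U, e == edge a j].
    move: jZ; rewrite inE => /andP[jZ jU]; have [y1 r1] := star j jU.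
    rewrite ej y1 r1 /= !orbT; apply/orP; right.
    by apply/exists_inP; exists j.
  rewrite orbF; congr (_ || _).
  have nU j : j \in Z :\ i -> e = edge a j -> j \notin U.
    move=> jZ ej; apply: contra nex => jU; apply/exists_inP; exists j; rewrite ?ej //.
    by rewrite in_setI jZ jU.
  apply/exists_inP/exists_inP=> -[j jZ /eqP ej]; exists j.
  - by rewrite in_setD (nU j) //; move: jZ; rewrite in_setD1 => /andP[].
  - rewrite ej; apply/eqP/hab; last exact: nU.
    by move: jZ; rewrite in_setD1 => /andP[_]; exact: subsetP.
  - move: jZ; rewrite in_setD in_setD1 => /andP[jU ->]; rewrite andbT.
    by apply: contraNneq jU => ->.
  - move: jZ; rewrite ej in_setD => /andP[jU jZ]; rewrite eq_sym; apply/eqP/hab => //.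
    exact: (subsetP ZH).
have [y1 r1] := star i iU.
have x0i : x0 (edge a i) = false.
  have : X (edge a i) = (w (edge a i)).2.2 by rewrite -wX !ffunE /cval y1 r1.
  rewrite Xi ffunE => <- /=; apply/negbTE/negP=> /exists_inP[j jZ /eqP /edge_inj ij].
  by move: jZ; rewrite -ij !inE eqxx.
have F1 : plant X a (i |: Z) = F (upd x0 (edge a i) true).
  have FE x e : F x e = ((w e).1 && odflt (x e) (w e).2.1) || [exists j in Z :\: U, e == edge b j].
    by rewrite !ffunE.
  rewrite plant_upd F0; clearbody F; apply/ffunP=> e; rewrite ffunE (FE x0) FE.
  have [->|ne] := eqVneq e (edge a i).
    by rewrite y1 r1 /= [upd _ _ _ _]ffunE eqxx.
  by rewrite [upd _ _ _ e]ffunE (negbTE ne).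
apply/bigcupP; exists (Z :\: U) => //; rewrite inE; apply/existsP; exists x0.
have -> : upd x0 (edge a i) false = x0 by rewrite -x0i upd_id.
by rewrite F1 F0 in hZ.
Qed.

(** The power counts embeddings made of alive edges and the [1] accounts for bad worlds; [2 / P] is
    the inverse probability that an edge is free, apart from the factor [N]. *)
Definition Lam : R := ((2 ^ (k + t)) ^ k + 1)%:R * (2 / P) ^+ k.

(** Double counting of embeddings and worlds over [X] in which all edges of the embedding in [U] are
    free. Each embedding has a share of at least [(q * P / 2) ^+ #|U|] of the worlds, while a world
    that is not bad admits few embeddings because their edges in [U] must be alive. *)
Lemma count_sens u H S b : List.In u (subs T) ->
  #|[set a | agree (~: verts (hull H (free S))) a b & sens (beval u) X H a]|%:R <=
  Lam * N%:R ^+ #|hull H (free S)|.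
Proof.
move=> hu; set U := hull H (free S); set A := [set a | _ & _].
have UH : U \subset H by exact: hull_subl.
pose D a : {set V} := [set edge a i | i in U].
have cD a : #|D a| = #|U| by rewrite card_imset //; exact: edge_inj.
pose ev a w := (wval w == X) && [forall e in D a, cstar (w e)].
have eta_gt0 : 0 < q * P / 2 by rewrite divr_gt0 // mulr_gt0.
have lower : #|A|%:R * ((q * P / 2) ^+ #|U| * mass) <= \sum_(a in A) Pr (ev a).
  rewrite mulr_natl -sumr_const; apply: ler_sum => a _; rewrite -(cD a).
  exact: mu_star.
have same a j : agree (~: verts U) a b -> j \in H -> j \notin U -> edge a j = edge b j.
  move=> /agreeP hab jH jU; rewrite /edge !hab // inE inE.
    apply/negP=> /exists_inP[i iU h]; move/negP: jU; apply; apply: (hull_verts iU jH).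
    by case/orP: h => /eqP ->; rewrite eqxx ?orbT.
  apply/negP=> /exists_inP[i iU h]; move/negP: jU; apply; apply: (hull_verts iU jH).
  by case/orP: h => /eqP ->; rewrite eqxx ?orbT.
have few w : wval w = X -> ~~ bad w ->
    (#|[set a in A | [forall e in D a, cstar (w e)]]| <= (2 ^ (k + t)) ^ k)%N.
  move=> wX nb; set A' := [set a in A | _].
  pose code a : {ffun 'I_k -> V} := [ffun i => if i \in U then edge a i else edge b i].
  pose F i : pred V := if i \in U then [pred e | e \in alive w u b] else pred1 (edge b i).
  have inj : {in A' &, injective code}.
    move=> a1 a2; rewrite !inE => /andP[/andP[/agreeP h1 _] _] /andP[/andP[/agreeP h2 _] _] /ffunP hc.
    apply/ffunP=> v; have [|nv] := boolP (v \in verts U); last by rewrite h1 ?h2 // inE.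
    rewrite inE => /exists_inP[i iU hv]; have := hc i; rewrite !ffunE iU => -[e1 e2].
    by case/orP: hv => /eqP ->.
  rewrite -(card_in_imset inj); apply: (@leq_trans #|family F|).
    apply/subset_leq_card/subsetP=> f /imsetP[a aA ->]; apply/familyP=> i.
    rewrite /F ffunE; case: ifP => iU; last by rewrite unfold_in /=.
    move: aA; rewrite !inE => /andP[/andP[hab hs] /forall_inP hst].
    apply: (sens_alive (U := U) wX hs UH _ _ iU); first by move=> j; exact: same.
    by move=> j jU; apply: hst; apply: imset_f.
  rewrite card_family foldrE big_image /=.
  apply: (@leq_trans (\prod_(i < k) 2 ^ (k + t))); last by rewrite prod_nat_const card_ord.
  apply: leq_prod => i _; rewrite /F; case: ifP => _; first exact: card_alive.
  by rewrite card1 expn_gt0.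
have upper : \sum_(a in A) Pr (ev a) <= mass * ((2 ^ (k + t)) ^ k + 1)%:R.
  have -> : \sum_(a in A) Pr (ev a) = \sum_(w | wval w == X) wweight q P w *
      #|[set a in A | [forall e in D a, cstar (w e)]]|%:R.
    rewrite /mu (eq_bigr (fun a => \sum_(w | wval w == X)
        (if [forall e in D a, cstar (w e)] then wweight q P w else 0))); last first.
      by move=> a _; rewrite -big_mkcondr.
    rewrite exchange_big; apply: eq_bigr => w _.
    by rewrite -big_mkcondr /= sumr_const mulr_natr; congr (_ *+ _); apply: eq_card => a; rewrite inE.
  (* In a bad world all [N ^ k.+1] embeddings may count; [few_bad] limits their total share to
     [mass]. *)
  rewrite (bigID bad) /= natrD mulrDr mulr1 addrC; apply: lerD.
    rewrite /mu mulr_suml; apply: le_trans (_ : _ <= \sum_(w | (wval w == X) && ~~ bad w) wweight q P w * ((2 ^ (k + t)) ^ k)%:R) _.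
      apply: ler_sum => w /andP[/eqP wX nb]; rewrite ler_wpM2l ?ler_nat //; exact: few.
    rewrite [leRHS](bigID bad) /= lerDr; apply: sumr_ge0 => w _.
    by rewrite mulr_ge0.
  apply: le_trans few_bad; rewrite /mu mulr_suml; apply: ler_sum => w _.
  rewrite ler_wpM2l // ler_nat; apply: leq_trans (max_card _) _.
  by rewrite card_ffun !card_ord.
have U_le : (#|U| <= k)%N by rewrite -[leqRHS]card_ord; exact: max_card.
have h := le_trans lower upper.
rewrite mulrA mulrC in h; rewrite ler_pM2l // in h.
move: h; rewrite -ler_pdivlMr ?exprn_gt0 // => /le_trans; apply.
rewrite /Lam -[leRHS]mulrA ler_wpM2l ?ler0n //.
have -> : ((q * P / 2) ^+ #|U|)^-1 = (2 / P) ^+ #|U| * N%:R ^+ #|U|.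
  rewrite -exprMn -exprVn; congr (_ ^+ _).
  by field; rewrite ?gt_eqF ?ltr0n.
rewrite ler_wpM2r ?exprn_ge0 ?ler0n // ler_weXn2l //.
by rewrite ler_pdivlMr // mul1r; apply: (le_trans P_le1); rewrite ler1n.
Qed.

Lemma Lam_ge1 : 1 <= Lam.
Proof.
rewrite -[leLHS]mulr1 ler_pM ?ler1n ?addn_gt0 ?orbT // exprn_ege1 //.
by rewrite ler_pdivlMr // mul1r; apply: (le_trans P_le1); rewrite ler1n.
Qed.

(** About [N ^ #|U|] embeddings are sensitive, out of [N ^ #|verts U|], and [verts U] exceeds [U] by
    at least the number of components. *)
Lemma gate_small u S H : List.In u (subs T) ->
  bdd S (sens (beval u) X H) (Lam * q ^+ cc H (free S)).
Proof.
move=> hu; set U := hull H (free S); set c := cc H (free S).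
have SU : S \subset ~: verts U.
  apply/subsetP=> v vS; rewrite !inE; apply/negP=> /exists_inP[i iU].
  have := subsetP (hull_subr H (free S)) _ iU; rewrite inE => /andP[h1 h2].
  by case/orP=> /eqP hv; [move: h1 | move: h2]; rewrite -hv vS.
have h1 : bdd (R := R) S (predT : pred (embedding k N)) 1.
  move=> b; rewrite mul1r ler_nat -(card_agree S b); apply/subset_leq_card/subsetP=> a.
  by rewrite !inE => /andP[].
have L0 : 0 <= Lam by exact: le_trans Lam_ge1.
have q0 n : 0 <= q ^+ n by exact/exprn_ge0/ltW.
have h2 : bdd (S :|: ~: verts U) (sens (beval u) X H) (Lam * q ^+ c).
  rewrite (setUidPr SU) => b; apply: le_trans (count_sens H S b hu) _.
  rewrite -/U -mulrA ler_wpM2l //.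
  have -> : (k.+1 - #|~: verts U| = #|verts U|)%N.
    apply: (@addIn #|~: verts U|); rewrite subnK; last by rewrite -[leqRHS]card_ord max_card.
    by rewrite cardsC card_ord.
  have hcard := card_verts_hull H (free S).
  rewrite -/U -/c in hcard.
  rewrite natrX; apply: (@le_trans _ _ (q ^+ c * N%:R ^+ (#|U| + c))).
    rewrite exprD mulrCA -exprMn mulVf ?expr1n ?mulr1 // pnatr_eq0; by rewrite -lt0n.
  by rewrite ler_wpM2l // ler_weXn2l // ler1n.
have := bdd_join N0 (mulr_ge0 L0 (q0 _)) (fun a b _ _ => isT) h1 h2.
by apply: bdd_sub; [move=> a ha | rewrite mul1r].
Qed.

End AtX.
End Smallness.

Lemma okt_impl (E : finType) (Q Q' : (cube E -> bool) -> Prop) (T : bt E) :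
  (forall u, List.In u (subs T) -> Q' (beval u)) -> okt Q T -> okt Q' T.
Proof.
elim: T => [g|op l IHl r IHr] h ok.
  by case: ok => _ ok; split=> //; apply: (h (BLeaf g)); left.
case: ok => _ [okl okr]; split; first by apply: (h (BNode op l r)); left.
split; [apply: IHl | apply: IHr] => // u hu; apply: h; right; apply/List.in_or_app;
 by [left | right].
Qed.

(** * Connectivity depends on the whole planted path *)

Section Hard.
Variables (k N : nat) (o0 : 'I_N).
Notation V := (edges k N).
Implicit Types (X : cube V) (a b : embedding k N) (Z : {set 'I_k}).

Definition linked X : bool :=
  [exists a : embedding k N, [&& a ord0 == o0, a ord_max == o0 & [forall i, X (edge a i)]]].
Definition base : embedding k N := [ffun => o0].
Definition ends : {set 'I_k.+1} := [set ord0; ord_max].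
Definition clean X a : bool := [forall Z : {set 'I_k}, (Z != setT) ==> ~~ linked (plant X a Z)].

Lemma agree_ends a : agree ends a base = (a ord0 == o0) && (a ord_max == o0).
Proof.
apply/agreeP/andP => [h|[/eqP h1 /eqP h2] v].
  by rewrite !h ?ffunE ?eqxx ?inE ?eqxx ?orbT.
by rewrite !inE => /orP[] /eqP ->; rewrite ffunE.
Qed.

Lemma clean_sens f X a : (forall x, f x = linked x) -> agree ends a base -> clean X a ->
  sens f X setT a.
Proof.
rewrite agree_ends => hf /andP[h1 h2] /forallP hc; apply/forall_inP=> i _.
apply/existsP; exists setT; rewrite subsetT /= !hf.
have -> : linked (plant X a (i |: setT)).
  apply/existsP; exists a; rewrite h1 h2 /=; apply/forallP=> j; rewrite ffunE.
  by apply/orP; right; apply/exists_inP; exists j; rewrite ?inE ?orbT.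
have := hc (setT :\ i); rewrite implybE => /orP[|/negbTE -> //].
by rewrite negbK => /eqP/setP/(_ i); rewrite !inE eqxx.
Qed.

Definition diff a b : {set 'I_k} := [set i | edge b i != edge a i].
Definition vdiff a b : {set 'I_k.+1} := [set v | b v != a v].

(** A connecting path is either [a] itself, one of whose unplanted edges then lies in [X], or a
    different path, all of whose edges off [a] lie in [X]. *)
Lemma unclean X a : ~~ clean X a ->
  (exists i, X (edge a i)) \/
  exists2 b, (b != a) && agree ends b base & [forall e in [set edge b i | i in diff a b], X e].
Proof.
case/forallPn=> Z; rewrite negb_imply negbK => /andP[ZT /existsP[b /and3P[b0 bk /forallP hb]]].
have [ba|nba] := eqVneq b a.
  have [i iZ] : exists i, i \notin Z.
    by apply/existsP; apply: contraNT ZT => /existsPn h; apply/eqP/setP=> i; rewrite inE; apply/negbNE/h.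
  left; exists i; have := hb i; rewrite ba ffunE => /orP[//|/exists_inP[j jZ /eqP/edge_inj ij]].
  by rewrite ij jZ in iZ.
right; exists b; first by rewrite nba agree_ends b0 bk.
apply/forall_inP=> e /imsetP[i]; rewrite inE => id ->; have := hb i; rewrite ffunE.
case/orP=> // /exists_inP[j jZ /eqP ej]; case/negP: id; apply/eqP.
by rewrite ej (congr1 (fun e : V => e.1.1) ej : i = j).
Qed.

(** Every changed vertex changes the edge entering it, and the last changed vertex also the edge
    leaving it; the end vertices never change. *)
Lemma card_diff a b : agree ends b base -> agree ends a base -> b != a ->
  (#|vdiff a b| < #|diff a b|)%N.
Proof.
rewrite !agree_ends => /andP[/eqP b0 /eqP bk] /andP[/eqP a0 /eqP ak] nba.
have [v0 v0D] : exists v, v \in vdiff a b.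
  apply/existsP; apply: contraNT nba => /existsPn h; apply/eqP/ffunP=> v.
  by have := h v; rewrite inE negbK => /eqP.
have nz v : v \in vdiff a b -> v != ord0.
  by rewrite inE; apply: contraNneq => ->; rewrite b0 a0.
have nm v : v \in vdiff a b -> v != ord_max.
  by rewrite inE; apply: contraNneq => ->; rewrite bk ak.
have [m mD mmax] := @arg_maxnP _ v0 (fun v => v \in vdiff a b) (fun v : 'I_k.+1 => v : nat) v0D.
have mk : (m < k)%N.
  have := nm m mD; rewrite -val_eqE /= => h; have := ltn_ord m; rewrite ltnS leq_eqVlt.
  by rewrite (negbTE h).
pose i0 := Ordinal mk.
have vi (i : 'I_k) : hi i \in vdiff a b -> i \in diff a b.
  by rewrite !inE; apply: contraNneq => -[_ ->].
have li (i : 'I_k) : lo i \in vdiff a b -> i \in diff a b.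
  by rewrite !inE; apply: contraNneq => -[-> _].
have lo0 : lo i0 = m by apply: val_inj.
have sub : [set i | hi i \in vdiff a b] \subset diff a b :\ i0.
  apply/subsetP=> i; rewrite inE => hiD; rewrite in_setD1 vi // andbT.
  apply/eqP=> ii; have := mmax _ hiD; rewrite ii /= /bump /=; lia.
have i0D : i0 \in diff a b by apply: li; rewrite lo0.
rewrite (cardsD1 i0 (diff a b)) i0D add1n ltnS; apply: leq_trans (subset_leq_card sub).
apply: leq_trans (leq_imset_card (@hi k) _).
apply/subset_leq_card/subsetP=> v vD; apply/imsetP.
have /unlift_some[j ej _] : ord0 != v by rewrite eq_sym nz.
by exists j; rewrite // inE /hi -ej.
Qed.

Section Prob.
Variables (R : realFieldType) (d : nat) (p : R).
Hypotheses (p0 : 0 < p) (p1 : p < 1).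
Notation P := (p ^+ d).
Notation q := (N%:R^-1 : R).
Notation Pr := (mu (@wweight R V q P)).

Let N0 : (0 < N)%N. Proof. exact: leq_ltn_trans (ltn_ord o0). Qed.
Let q_gt0 : 0 < q. Proof. by rewrite invr_gt0 ltr0n. Qed.
Let q_le1 : q <= 1. Proof. by rewrite invf_le1 ?ltr0n // ler1n. Qed.
Let P_gt0 : 0 < P. Proof. exact: exprn_gt0. Qed.
Let P_le1 : P <= 1. Proof. by rewrite exprn_ile1 // ltW. Qed.
Let W0 (w : world V) : 0 <= wweight q P w. Proof. exact: wweight_ge0. Qed.

(** First moment: at most [N ^ #|D|] paths differ from [a] exactly on [D], and each needs at least
    [#|D| + 1] edges of probability 1/(2N). Every [D] thus contributes at most 1/(2N), and so does
    every edge of [a]. *)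
Lemma Pr_unclean a : agree ends a base ->
  Pr (fun w => ~~ clean (wval w) a) <= (2 ^ k.+1)%:R * q.
Proof.
move=> ha; have h2 : 0 <= q / 2 by rewrite divr_ge0 // ltW.
have hq2 : q / 2 <= 1 by rewrite ler_pdivrMr // mul1r (le_trans q_le1) // ler1n.
pose Q (c : 'I_k + embedding k N) (w : world V) := match c with
  | inl i => [forall e in [set edge a i], wval w e]
  | inr b => [forall e in [set edge b i | i in diff a b], wval w e] end.
pose J (c : 'I_k + embedding k N) := match c with
  | inl i => true | inr b => (b != a) && agree ends b base end.
apply: le_trans (mu_union W0 (J := J) (Q := Q) _) _.
  move=> w /unclean[[i Xi]|[b hb1 hb2]]; last by exists (inr b).
  by exists (inl i) => //; apply/forall_inP=> e; rewrite inE => /eqP ->.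
rewrite big_sumType /=.
have -> : (2 ^ k.+1)%:R * q = (2 ^ k.+1)%:R * (q / 2) + (2 ^ k.+1)%:R * (q / 2) by field; rewrite gt_eqF ?ltr0n.
apply: lerD.
  apply: (@le_trans _ _ (\sum_(i < k) q / 2)).
    by apply: ler_sum => i _; rewrite /Q mu_wval // cards1 expr1.
  rewrite sumr_const card_ord -[leLHS]mulr_natl ler_wpM2r // ler_nat.
  by apply: ltnW; apply: leq_trans (ltn_expl k (isT : (1 < 2)%N)) _; rewrite leq_exp2l.
apply: (@le_trans _ _ (\sum_(b | (b != a) && agree ends b base) (q / 2) ^+ (#|vdiff a b|.+1))).
  apply: ler_sum => b /andP[nba hb]; rewrite /Q mu_wval // card_imset; last exact: edge_inj.
  by apply: ler_wiXn2l => //; exact: card_diff.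
rewrite (partition_big (vdiff a) predT) //=.
have -> : (2 ^ k.+1)%:R * (q / 2) = \sum_(D : {set 'I_k.+1}) q / 2.
  by rewrite sumr_const -[RHS]mulr_natl -cardsT -powersetT card_powerset cardsT card_ord.
apply: ler_sum => D _; apply: (@le_trans _ _ (\sum_(b in [set b | agree (~: D) b a]) (q / 2) ^+ #|D|.+1)).
  rewrite [leLHS]big_mkcond [leRHS]big_mkcond; apply: ler_sum => b _.
  case: ifP => [/andP[_ /eqP hD]|_]; last by case: ifP => // _; exact: exprn_ge0.
  rewrite inE hD; case: ifP => // /negP[]; apply/agreeP=> v; rewrite -hD !inE negbK.
  by move/eqP.
rewrite sumr_const card_agree -[leLHS]mulr_natl.
have -> : (k.+1 - #|~: D| = #|D|)%N.
  apply: (@addIn #|~: D|); rewrite subnK; last by rewrite -[leqRHS]card_ord max_card.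
  by rewrite cardsC card_ord.
rewrite exprS mulrCA natrX -exprMn -[leRHS]mulr1 ler_wpM2l // exprn_ile1 //.
  by rewrite mulr_ge0.
by rewrite mulrA divff ?pnatr_eq0 -?lt0n // ler_pdivrMr // mul1r ler1n.
Qed.

(** Markov's inequality twice: more than half of the embeddings are unclean with probability at most
    1/2, and too large a share of [B] given the value has probability less than 1/2. *)
Lemma good_world (B : pred (world V)) : (2 ^ k.+3 <= N)%N ->
  (N ^ k.+1)%:R * Pr B < 2^-1 ->
  exists X, [/\ 0 < Pr (fun w => wval w == X),
    Pr (fun w => (wval w == X) && B w) * (N ^ k.+1)%:R <= Pr (fun w => wval w == X) &
    (N ^ (k.+1 - #|ends|))%:R <= 2 * #|[set a | agree ends a base & clean X a]|%:R :> R].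
Proof.
move=> hN hB; set Nc := (N ^ (k.+1 - #|ends|))%N.
pose uncl (X : cube V) := [set a | agree ends a base & ~~ clean X a].
pose t1 (w : world V) := (Nc < 2 * #|uncl (wval w)|)%N.
pose t2 (X : cube V) := Pr (fun w => wval w == X) < Pr (fun w => (wval w == X) && B w) * (N ^ k.+1)%:R.
have Nc0 : 0 < Nc%:R :> R by rewrite ltr0n expn_gt0 N0.
have h1 : Pr t1 <= 2^-1.
  have e1 : Nc%:R * Pr t1 <= 2 * \sum_(a in [set a | agree ends a base]) Pr (fun w => ~~ clean (wval w) a).
    have -> : \sum_(a in [set a | agree ends a base]) Pr (fun w => ~~ clean (wval w) a) =
       \sum_w wweight q P w * #|uncl (wval w)|%:R.
      rewrite /mu; under eq_bigr => a _ do rewrite big_mkcond.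
      rewrite exchange_big; apply: eq_bigr => w _ /=.
      rewrite -big_mkcondr /= sumr_const mulr_natr; congr (_ *+ _).
      by apply: eq_card => a; rewrite !inE unfold_in /= !inE.
    rewrite /mu !mulr_sumr big_mkcond; apply: ler_sum => w _.
    case: ifP => [hw|_]; last by rewrite !mulr_ge0.
    rewrite mulrCA mulrC ler_wpM2l // -natrM ler_nat; exact: ltnW.
  have e2 : Nc%:R * Pr t1 <= Nc%:R * 2^-1.
    apply: le_trans e1 _; apply: (@le_trans _ _ (2 * \sum_(a in [set a | agree ends a base]) (2 ^ k.+1)%:R * q)).
      by rewrite ler_wpM2l //; apply: ler_sum => a; rewrite inE => ha; exact: Pr_unclean.
    rewrite sumr_const card_agree -/Nc -[X in 2 * X]mulr_natl mulrCA ler_wpM2l //.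
    rewrite mulrA -natrM -expnS ler_pdivrMr ?ltr0n // mulrC ler_pdivlMr // -natrM ler_nat.
    by rewrite mulnC -expnS.
  by rewrite ler_pM2l in e2.
have h2 : Pr (fun w => t2 (wval w)) < 2^-1.
  apply: le_lt_trans hB; rewrite /mu (partition_big (@wval V) t2) //=.
  apply: (@le_trans _ _ (\sum_(X | t2 X) Pr (fun w => (wval w == X) && B w) * (N ^ k.+1)%:R)).
    apply: ler_sum => X hX; apply: le_trans (ltW hX); apply: mu_sub => // w.
    by case/andP.
  rewrite -mulr_suml mulrC ler_wpM2l ?ler0n //.
  rewrite [leRHS](partition_big (@wval V) predT) //= [leLHS]big_mkcond; apply: ler_sum => X _.
  case: ifP => _; last by apply: sumr_ge0.
  by rewrite le_eqVlt; apply/orP; left; apply/eqP; apply: eq_bigl => w; rewrite andbC.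
have [w /andP[n1 n2] w0] : exists2 w, ~~ t1 w && ~~ t2 (wval w) & 0 < wweight q P w.
  apply: contrapT => hno; have : Pr predT <= Pr t1 + Pr (fun w => t2 (wval w)).
    rewrite (muID _ _ t1) lerD //.
    rewrite (muID _ _ (fun w => t2 (wval w))) -[leRHS]addr0 lerD //.
      by apply: mu_sub => // w /andP[].
    rewrite /mu; apply: sumr_le0 => w /andP[/andP[_ n1] n2].
    by rewrite leNgt; apply/negP=> w0; apply: hno; exists w; rewrite ?n1 ?n2.
  rewrite {1}/mu wweight_sum; apply/negP; rewrite -ltNge.
  rewrite [ltRHS](_ : 1 = 2^-1 + 2^-1); last by field.
  exact: ler_ltD h1 h2.
exists (wval w); split.
- rewrite /mu (bigD1 w) //=; apply: ltr_pwDl => //; exact: sumr_ge0.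
- by rewrite leNgt.
rewrite -natrM ler_nat.
have : (#|uncl (wval w)| + #|[set a | agree ends a base & clean (wval w) a]| = Nc)%N.
  rewrite /Nc -(card_agree ends base) -(cardsID [set a | clean (wval w) a] [set a | agree ends a base]) [RHS]addnC.
  by congr addn; apply: eq_card => a; rewrite !inE // andbC.
move: n1; rewrite /t1 -leqNgt; clearbody Nc.
by move: (#|uncl (wval w)|) (#|[set a | _ & clean _ a]|) => x y; clear; lia.
Qed.

End Prob.
End Hard.

(** * From formulas to binary trees *)

Section Finite.
Variable R : realFieldType.

Theorem finite_bound k N s d t r D (p g eps : R) (o0 : 'I_N) (T : bt (edges k N)) :
  0 < p < 1 -> 0 < g <= 1 -> (1 + 2 * (2 * p / (1 - p)) / g) ^+ t <= 2 -> (0 < t)%N ->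
  0 < eps <= 1 -> eps ^+ 16 = N%:R^-1 -> okt (AC d s) T -> (bdepth T < D)%N ->
  (forall x, beval T x = linked o0 x) -> (2 ^ k.+3 <= N)%N -> (2 ^ (r + 4) <= k - 2)%N ->
  (N ^ k.+1)%:R * ((N ^ k.+1 * 2 ^ k * (2 * bsize T))%:R * ((s * d)%:R * g ^+ t)) < 2^-1 ->
  1 <= 2 * blowup k (Lam k d t p) D ^+ k.+1 * (bsize T)%:R * eps ^+ r.
Proof.
move=> /andP[p0 p1] hg hw t0 /andP[eps0 eps1] heps ok hD hT hN hr hB.
have N0 : (0 < N)%N by exact: leq_ltn_trans (ltn_ord o0).
have g0 : 0 <= g by case/andP: hg => /ltW.
have hPB : (N ^ k.+1)%:R * mu (wweight N%:R^-1 (p ^+ d)) (bad t T) < 2^-1.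
  apply: le_lt_trans hB; rewrite ler_wpM2l ?ler0n //.
  apply: le_trans (Pr_bad N0 p0 p1 t0 hg hw ok) _.
  by rewrite ler_wpM2r ?mulr_ge0 ?exprn_ge0 // ler_nat leq_mul2l size_subs orbT.
have [X [mass0 few half]] := good_world o0 p0 p1 hN hPB.
have Lam1 := Lam_ge1 k d t p0 p1.
have oksm : okt (small X eps (Lam k d t p)) T.
  apply: okt_impl ok => u hu S H; rewrite exprM heps.
  exact: (gate_small N0 p0 p1 mass0 few).
have hgood : good setT (free (ends k)) r.
  (* The first and last edge are dropped because their outer endpoints are fixed; the [4] in [r + 4]
     covers two stuck ends. *)
  right; exists 1%N, k.-1, r; split.
  - exact: leq_pred.
  - apply/subsetP=> x; rewrite !inE -!val_eqE /= /bump /= add1n; nat_lia.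
  - apply: (@leq_trans (2 ^ (r + 4))); last by apply: leq_trans hr _; clear; lia.
    by rewrite leq_exp2l // leq_add2l (leq_mul2l 2 _ 2) st_le2.
  - exact: leq_addr.
have := recursion N0 eps0 eps1 Lam1 (leq_ltn_trans (leq0n _) hD) (n := k) (H := setT) _ oksm hD hgood.
move=> /(_ _ (base k o0)); rewrite cardsT card_ord leqnn => /(_ isT) hbd.
have hle : #|[set a | agree (ends k) a (base k o0) & clean o0 X a]|%:R <=
    blowup k (Lam k d t p) D ^+ k.+1 * (bsize T)%:R * eps ^+ r * (N ^ (k.+1 - #|ends k|))%:R :> R.
  apply: le_trans hbd; rewrite ler_nat; apply/subset_leq_card/subsetP=> a.
  by rewrite !inE => /andP[h1 h2]; rewrite h1 (clean_sens hT h1 h2).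
have Nc0 : 0 < (N ^ (k.+1 - #|ends k|))%:R :> R by rewrite ltr0n expn_gt0 N0.
rewrite -(ler_pM2r Nc0) mul1r; apply: le_trans half _.
by rewrite -!mulrA ler_wpM2l // !mulrA.
Qed.

End Finite.

(** * Unbounded fan-in replaced by balanced binary trees *)

Section FormulaTree.
Variables (V : Type) (E : finType) (sigma : cube E -> V -> bool).
Hypothesis sigma1 : forall v, dtle 1 (fun x => sigma x v).
Implicit Types (F : formula V).

Lemma AC_neg d s (f : cube E -> bool) : AC d s f -> AC d s (fun x => ~~ f x).
Proof.
case: d => [|d] [[s0 h]|] //; try by left; split=> //; exact: dtle_neg.
case=> b [l [s0 ls lA fE]]; right; exists (~~ b), l; split=> // x.
by rewrite fE; case: b {fE} => /=; case: has.
Qed.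

Lemma AC_leq d d' s s' (f : cube E -> bool) : (d <= d')%N -> (s <= s')%N -> AC d s f -> AC d' s' f.
Proof.
elim: d d' s s' f => [|d IH] d' s s' f dd ss.
  by case=> [[s0 h]|] //; case: d' dd => [|d'] _; left; split=> //; exact: leq_trans ss.
case: d' dd => // d' dd [[s0 h]|]; first by left; split=> //; exact: leq_trans ss.
case=> b [l [s0 ls lA fE]]; right; exists b, l; split=> //.
- exact: leq_trans ss.
- exact: leq_trans ss.
- by move=> q /lA; exact: IH.
Qed.

Lemma okt_AC_leq d d' s s' T : (d <= d')%N -> (s <= s')%N -> okt (@AC E d s) T -> okt (@AC E d' s') T.
Proof.
move=> dd ss ok; apply: (okt_impl _ ok) => u hu; have [oku _] := okt_subs ok hu.
exact: AC_leq (okt_eval oku).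
Qed.

(* The disjunction of the [u]s for [b = false], their conjunction for [b = true]. *)
Lemma balanced (b : bool) h d s D (l : seq (bt E)) : l <> [::] -> (size l <= 2 ^ h)%N ->
  (forall u, List.In u l ->
     [/\ okt (@AC E d.+1 s) u, AC d (bsize u) (beval u) & (bdepth u <= D)%N]) ->
  (\sum_(u <- l) bsize u <= s)%N ->
  exists T, [/\ forall x, beval T x = b (+) has (fun u => b (+) beval u x) l,
     bsize T = (\sum_(u <- l) bsize u)%N, (bdepth T <= D + h)%N & okt (@AC E d.+1 s) T].
Proof.
elim: h l => [|h IH] l l0 hs hl hsum.
  case: l l0 hs hl hsum => // u [|//] _ _ hl _; have [h1 h2 h3] := hl u (or_introl erefl).
  exists u; split=> //; last by rewrite addn0.
    by move=> x; rewrite /= orbF addKb.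
  by rewrite big_seq1.
have [hle|hgt] := leqP (size l) (2 ^ h).
  have [T [h1 h2 h3 h4]] := IH l l0 hle hl hsum; exists T; split=> //.
  by rewrite addnS; exact: leqW.
pose l1 := take (2 ^ h) l; pose l2 := drop (2 ^ h) l.
have el : l = l1 ++ l2 by rewrite cat_take_drop.
have sz1 : size l1 = (2 ^ h)%N by rewrite size_takel // ltnW.
have in1 u : List.In u l1 -> List.In u l by rewrite el => hu; apply/List.in_or_app; left.
have in2 u : List.In u l2 -> List.In u l by rewrite el => hu; apply/List.in_or_app; right.
have sum12 : (\sum_(u <- l) bsize u = \sum_(u <- l1) bsize u + \sum_(u <- l2) bsize u)%N.
  by rewrite {1}el big_cat.
have [|||T1 [a1 a2 a3 a4]] := IH l1 _ _ (fun u hu => hl u (in1 u hu)).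
- by move=> e; move: sz1; rewrite e /= => /eqP; rewrite eq_sym expn_eq0.
- by rewrite sz1.
- by apply: leq_trans hsum; rewrite sum12 leq_addr.
have [|||T2 [b1 b2 b3 b4]] := IH l2 _ _ (fun u hu => hl u (in2 u hu)).
- by move=> e; move: hgt; rewrite -subn_gt0 -size_drop -/l2 e.
- by rewrite size_drop leq_subLR addnn -mul2n -expnS.
- by apply: leq_trans hsum; rewrite sum12 leq_addl.
pose op x y := b (+) ((b (+) x) || (b (+) y)).
have ev x : beval (BNode op T1 T2) x = b (+) has (fun u => b (+) beval u x) l.
  by rewrite /= a1 b1 /op !addKb -has_cat -el.
exists (BNode op T1 T2); split=> //.
- by rewrite /= a2 b2 sum12.
- by rewrite /= addnS ltnS geq_max a3.
(* A partial gate is the same gate over fewer children, so the binary nodes do not increase the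
   depth in [AC]. *)
split=> //; right; exists b, [seq (bsize u, fun x => b (+) beval u x) | u <- l]; split.
- apply: leq_trans hsum; case: (l) l0 => // u l' _; rewrite big_cons addn_gt0.
  by rewrite bsize_gt0.
- by rewrite big_map.
- move=> q /List.in_map_iff[u [<- hu]] /=; have [_ h2 _] := hl u hu.
  by case: (b) => //=; exact: AC_neg.
- by move=> x; rewrite ev has_map.
Qed.

Lemma fsize_gt0 F : (0 < fsize F)%N.
Proof.
by elim: F => //= m fs IH; rewrite big_ord_recl addn_gt0 IH.
Qed.

(** Fan-in is at most size, so every gate becomes a binary tree of depth at most [w], whereas the
    depth that governs the switching lemma remains that of [F]. *)
Lemma formula_tree w F : (fsize F <= 2 ^ w)%N ->
  exists T, [/\ forall x, beval T x = feval (sigma x) F, bsize T = fsize F,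
     (bdepth T <= fdepth F * w)%N & okt (@AC E (fdepth F) (fsize F)) T].
Proof.
have gate b m (fs : 'I_m.+1 -> formula V) :
  (forall i, (fsize (fs i) <= 2 ^ w)%N -> exists T, [/\ forall x, beval T x = feval (sigma x) (fs i),
     bsize T = fsize (fs i), (bdepth T <= fdepth (fs i) * w)%N &
     okt (@AC E (fdepth (fs i)) (fsize (fs i))) T]) ->
  (\sum_i fsize (fs i) <= 2 ^ w)%N ->
  exists T, [/\ forall x, beval T x = b (+) [exists i, b (+) feval (sigma x) (fs i)],
     bsize T = (\sum_i fsize (fs i))%N, (bdepth T <= (\max_i fdepth (fs i)).+1 * w)%N &
     okt (@AC E (\max_i fdepth (fs i)).+1 (\sum_i fsize (fs i))) T].
  move=> IH hs; set d := \max_i _; set s := (\sum_i _)%N.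
  have les i : (fsize (fs i) <= s)%N by rewrite /s (bigD1 i) //= leq_addr.
  have led i : (fdepth (fs i) <= d)%N by rewrite /d (bigD1 i) //= leq_maxl.
  have [TT hTT] := fin_all_exists (fun i => IH i (leq_trans (les i) hs)).
  pose l := [seq TT i | i <- enum 'I_m.+1].
  have sl : (\sum_(u <- l) bsize u = s)%N.
    by rewrite big_map big_enum /=; apply: eq_bigr => i _; have [_ -> _ _] := hTT i.
  have [|||T [h1 h2 h3 h4]] := @balanced b w d s (d * w)%N l _ _ _ (eq_leq sl).
  - by move=> e; have := size_map TT (enum 'I_m.+1); rewrite -/l e size_enum_ord.
  - rewrite size_map size_enum_ord; apply: leq_trans hs.
    rewrite -[leqLHS]card_ord -sum1_card; apply: leq_sum => i _; exact: fsize_gt0.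
  - move=> u /List.in_map_iff[i [<- _]]; have [e1 e2 e3 e4] := hTT i; split.
    + by apply: okt_AC_leq e4 => //; exact: leqW.
    + by rewrite e2; apply: AC_leq (okt_eval e4).
    + by apply: leq_trans e3 _; rewrite leq_mul2r led orbT.
  exists T; split=> //.
  - move=> x; rewrite h1; congr (_ (+) _); rewrite has_map; apply/hasP/existsP.
      by case=> i _ /=; have [-> _ _ _] := hTT i; exists i.
    by case=> i hi; exists i; rewrite ?mem_enum //=; have [-> _ _ _] := hTT i.
  - by rewrite h2.
  - by rewrite mulSn addnC.
elim: F => [b|b v|m fs IH|m fs IH] hs.
- exists (BLeaf (fun _ => b)); split=> //.
  have h : dtle 1 (fun _ : cube E => b) by exact: dtle_const.
  by split=> //; left.
- exists (BLeaf (fun x => feval (sigma x) (Lit b v))); split=> //.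
  have h : dtle 1 (fun x => feval (sigma x) (Lit b v)).
    by case: b hs => _; [exact: sigma1 | exact/dtle_neg/sigma1].
  by split=> //; left.
- have [T [h1 h2 h3 h4]] := gate true m fs IH hs; exists T; split=> // x.
  rewrite h1 /=; rewrite -[RHS]negbK negb_forall; congr negb.
- have [T [h1 h2 h3 h4]] := gate false m fs IH hs; exists T; split=> // x.
Qed.

End FormulaTree.

(** * Layered graphs as instances of connectivity *)

Section Digraph.
Variables (k N n : nat) (o0 : 'I_N) (s t : 'I_n) (iota : 'I_k.+1 * 'I_N -> 'I_n).
Hypotheses (iota_inj : injective iota) (iota_s : iota (ord0, o0) = s)
  (iota_t : iota (ord_max, o0) = t).
Implicit Types (X : cube (edges k N)) (e : edges k N).

Definition esrc e : 'I_k.+1 * 'I_N := (lo e.1.1, e.1.2).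
Definition etgt e : 'I_k.+1 * 'I_N := (hi e.1.1, e.2).
Definition erel X : rel 'I_n := fun u v =>
  [exists e, [&& X e, u == iota (esrc e) & v == iota (etgt e)]].
Definition evar X (uv : 'I_n * 'I_n) : bool := erel X uv.1 uv.2.

(** An entry of the adjacency matrix is a single edge variable or constantly false. *)
Lemma evar_dtle uv : dtle 1 (fun X => evar X uv).
Proof.
have uniq e e' : esrc e = esrc e' -> etgt e = etgt e' -> e = e'.
  case: e => [[i x] y]; case: e' => [[i' x'] y'] [h1 ->] [_ ->].
  by congr (_, _, _); apply: val_inj.
have [[e /andP[/eqP eu /eqP ev]]|no] := pselect (exists e, (uv.1 == iota (esrc e)) && (uv.2 == iota (etgt e))).
  right; exists e => b; left=> x y; rewrite /evar /erel.
  have h (z : cube (edges k N)) : [exists e0, [&& z e0, uv.1 == iota (esrc e0) & uv.2 == iota (etgt e0)]] = z e.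
    apply/existsP/idP=> [[e' /and3P[ze' /eqP h1 /eqP h2]]|ze]; last by exists e; rewrite ze eu ev !eqxx.
    suff -> : e = e' by [].
    by apply: uniq; apply: iota_inj; rewrite -?eu -?ev.
  by rewrite (h (upd x e b)) (h (upd y e b)) [LHS]ffunE [RHS]ffunE eqxx.
apply: dtle_const => x y; rewrite /evar /erel.
have h (z : cube (edges k N)) : [exists e0, [&& z e0, uv.1 == iota (esrc e0) & uv.2 == iota (etgt e0)]] = false.
  by apply/existsP=> -[e /and3P[_ h1 h2]]; apply: no; exists e; rewrite h1 h2.
by rewrite !h.
Qed.

(** Every edge raises the layer by one, so the walk meets each later layer exactly once and defines
    an embedding from layer [v] on. *)
Lemma path_linked X p (v : 'I_k.+1) (x : 'I_N) : path (erel X) (iota (v, x)) p ->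
  last (iota (v, x)) p = t -> exists a : embedding k N,
    [/\ a v = x, a ord_max = o0 & forall i : 'I_k, (v <= i)%N -> X (edge a i)].
Proof.
elim: p v x => [|y p IH] v x /=.
  move=> _; rewrite -iota_t => /iota_inj[-> ->]; exists [ffun => o0]; split; rewrite ?ffunE // => i.
  by rewrite leqNgt ltn_ord.
case/andP=> /existsP[[[i x'] y']] /and3P[Xe /eqP/iota_inj[ev ex] /eqP ->] hp hl.
have [a [a1 a2 a3]] := IH (hi i) y' hp hl.
have hiv : hi i = v.+1 :> nat by rewrite ev /= /bump /= add1n.
exists [ffun w => if w == v then x else a w]; split.
- by rewrite ffunE eqxx.
- rewrite ffunE; case: eqP => // emax; move: (ltn_ord (hi i)); rewrite hiv -emax /= ltnn //.
move=> j; rewrite leq_eqVlt => /orP[/eqP vj|vj].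
  have -> : j = i by apply: val_inj; rewrite -[val j]/(nat_of_ord j) -vj ev.
  rewrite /edge !ffunE -ev eqxx.
  have -> : (hi i == v) = false by apply/eqP=> h; move: hiv; rewrite h; exact: n_Sn.
  by rewrite a1 ex.
have := a3 j; rewrite hiv => /(_ vj); rewrite /edge !ffunE.
have -> : (lo j == v) = false by apply/eqP=> h; move: vj; rewrite -h /= ltnn.
have -> // : (hi j == v) = false.
by apply/eqP=> h; move: vj; rewrite -h /= /bump /= add1n ltnNge leqW // leqnSn.
Qed.

Lemma linked_path X (a : embedding k N) m (v : 'I_k.+1) : (forall i, X (edge a i)) ->
  (v + m = k)%N -> exists p, [/\ path (erel X) (iota (v, a v)) p,
     last (iota (v, a v)) p = iota (ord_max, a ord_max) & size p = m].
Proof.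
move=> ha; elim: m v => [|m IH] v hv.
  exists [::]; split=> //=; suff -> : v = ord_max by [].
  by apply: val_inj => /=; rewrite addn0 in hv.
have vk : (v < k)%N by move: (nat_of_ord v) hv => x <-; rewrite addnS ltnS leq_addr.
pose i := Ordinal vk.
have lov : lo i = v by apply: val_inj.
have [|p [h1 h2 h3]] := IH (hi i); first by rewrite /= /bump /= add1n addSnnS.
exists (iota (hi i, a (hi i)) :: p); split=> //=; last by rewrite h3.
rewrite h1 andbT; apply/existsP; exists (edge a i); rewrite ha /=.
by rewrite /esrc /etgt /edge /= lov !eqxx.
Qed.

Lemma stconn_linked X : stconn k s t (erel X) <-> linked o0 X.
Proof.
split=> [[p [hp hl _]]|/existsP[a /and3P[/eqP a0 /eqP ak /forallP ha]]].
  rewrite -iota_s in hp hl; have [a [a1 a2 a3]] := path_linked hp hl.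
  apply/existsP; exists a; rewrite a1 a2 !eqxx /=; apply/forallP=> i; exact: a3.
have [p [h1 h2 h3]] := linked_path ha (add0n k : (@ord0 k + k)%N = k).
rewrite a0 ak iota_s iota_t in h1 h2; exists p; split=> //; by rewrite h3.
Qed.

End Digraph.

Lemma embed_vertices k N n (o0 : 'I_N) (s t : 'I_n) : (0 < k)%N -> (k.+1 * N <= n)%N -> s != t ->
  exists iota : 'I_k.+1 * 'I_N -> 'I_n,
    [/\ injective iota, iota (ord0, o0) = s & iota (ord_max, o0) = t].
Proof.
move=> k0 hn st.
have lt (vx : 'I_k.+1 * 'I_N) : (vx.1 * N + vx.2 < n)%N.
  apply: leq_trans hn; apply: (@leq_trans (vx.1 * N + N)).
    by rewrite -addnS leq_add2l ltn_ord.
  by rewrite addnC -mulSn leq_mul2r ltn_ord orbT.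
pose io (vx : 'I_k.+1 * 'I_N) : 'I_n := Ordinal (lt vx).
have io_inj : injective io.
  move=> [v x] [v' x'] /(congr1 val) /= h.
  have N0 : (0 < N)%N by exact: leq_ltn_trans (ltn_ord x).
  have ev : v = v'.
    apply: val_inj; have := congr1 (fun m => m %/ N)%N h.
    by rewrite /= !divnMDl // !divn_small ?addn0.
  by move: h; rewrite ev => /addnI h; congr pair; apply: val_inj.
set a := io (ord0, o0); set b := io (ord_max, o0).
have ab : a != b by apply/eqP=> /io_inj[] hk; rewrite -hk in k0.
(* One transposition brings [a] to [s]; a second one brings the image [c] of [b] to [t] without
   moving [s]. *)
pose c := tperm a s b.
have cs : c != s by rewrite -(tpermL a s) (inj_eq perm_inj) eq_sym.
exists (fun vx => tperm c t (tperm a s (io vx))); split.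
- by move=> x y /perm_inj/perm_inj/io_inj.
- by rewrite -/a tpermL tpermD // eq_sym.
- by rewrite -/b -/c tpermL.
Qed.

Theorem formula_bound (R : realFieldType) k N n w u r (p g eps : R) (s t : 'I_n)
    (F : formula ('I_n * 'I_n)) :
  s != t -> solves_stconn k s t F -> (k.+1 * N <= n)%N -> (fsize F <= 2 ^ w)%N ->
  0 < p < 1 -> 0 < g <= 1 -> (1 + 2 * (2 * p / (1 - p)) / g) ^+ u <= 2 -> (0 < u)%N ->
  0 < eps <= 1 -> eps ^+ 16 = N%:R^-1 -> (2 ^ k.+3 <= N)%N -> (2 ^ (r + 4) <= k - 2)%N ->
  (N ^ k.+1)%:R * ((N ^ k.+1 * 2 ^ k * (2 * fsize F))%:R * ((fsize F * fdepth F)%:R * g ^+ u)) < 2^-1 ->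
  1 <= 2 * blowup k (Lam k (fdepth F) u p) (fdepth F * w).+1 ^+ k.+1 * (fsize F)%:R * eps ^+ r.
Proof.
move=> st hF hn hs hp hg hw u0 heps he hN hr hB.
have N0 : (0 < N)%N by apply: leq_trans hN; rewrite expn_gt0.
have k0 : (0 < k)%N by case: k {hF hn hN hB} hr => //; rewrite leqNgt expn_gt0.
pose o0 : 'I_N := Ordinal N0.
have [iota [ii is_ it]] := embed_vertices o0 k0 hn st.
have [T [h1 h2 h3 h4]] := formula_tree (@evar_dtle k N n iota ii) hs.
have hT x : beval T x = linked o0 x.
  rewrite h1; apply/idP/idP; have [ha hb] := stconn_linked ii is_ it x; have [hc hd] := hF (erel iota x).
    by move=> h; apply: ha; apply: hc.
  by move=> h; apply: hd; apply: hb.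
have := finite_bound (T := T) hp hg hw u0 heps he h4 _ hT hN hr.
by rewrite h2; apply; rewrite ?ltnS.
Qed.

(** * Choice of parameters *)

(** A form of Bernoulli's inequality, [(1 + x) ^+ j * (1 - j x) <= 1], whose second factor is at
    least 1/2 at [j = u]. *)
Lemma pow_half_double (R : realFieldType) (x : R) u : 0 <= x -> 2 * u%:R * x <= 1 -> (1 + x) ^+ u <= 2.
Proof.
move=> x0 hx.
have key j : (j <= u)%N -> (1 + x) ^+ j * (1 - j%:R * x) <= 1.
  elim: j => [|j IH] hj; first by rewrite expr0 mul0r subr0 mulr1.
  apply: le_trans (IH (ltnW hj)); rewrite exprSr -mulrA ler_wpM2l ?exprn_ge0 ?addr_ge0 //.
  rewrite -natr1; have : 0 <= (j%:R + 1) * (x * x) :> R by rewrite mulr_ge0 ?mulr_ge0 // addr_ge0.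
  nra.
have := key u (leqnn u); have : 0 <= (1 + x) ^+ u by rewrite exprn_ge0 // addr_ge0.
nra.
Qed.

(** All parameters are powers of two: N = 2^(16m), eps = 2^(-m), g = 2^(-a) and p = 2^(-(a+e+4)).
    The requirements thereby become inequalities between exponents; the [4] in p absorbs the
    constants of the switching lemma. *)
Lemma formula_size_exponents k n m w u a e q r (s t : 'I_n) (F : formula ('I_n * 'I_n)) :
  s != t -> solves_stconn k s t F -> (k.+1 * 2 ^ (16 * m) <= n)%N -> (fsize F <= 2 ^ w)%N ->
  (0 < u <= 2 ^ e)%N -> (32 * m * k.+1 + k + 2 * w + fdepth F + 3 <= a * u)%N ->
  (k + 3 <= 16 * m)%N -> (2 ^ (r + 4) <= k - 2)%N -> ((fdepth F * w).+1 <= 2 ^ q)%N ->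
  ((2 * q + 3 * k + 2 * ((k + u) * k + 1 + (1 + (a + e + 4) * fdepth F) * k)) * k.+1 + 1 <= m)%N ->
  (2 ^ (m * r) <= 2 ^ m * fsize F)%N.
Proof.
move=> st hF hn hw /andP[u0 hu] ha hk hr hD hm.
have [R _] : exists R : realFieldType, True by exists rat.
pose h : R := 2^-1; have h0 : 0 < h by rewrite invr_gt0.
have hE j : h ^+ j = (2 ^ j)%:R^-1 by rewrite /h exprVn natrX.
have h1 : h <= 1 by rewrite invf_le1 // ler1n.
have hle j : h ^+ j <= 1 by rewrite exprn_ile1 // ltW.
have hgt j : 0 < h ^+ j by rewrite exprn_gt0.
have p2 : h ^+ (a + e + 4) <= 2^-1.
  by rewrite addn4 exprSr ler_piMl // ltW.
have pow2_gt0 j : 0 < (2 ^ j)%:R :> R by rewrite ltr0n expn_gt0.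
have rate : (1 + 2 * (2 * h ^+ (a + e + 4) / (1 - h ^+ (a + e + 4))) / h ^+ a) ^+ u <= 2.
  set p := h ^+ (a + e + 4) in p2 *; have p0 : 0 < p by exact: hgt.
  have p1 : 0 < 1 - p by move: p2; lra.
  apply: pow_half_double.
    by rewrite divr_ge0 ?(ltW (hgt a)) // mulr_ge0 // divr_ge0 ?mulr_ge0 // ltW.
  have hu' : u%:R <= (2 ^ e)%:R :> R by rewrite ler_nat.
  have -> : 2 * u%:R * (2 * (2 * p / (1 - p)) / h ^+ a) = u%:R * (p / h ^+ a * 8) / (1 - p).
    by field; rewrite (gt_eqF (hgt a)) (gt_eqF p1).
  rewrite ler_pdivrMr // mul1r.
  have -> : p / h ^+ a = h ^+ e * h ^+ 4.
    by rewrite /p -addnA exprD exprD mulrC mulKf // gt_eqF.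
  have hh : u%:R * h ^+ e <= 1 by rewrite hE ler_pdivrMr // mul1r.
  have -> : u%:R * (h ^+ e * h ^+ 4 * 8) = u%:R * h ^+ e * 2^-1.
    by rewrite -mulrA mulrA; congr (_ * _); rewrite /h; field.
  move: hh p2; lra.
have tail : ((2 ^ (16 * m)) ^ k.+1)%:R * (((2 ^ (16 * m)) ^ k.+1 * 2 ^ k * (2 * fsize F))%:R *
    ((fsize F * fdepth F)%:R * (h ^+ a) ^+ u)) < 2^-1 :> R.
  rewrite -exprM hE !mulrA -!natrM ltr_pdivrMr // ltr_pdivlMl // -natrM ltr_nat.
  apply: (@leq_ltn_trans (2 * (2 ^ (16 * m * k.+1) * (2 ^ (16 * m * k.+1) * 2 ^ k * (2 * 2 ^ w)) * (2 ^ w * 2 ^ fdepth F)))).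
    rewrite -!expnM leq_mul2l /= !leq_mul //; exact/ltnW/ltn_expl.
  rewrite -expnS -!expnD -expnS ltn_exp2l //; lia.
have small : 2 * blowup k (Lam k (fdepth F) u (h ^+ (a + e + 4))) (fdepth F * w).+1 ^+ k.+1 <= (2 ^ m)%:R.
  set D := (_ * w).+1 in hD *; set d := fdepth F in hm *; set b := (a + e + 4)%N in hm *.
  have hL : Lam k d u (h ^+ b) <= (2 ^ ((k + u) * k + 1 + (1 + b * d) * k))%:R.
    rewrite /Lam -exprM hE invrK -natrM -natrX -natrM ler_nat -expnS -!expnM expnD leq_mul2r.
    apply/orP; right; rewrite expnD expn1 muln2 -addnn leq_add2l.
    by rewrite expn_gt0.
  have L0 : 0 <= Lam k d u (h ^+ b) by rewrite /Lam mulr_ge0 // exprn_ge0 // divr_ge0 // exprn_ge0 // ltW.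
  move: (Lam k d u _) L0 hL => L L0 hL.
  have hB : blowup k L D <= (2 ^ (2 * q + 3 * k + 2 * ((k + u) * k + 1 + (1 + b * d) * k)))%:R.
    have hD' : D%:R <= (2 ^ q)%:R :> R by rewrite ler_nat.
    have -> : (2 ^ (2 * q + 3 * k + 2 * ((k + u) * k + 1 + (1 + b * d) * k)))%:R =
        (2 ^ q)%:R * (2 ^ k)%:R ^+ 2 * ((2 ^ ((k + u) * k + 1 + (1 + b * d) * k))%:R ^+ 2 * (2 ^ q)%:R * (2 ^ k)%:R) :> R.
      rewrite -!natrX -!natrM; congr _%:R; rewrite -!expnM -!expnD; congr (2 ^ _)%N.
      by clear; move: ((k + u) * k + 1 + _)%N => x; lia.
    rewrite /blowup /kap !ler_pM ?mulr_ge0 ?exprn_ge0 //.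
  apply: (@le_trans _ _ (2 * ((2 ^ (2 * q + 3 * k + 2 * ((k + u) * k + 1 + (1 + b * d) * k)))%:R ^+ k.+1))).
    by rewrite ler_pM2l // lerXn2r // nnegrE // /blowup /kap !mulr_ge0 // ?exprn_ge0.
  by rewrite -natrX -natrM -expnM -expnS ler_nat leq_exp2l // -addn1.
have := formula_bound (r := r) (g := h ^+ a) (eps := h ^+ m) st hF hn hw _ _ rate u0 _ _ _ hr tail.
move=> H; have {}H : 1 <= 2 * blowup k (Lam k (fdepth F) u (h ^+ (a + e + 4))) (fdepth F * w).+1 ^+ k.+1 *
   (fsize F)%:R * (h ^+ m) ^+ r.
  apply: H.
  - by move: p2 (hgt (a + e + 4)%N); lra.
  - by rewrite hgt hle.
  - by rewrite hgt hle.
  - by rewrite -exprM mulnC hE.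
  - by rewrite leq_exp2l // -addn3.
rewrite -(ler_nat R) natrM -[leLHS]mul1r -ler_pdivlMr //.
apply: le_trans H _; rewrite -exprM (hE (m * r)%N) ler_pM2r ?invr_gt0 //.
by rewrite ler_wpM2r.
Qed.

(** * Parameters in terms of log n and log log n *)

Section Scales.
Local Open Scope nat_scope.

Lemma expn4_le_exp2 x : 16 <= x -> x ^ 4 <= 2 ^ x.
Proof.
elim: x => // x IH; rewrite leq_eqVlt ltnS => /predU1P[<- //|hx].
apply: leq_trans (_ : 2 * x ^ 4 <= _); last by rewrite [2 ^ _]expnS leq_mul2l IH.
rewrite !expnS !expn0 !muln1; have : 16 * (x * (x * x)) <= x * (x * (x * x)) by rewrite leq_mul2r hx orbT.
have : 16 * (x * x) <= x * (x * x) by rewrite leq_mul2r hx orbT.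
nia.
Qed.

(** With l = log n and x = log log n, rounded down, take u about l / x^4 and a = x^6: then a u is
    about l x^2 and beats the union bound, of order l x. The loss has exponent of order (u + x^6 d)
    x^2 for depth d, which is O(l / x^2) because d is at most 2 l / x^12. *)
Lemma formula_size_scales k n l x r (s t : 'I_n) (F : formula ('I_n * 'I_n)) :
  s != t -> solves_stconn k s t F -> 20 * 20 * 20 <= x -> 2 ^ x <= l < 2 ^ x.+1 -> 2 ^ l <= n ->
  k <= x -> fdepth F * x ^ 12 <= 2 * l -> fsize F <= 2 ^ (l.+1 * x) -> 2 ^ (r + 4) <= k - 2 ->
  2 ^ (l %/ 20 * r) <= 2 ^ (l %/ 20) * fsize F.
Proof.
move=> st hF hx /andP[lx1 lx2] hn hk hd hw hr.
have x4 : x ^ 4 <= l by apply: leq_trans lx1; apply: expn4_le_exp2; apply: leq_trans hx.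
have x0 : 0 < x by apply: leq_trans hx.
have x3 : 20 * 20 * 20 * x ^ 3 <= l by apply: leq_trans x4; rewrite (expnS x 3) leq_mul2r hx orbT.
pose u := l %/ x ^ 4; set m := l %/ 20.
have x40 : 0 < x ^ 4 by rewrite expn_gt0 x0.
have u0 : 0 < u by rewrite divn_gt0.
have u1 : u * x ^ 4 <= l by exact: leq_trunc_div.
have u2 : l <= 2 * u * x ^ 4.
  apply: leq_trans (ltnW (ltn_ceil l x40)) _; rewrite leq_mul2r -/u; apply/orP; right; lia.
have m1 : m * 20 <= l by exact: leq_trunc_div.
have m2 : l < m.+1 * 20 by exact: ltn_ceil.
have xl : 20 * 20 * 20 * x <= l by apply: leq_trans x3; rewrite leq_mul2l (expnS x 2) leq_pmulr ?orbT // expn_gt0 x0.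
have dl : 20 * 20 * 20 * (fdepth F * x ^ 8) <= 2 * l.
  apply: leq_trans hd; rewrite mulnCA leq_mul2l; apply/orP; right.
  apply: leq_trans (leq_mul hx (leqnn _)) _; rewrite -expnS; exact: leq_pexp2l.
have d1 : fdepth F <= l.
  have : fdepth F * 1 <= fdepth F * x ^ 8 by rewrite leq_mul2l expn_gt0 x0 orbT.
  move: dl; nat_lia.
have bound3 : 32 * m * k.+1 + k + 2 * (l.+1 * x) + fdepth F + 3 <= x ^ 6 * u.
  have e1 : 32 * m * k.+1 <= 4 * (l * x).
    apply: (@leq_trans (32 * m * (2 * x))); first by rewrite leq_mul2l; apply/orP; right; nat_lia.
    have : m * 20 * x <= l * x by rewrite leq_mul2r m1 orbT.
    nat_lia.
  have e2 : 20 * 20 * 20 * u * x ^ 4 * x <= x ^ 6 * u.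
    have -> : x ^ 6 * u = x * (u * x ^ 4 * x) by rewrite (expnD x 4 2) (expnS x 1) expn1; nat_lia.
    by rewrite -!mulnA mulnA mulnA leq_mul2r hx orbT.
  have e3 : l * x <= 2 * u * x ^ 4 * x by rewrite leq_mul2r u2 orbT.
  have e4 : l * 1 <= l * x by rewrite leq_mul2l x0 orbT.
  nat_lia.
(* [x.+1] bounds log u and [3 * x + 6] the logarithm of the depth of the binary tree. Taking [m] as
   [l %/ 20] leaves room for [k + 1] layers, since [16 m + k <= l]. *)
apply: (@formula_size_exponents k n m (l.+1 * x) u (x ^ 6) x.+1 (3 * x + 6) r s t F) => //.
- apply: leq_trans hn; apply: (@leq_trans (2 ^ k * 2 ^ (16 * m))); first by rewrite leq_mul2r ltn_expl ?orbT.
  rewrite -expnD leq_exp2l //; nat_lia.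
- rewrite u0; apply: leq_trans (ltnW lx2); apply: leq_trans u1; exact: leq_pmulr.
- nat_lia.
- apply: (@leq_trans (2 * l ^ 3).+1).
    rewrite ltnS !expnS expn0 muln1; apply: (@leq_trans (l * (2 * l * l))); last nat_lia.
    apply: leq_mul => //; apply: leq_mul; nat_lia.
  apply: (@leq_trans (2 * (2 ^ x.+1) ^ 3)); first by rewrite ltn_pmul2l // ltn_exp2r.
  rewrite -expnM -expnS leq_exp2l //; nat_lia.
- have e1 : 20 * 20 * 20 * (u * x ^ 2) <= l.
    apply: leq_trans u1; rewrite mulnCA leq_mul2l; apply/orP; right.
    by rewrite (expnD x 2 2) leq_mul2r (leq_trans hx) ?orbT // -[x in x <= _]expn1 leq_pexp2l.
  have e2 : x ^ 6 + x.+1 + 4 <= 2 * x ^ 6.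
    have : x * (20 * 20 * 20) <= x * x ^ 5.
      by rewrite leq_mul2l (leq_trans hx) ?orbT // (expnS x 4) leq_pmulr.
    by rewrite -expnS; move: hx; nat_lia.
  have e3 : x * 1 <= x * x by rewrite leq_mul2l x0 orbT.
  have e4 : x * x * 1 <= x * x * x by rewrite leq_mul2l x0 orbT.
  have dE : fdepth F * x ^ 8 = fdepth F * x ^ 6 * (x * x) by rewrite (expnD x 6 2) (expnS x 1) expn1 mulnA.
  move: (fdepth F) dE dl => d ->; move: (x ^ 6) e2 => y e2 dl.
  rewrite (expnS x 1) expn1 in e1; rewrite !expnS expn0 muln1 in x3.
  have e5 : (k + u) * k + 1 + (1 + (y + x.+1 + 4) * d) * k <= (x + u) * x + 1 + (1 + 2 * y * d) * x.
    rewrite leq_add ?leq_add2r ?leq_mul ?leq_add2r ?leq_add2l ?leq_mul //.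
  apply: (@leq_trans ((9 * x + 12 + 2 * ((x + u) * x + 1 + (1 + 2 * y * d) * x)) * (2 * x) + 1)).
    rewrite leq_add2r; apply: leq_mul; last by nat_lia.
    rewrite leq_add ?leq_mul2l //; nat_lia.
  rewrite -ltnS -(ltn_pmul2r (isT : 0 < 20)); apply: leq_ltn_trans m2.
  clear - x0 e1 x3 dl e3 e4; nat_lia.
Qed.

End Scales.

(** * A linear lower bound for small distances *)

Section Variables.
Variable V : eqType.
Implicit Types F : formula V.

Fixpoint fvars F : seq V :=
  match F with
  | Const _ => [::]
  | Lit _ x => [:: x]
  | And m fs | Or m fs => flatten [seq fvars (fs i) | i <- enum 'I_m.+1]
  end.

Lemma size_fvars F : (size (fvars F) <= fsize F)%N.
Proof.
elim: F => [b|b x|m fs IH|m fs IH] //=; rewrite size_flatten sumnE /shape 2!big_map big_enum; exact: leq_sum.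
Qed.

Lemma feval_fvars (a b : V -> bool) F : {in fvars F, a =1 b} -> feval a F = feval b F.
Proof.
have sub m (fs : 'I_m.+1 -> formula V) i : {subset fvars (fs i) <= flatten [seq fvars (fs i) | i <- enum 'I_m.+1]}.
  by move=> x hx; apply/flatten_mapP; exists i; rewrite ?mem_enum.
elim: F => [c|c x|m fs IH|m fs IH] //= h.
- by rewrite h ?mem_head.
- by apply: eq_forallb => i; apply: IH => x /sub; apply: h.
- by apply: eq_existsb => i; apply: IH => x /sub; apply: h.
Qed.

End Variables.

(** For every other vertex [v], deleting the edge from [s] to [v] in the graph consisting of the
    path s, v, t changes the answer, so this variable occurs in [F]. *)
Lemma stconn_fsize k n (s t : 'I_n) (F : formula ('I_n * 'I_n)) :
  (1 < k)%N -> s != t -> solves_stconn k s t F -> (n - 2 <= fsize F)%N.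
Proof.
move=> k1 st hF; apply: leq_trans (size_fvars F).
have key v : v \notin [set s; t] -> (s, v) \in fvars F.
  rewrite !inE negb_or => /andP[vs vt]; apply: contraT => hv.
  pose e b : rel 'I_n := fun x y => (b && (x == s) && (y == v)) || ((x == v) && (y == t)).
  have : stconn k s t (e true) by exists [:: v; t]; rewrite /= /e !eqxx /= orbT.
  move/(hF (e true)); rewrite (@feval_fvars _ _ (fun uv => e false uv.1 uv.2)).
    move/(hF (e false)) => [[|y p] [/= hp hl _]]; first by rewrite hl eqxx in st.
    by move: hp; rewrite /e /= eq_sym (negPf vs).
  move=> [x y] /= hxy; rewrite /e /= orb_idl // => /andP[/eqP xs /eqP yv].
  by case/negP: hv; rewrite -xs -yv.
have := @uniq_leq_size _ [seq (s, v) | v in ~: [set s; t]] (fvars F).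
rewrite size_map -cardE cardsCs setCK card_ord cards2 st; apply.
  by rewrite map_inj_uniq ?enum_uniq // => v v' [].
by move=> y /mapP[v]; rewrite mem_enum inE => /key ? ->.
Qed.

From mathcomp Require Import all_classical all_reals all_analysis.
Import numFieldNormedType.Exports.

(** * From powers of two to real exponents *)

Section Log.
Variable R : realType.
Implicit Types (x y : R) (n l : nat).

Let ln2 : 0 < ln 2 :> R. Proof. by rewrite ln_gt0 // ltr1n. Qed.

Lemma log2_exp l : log2 (2 ^+ l) = l%:R :> R.
Proof. by rewrite /log2 lnXn // -[ln 2 *+ l]mulr_natl mulfK // gt_eqF. Qed.

Lemma log2_le x y : 0 < x -> x <= y -> log2 x <= log2 y.
Proof.
move=> x0 xy; rewrite /log2 ler_pM2r ?invr_gt0 // ler_ln ?posrE //; exact: lt_le_trans xy.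
Qed.

Lemma log2_lt x y : 0 < x -> x < y -> log2 x < log2 y.
Proof.
move=> x0 xy; rewrite /log2 ltr_pM2r ?invr_gt0 // ltr_ln ?posrE //; exact: lt_trans xy.
Qed.

Lemma log2_le_nat n : log2 n%:R <= n%:R :> R.
Proof.
case: n => [|n]; first by rewrite /log2 ln0 ?mul0r.
have h : n.+1%:R <= (2 ^ n.+1)%:R :> R by rewrite ler_nat ltnW // ltn_expl.
apply: le_trans (log2_le _ h) _; first by rewrite ltr0n.
by rewrite natrX log2_exp.
Qed.

Lemma trunc_log_log2 n : (0 < n)%N ->
  (trunc_log 2 n)%:R <= log2 n%:R :> R /\ log2 n%:R < (trunc_log 2 n).+1%:R :> R.
Proof.
move=> n0; have /andP[h1 h2] := trunc_log_bounds (isT : (1 < 2)%N) n0.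
split.
  by rewrite -log2_exp; apply: log2_le; rewrite -natrX ?ler_nat // ltr0n expn_gt0.
by rewrite -(log2_exp _.+1); apply: log2_lt; rewrite -?natrX ?ltr_nat ?ltr0n.
Qed.

Lemma log2_ge0 k : 0 <= log2 k%:R :> R.
Proof.
case: k => [|k]; first by rewrite /log2 ln0 ?mul0r.
by apply: le_trans (log2_le ltr01 _); rewrite ?ler1n // /log2 ln1 mul0r.
Qed.

Lemma powR_half_le n : (4 <= n)%N -> n%:R `^ 2^-1 <= (n - 2)%:R :> R.
Proof.
move=> n4; rewrite powR12_sqrt // -(ger0_norm (ler0n R (n - 2))) -sqrtr_sqr.
by rewrite ler_sqrt ?exprn_ge0 // -natrX ler_nat !expnS expn0 muln1; nia.
Qed.

Lemma powR_exp2_le n l m K (y : R) : 0 <= y -> y < K.+1%:R -> (12 <= K)%N -> (n <= 2 ^ l)%N ->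
  (l <= 40 * m)%N -> n%:R `^ (120^-1 * y) <= (2 ^ (m * (K - 6)))%:R.
Proof.
move=> y0 yK K12 nl lm.
apply: le_trans (_ : (2 `^ (40 * m)%:R) `^ (120^-1 * y) <= _).
  apply: ge0_ler_powR; rewrite ?nnegrE ?powR_ge0 ?mulr_ge0 // powR_mulrn // -natrX ler_nat.
  by apply: leq_trans nl _; rewrite leq_exp2l.
rewrite -powRrM natrX -powR_mulrn //; apply: ler_powR; first by rewrite ler1n.
(* The left side is y / 3, below (K + 1) / 3, and this is at most K - 6 for K >= 12. *)
have e : 120^-1 * y * 40 <= (K - 6)%:R.
  rewrite natrB; last by rewrite (leq_trans _ K12).
  have : 12%:R <= K%:R :> R by rewrite ler_nat.
  by move: yK; rewrite -natr1; lra.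
by rewrite natrM natrM mulrAC mulrC ler_wpM2l // mulrC.
Qed.

(** Of the [5] doublings given up, four cover stuck ends and one the two edges at the fixed
    vertices. *)
Lemma exp2_trunc_log_sub k : (12 <= trunc_log 2 k)%N -> (2 ^ (trunc_log 2 k - 5 + 4) <= k - 2)%N.
Proof.
move=> K12; have k0 : (0 < k)%N by case: k K12 => //; rewrite trunc_log0.
have := trunc_logP (isT : (1 < 2)%N) k0; move: K12; move: (trunc_log 2 k) => [|[|j]] // K12.
rewrite (_ : j.+2 - 5 + 4 = j.+1)%N; last by lia.
by have := ltn_expl j (isT : (1 < 2)%N); rewrite !expnS; lia.
Qed.

(** For bounded [k] the exponent is at most 1/2 and the linear bound suffices. A formula larger than
    n^x, with x the rounded log log n, is large enough because log k <= k <= x. The remaining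
    formulas have logarithmic size at most [l.+1 * x], as the choice of parameters requires. *)
Lemma stconn_formula_size k n (s t : 'I_n) (F : formula ('I_n * 'I_n)) :
  s != t -> solves_stconn k s t F -> (20 * 20 * 20 <= trunc_log 2 (trunc_log 2 n))%N ->
  k%:R <= log2 (log2 n%:R) :> R ->
  (fdepth F)%:R <= log2 n%:R / (log2 (log2 n%:R)) `^ 12 :> R ->
  n%:R `^ (120^-1 * log2 k%:R) <= (fsize F)%:R :> R.
Proof.
move=> st hF hx hk hd.
set l := trunc_log 2 n in hx; set x := trunc_log 2 l in hx.
have x0 : (0 < x)%N by apply: leq_trans hx.
have l0 : (0 < l)%N by rewrite lt0n; apply: contraTneq x0 => l0; rewrite /x l0 trunc_log0.
have n0 : (0 < n)%N by rewrite lt0n; apply: contraTneq l0 => n0; rewrite /l n0 trunc_log0.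
have [L1 L2] := trunc_log_log2 n0; have [X1 X2] := trunc_log_log2 l0.
rewrite -/l in L1 L2; rewrite -/x in X1 X2.
have /andP[n1 n2] := trunc_log_bounds (isT : (1 < 2)%N) n0; rewrite -/l in n1 n2.
have lx := trunc_log_bounds (isT : (1 < 2)%N) l0; rewrite -/x /= in lx.
have /andP[l1 l2] := lx.
have nR : 1 <= n%:R :> R by rewrite ler1n.
have M1 : x%:R <= log2 (log2 n%:R) :> R.
  by apply: le_trans X1 _; apply: log2_le; rewrite ?ltr0n.
have M2 : log2 (log2 n%:R) < x.+1%:R :> R.
  rewrite -(log2_exp x.+1); apply: log2_lt.
    by apply: lt_le_trans L1; rewrite ltr0n.
  by apply: lt_le_trans L2 _; rewrite -natrX ler_nat.
have kx : (k <= x)%N by rewrite -ltnS -(ltr_nat R); exact: le_lt_trans M2.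
have dx : (fdepth F * x ^ 12 <= 2 * l)%N.
  have : (fdepth F * x ^ 12 < l.+1)%N.
    rewrite -(ltr_nat R); apply: le_lt_trans L2.
    move: hd; rewrite powR_mulrn; last by apply: le_trans M1.
    rewrite ler_pdivlMr ?exprn_gt0 //; last by apply: lt_le_trans M1; rewrite ltr0n.
    apply: le_trans; rewrite natrM natrX ler_wpM2l // lerXn2r // nnegrE //.
    by apply: le_trans M1.
  by rewrite ltnS => h; apply: leq_trans h _; rewrite leq_pmull.
have [k2|k2] := ltnP k 2.
  have -> : log2 k%:R = 0 :> R.
    have [->|->] : k = 0%N \/ k = 1%N by case: (k) k2 => [|[]]; auto.
      by rewrite /log2 ln0 ?mul0r.
    by rewrite /log2 ln1 mul0r.
  by rewrite mulr0 powRr0 ler1n fsize_gt0.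
have [_ K2] := trunc_log_log2 (ltnW k2 : 0 < k)%N; have kR := log2_ge0 k.
have [K12|K12] := ltnP (trunc_log 2 k) 12.
  apply: le_trans (_ : n%:R `^ 2^-1 <= _).
    apply: ler_powR => //.
    have : (trunc_log 2 k).+1%:R <= 12%:R :> R by rewrite ler_nat.
    by move: K2; lra.
  apply: le_trans (powR_half_le _) _; last by rewrite ler_nat (stconn_fsize k2 st hF).
  apply: (@leq_trans (2 ^ 2)) => //; apply: leq_trans n1; rewrite leq_exp2l //; apply: leq_trans l1.
  by rewrite -[leqLHS]expn1 leq_exp2l.
have [hw|hw] := ltnP (2 ^ (l.+1 * x)) (fsize F).
  apply: le_trans (_ : n%:R `^ x%:R <= _).
    apply: ler_powR => //; have : log2 k%:R <= x%:R :> R.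
      by apply: le_trans (log2_le_nat k) _; rewrite ler_nat.
    by move: kR; lra.
  rewrite powR_mulrn // -natrX ler_nat; apply: leq_trans (ltnW hw).
  by rewrite expnM leq_exp2r // ltnW.
have := formula_size_scales st hF hx lx n1 kx dx hw (exp2_trunc_log_sub K12).
have m2 : (l.+1 <= 40 * (l %/ 20))%N.
  have : (20 <= l)%N.
    apply: leq_trans l1; apply: leq_trans (ltnW (ltn_expl x (isT : (1 < 2)%N))).
    by apply: leq_trans hx; rewrite -mulnA leq_pmulr.
  by clear; lia.
move: (l %/ 20)%N m2 => m m2; rewrite -(subnSK (_ : 5 < _)%N) ?(leq_trans _ K12) //.
rewrite mulnS expnD leq_pmul2l ?expn_gt0 // => H.
apply: le_trans (powR_exp2_le kR K2 K12 (ltnW n2) m2) _.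
by rewrite ler_nat.
Qed.

End Log.

Local Open Scope classical_set_scope.
Local Open Scope ring_scope.

Theorem theorem2p1 (R : realType) :
  exists C c : R, [/\ 0 < C, 0 < c &
    forall k : nat -> nat,
      (forall n : nat, (k n <= n)%N) ->
      (\forall n \near \oo, (k n)%:R <= log2 (log2 n%:R) :> R) ->
      \forall n \near \oo,
        forall (s t : 'I_n) (F : formula ('I_n * 'I_n)),
          s != t ->
          solves_stconn (k n) s t F ->
          (fdepth F)%:R <= log2 n%:R / (log2 (log2 n%:R)) `^ C :> R ->
          n%:R `^ (c * log2 (k n)%:R) <= (fsize F)%:R :> R].
Proof.
(* The exponent [12] comes from [formula_size_scales]. The factor 120 is 40 * 3: log n is at most 40
   [m], and a third of log k still fits below the exponent obtained. *)
exists 12, 120^-1; split; rewrite ?invr_gt0 ?ltr0n // => k _ hk.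
(* [X] is made abstract so that the doubly exponential threshold is never computed. *)
have [X hX] : exists X, (20 * 20 * 20 <= X)%N by exists (20 * 20 * 20)%N.
have large := nbhs_infty_ge (2 ^ (2 ^ X)).
near=> n => s t F st hF hd; apply: (stconn_formula_size st hF _ _ hd).
  apply: leq_trans hX _; do 2![apply: trunc_log_max => //].
  by near: n.
by near: n.
Unshelve. all: by end_near.
Qed.
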